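(* Let $m$ be a positive integer and assume the standard conditions hold. Assume moreover (i) $h(t)\sim\lambda t^{-1}\log t$ as $t\to\infty$ for some $\lambda>0$; (ii) $h$ is smoothly varying (necessarily of index $-1$) of order $m$. Then for every positive integer $k\le m$, as $t\to\infty$, $$\overline G(t)=\sum_{i\in\mathbb Z}\mathbb I\{c_i\succeq c_{(1)}e^{-k/\lambda}\}\,\big(\mathsf L_{G\natural\mathsf M_{c_i}F,\;k+\lfloor\lambda\log|c_i/c_{(1)}|\rfloor}\,\overline{\mathsf M_{c_i}F}\big)(t)+o\big(h(t)^k\,\overline{\mathsf M_{c_{(1)}}F}(t)\big),$$ where $\lfloor\cdot\rfloor$ denotes the integer part and $\mathbb I$ the indicator function.
   Context: Let $(X_i)_{i\in\mathbb Z}$ be independent random variables with common distribution function $F$. Let $(c_i)_{i\in\mathbb Z}$ be real weights tending to $0$ at infinity, and let $G$ be the distribution function of $\sum_{i\in\mathbb Z}c_iX_i$. For a distribution function $K$ write $\overline K=1-K$. For a real $c$, $\mathsf M_cK$ denotes the distribution function of $cY$ when $Y$ has distribution $K$; thus $\overline{\mathsf M_cK}(t)=\overline K(t/c)$ for $c>0$, and $\mathsf M_0K$ is the point mass at $0$. The hazard rate of $F$ is $h=F'/\overline F$, assumed to exist for all large $t$, so that $\overline F(t)=\overline F(t_0)\exp(-\int_{t_0}^t h(u)\,du)$ for $t\ge t_0$. $F$ is tail balanced if $\overline F(t)/F(-t)$ has a positive finite limit as $t\to\infty$; then $h_-$ denotes the hazard rate of $\mathsf M_{-1}F$. $F$ is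 strongly tail balanced if it is tail balanced and every property assumed of $h$ is also satisfied by $h_-$. The standard conditions are: $\sum_{i\in\mathbb Z}|c_i|^\delta<\infty$ for some $\delta\in(0,1)$, and either $F$ vanishes on a neighborhood of $-\infty$ or $F$ is strongly tail balanced. A function $h$ is smoothly varying of index $\alpha$ and order $m$ (written $h\in SR_{\alpha,m}$) if it is ultimately $m$ times continuously differentiable and $h^{(m)}$ is regularly varying of index $\alpha-m$. Ordering of reals: $a\prec b$ means $\overline{\mathsf M_aF}=o(\overline{\mathsf M_bF})$ at infinity; $a\equiv b$ means there is $\epsilon>0$ with $\epsilon\overline{\mathsf M_aF}\le\overline{\mathsf M_bF}\le\epsilon^{-1}\overline{\mathsf M_aF}$ ultimately; $a\preceq b$ means $a\prec b$ or $a\equiv b$; $a\succ b$, $a\succeq b$ are the reverse relations. $(c_{(i)})_{i\ge1}$ denotes the weights $(c_i)$ listed in nonincreasing $\prec$-order without multiplicity; in particular $c_{(1)}$ is a $\prec$-maximal weight. For a distribution $K$ with $m$ finite moments $\mu_{K,i}=\int x^i\,dK(x)$, its Laplace character of order $m$ is the differential operator $\mathsf L_{K,m}=\sum_{0\le i\le m}\frac{(-1)^i}{i!}\mu_{K,i}\mathrm D^i$, where $\mathrm D$ denotes differentiation (and $\mathrm D^0$ the identity). $G\natural\mathsf M_{c_i}F$ denotes the distribution of $\sum_{j\in\mathbb Z\setminus\{i\}}c_jX_j$. *)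

(* Defs.v *)
From HB Require Import structures.
From mathcomp Require Import all_boot all_order all_algebra.
From mathcomp Require Import all_classical all_reals all_analysis.
Set Implicit Arguments. Unset Strict Implicit. Unset Printing Implicit Defensive.
Import Order.TTheory GRing.Theory Num.Theory.
Import numFieldNormedType.Exports.
Local Open Scope classical_set_scope.
Local Open Scope ring_scope.

Section Defs.
Context {R : realType}.

Definition littleo_infty (f g : R -> R) : Prop :=
  forall e : R, 0 < e -> \forall t \near +oo, `|f t| <= e * `|g t|.

(* [g] is regularly varying of index [rho] at infinity (g may be eventually
   negative: g is eventually nonzero and g(x t)/g(t) -> x^rho for all x > 0) *)
Definition regularly_varying (g : R -> R) (rho : R) : Prop :=
  (\forall t \near +oo, g t != 0) /\
  forall x : R, 0 < x -> (g (x * t) / g t) @[t --> +oo] --> x `^ rho.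

Definition ultimately_Cn (m : nat) (h : R -> R) : Prop :=
  exists t0 : R,
    (forall j : nat, (j < m)%N -> forall t, t0 < t -> derivable (derive1n j h) t 1)
    /\ forall t, t0 < t -> {for t, continuous (derive1n m h)}.

Definition smoothly_varying (alpha : R) (m : nat) (h : R -> R) : Prop :=
  ultimately_Cn m h /\ regularly_varying (derive1n m h) (alpha - m%:R).

Definition hazard_rate (K h : R -> R) : Prop :=
  exists t0 : R, forall t, t0 <= t ->
    [/\ derivable K t 1, 0 < 1 - K t & h t = derive1 K t / (1 - K t)].

Definition hazard_log_asymp (lambda : R) (h : R -> R) : Prop :=
  (h t / (lambda * ln t / t)) @[t --> +oo] --> (1 : R).

Context {d : measure_display} {T : measurableType d} (P : probability T R).

Definition prob (A : set T) : R := fine (P A).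

Definition dfun (Y : T -> R) (t : R) : R := prob [set w | Y w <= t].

Definition mutually_independent (X : int -> T -> R) : Prop :=
  forall (s : seq int) (B : int -> set R), uniq s ->
    (forall i, measurable (B i)) ->
    P (\bigcap_(i in [set` s]) (X i @^-1` B i)) = (\prod_(i <- s) P (X i @^-1` B i))%E.

(* bar{M_c F}(t) = P(c Y > t) where Y has distribution F *)
Definition tailM (Y : T -> R) (c t : R) : R := prob [set w | c * Y w > t].

Definition wprec (Y : T -> R) (a b : R) : Prop :=
  littleo_infty (tailM Y a) (tailM Y b).
Definition wequiv (Y : T -> R) (a b : R) : Prop :=
  exists2 e : R, 0 < e & \forall t \near +oo,
    e * tailM Y a t <= tailM Y b t /\ tailM Y b t <= e^-1 * tailM Y a t.
Definition wpreceq (Y : T -> R) (a b : R) : Prop := wprec Y a b \/ wequiv Y a b.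
Definition wsucceq (Y : T -> R) (a b : R) : Prop := wpreceq Y b a.

Definition wpsum (c : int -> R) (X : int -> T -> R) (excl : option int)
    (n : nat) (w : T) : R :=
  \sum_(k < (2 * n).+1)
    (let j := (k%:Z - n%:Z)%R in if excl == Some j then 0 else c j * X j w).

Definition wseries (c : int -> R) (X : int -> T -> R) (excl : option int) (w : T) : R :=
  limn (fun n => wpsum c X excl n w).

Definition rv_moment (Y : T -> R) (j : nat) : R := fine (\int[P]_w ((Y w) ^+ j)%:E).

End Defs.

(* Laplace character of order n (an integer; the empty operator if n < 0)
   of a distribution with rv_moment sequence mu, applied to f, evaluated at t *)
Definition laplace_char {R : realType} (mu : nat -> R) (n : int) (f : R -> R) (t : R) : R :=
  if (0 <= n)%R then
    \sum_(i < (absz n).+1)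
      ((-1) ^+ i / (i`!)%:R * mu i * derive1n i f t)
  else 0.

(* Main.v *)
(** One big jump.  The tail [H] of [X_0] satisfies [ln H(t) ~ - lambda (ln t)^2 / 2],
    so it decays faster than every power of [t], while [H(t/theta) / H(t)] equals
    [t^(- lambda ln(1/theta) + o(1))].  Hence, up to [o(h(t)^k H(t/|c_(1)|))], the event
    that the series exceeds [t] is the disjoint union, over finitely many indices [i],
    of the events [c_i X_i + S_i > t, |S_i| <= t/2], where [S_i] is the sum of the
    other terms: the tail of the series outside a finite window is controlled by the
    summability of [|c_i|^delta], and two simultaneous big jumps cost a product of
    two tails.

    By independence each such probability is the integral of [H_i(t - s)] against
    the law of [S_i] on [|s| <= t/2], [H_i] being the tail of [c_i X_i].  The Taylor
    expansion of [H_i] at [t] gives the Laplace character.  Its remainder, divided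
    by [(h^n H_i)(t)], tends to 0 pointwise in [s] and is dominated by a polynomial
    in [s], because [H_i(t - s) / H_i(t)] is at most polynomial in [s] on
    [|s| <= t/2]; all moments of [S_i] are finite.  The orders [k + floor(...)] are
    those for which [h^n H_i] is still not negligible before [h^k H(t/|c_(1)|)]. *)
Require Import Defs.
From HB Require Import structures.
From mathcomp Require Import all_boot all_order all_algebra.
From mathcomp Require Import all_classical all_reals all_analysis.
From mathcomp Require Import measurable_realfun.
From mathcomp Require Import ring lra zify.
Set Implicit Arguments. Unset Strict Implicit. Unset Printing Implicit Defensive.
Import Order.TTheory GRing.Theory Num.Theory.
Import numFieldNormedType.Exports.
Local Open Scope classical_set_scope.
Local Open Scope ring_scope.

(** * Derivatives of the hazard rate and of the tail *)

Section Eventually.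
Context {R : realType}.
Implicit Types (f g h : R -> R).

(** The factor [ln t] of the hazard rate drives every estimate. It makes [h'] negligible before
    [h^2], so that the [j]-th derivative of the tail [H] is equivalent to [(-1)^j h^j H], with no
    other constant. It also bounds [H(t / theta)] by [theta^p H(t)] for any given [p] and all large
    [t], uniformly in [theta <= 1]; this uniformity lets a union bound over infinitely many weights
    cost no more than a single tail. The domination of the Taylor remainder is found on a
    logarithmic scale: the derivative of [ln ((ln t / t)^n H)] is [O(ln t / t)], and [|s| ln t / t]
    is at most [ln (1 + |s|) + 1] on [|s| <= t/2], so that exponentiating gives a polynomial in [s].
    The order on the weights is defined through tails. Tail balance turns it, up to constants that
    every little-o absorbs, into the order of the absolute values. A weight strictly below the
    maximal one is expanded to an order less than [k], which leaves one spare derivative to make its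
    error negligible. *)

Lemma near_ooP (Q : R -> Prop) :
  (\forall t \near +oo, Q t) <-> exists2 T : R, 1 <= T & forall t, T <= t -> Q t.
Proof.
split=> [[M [_ MQ]]|[T _ TQ]].
  exists (Num.max 1 (M + 1)); first by rewrite le_max lexx.
  by move=> t; rewrite ge_max => /andP[_ Mt]; apply: MQ; lra.
by exists T; split; [exact: num_real|move=> t Tt; apply: TQ; exact: ltW].
Qed.

(** With [a = 1/2] this controls all the points [t - s], [|s| <= t/2], at once. *)
Lemma near_oo_ge (Q : R -> Prop) (a : R) : 0 < a ->
  (\forall t \near +oo, Q t) -> \forall t \near +oo, forall u, a * t <= u -> Q u.
Proof.
move=> a0 /near_ooP[T T1 QT]; apply/near_ooP; exists (Num.max 1 (T / a)).
  by rewrite le_max lexx.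
move=> t; rewrite ge_max => /andP[t1 Tt] u tu; apply: QT; apply: le_trans tu.
by rewrite mulrC -ler_pdivrMr.
Qed.

Lemma near_pinfty_ge (a : R) : \forall t \near +oo, a <= t.
Proof. by apply: nbhs_pinfty_ge; exact: num_real. Qed.

Lemma near_oo_scale (Q : R -> Prop) (a : R) : 0 < a ->
  (\forall t \near +oo, Q t) -> \forall t \near +oo, Q (a * t).
Proof.
by move=> a0 /(near_oo_ge a0); apply: filterS => t; apply.
Qed.

Lemma near_oo_nbhs (Q : R -> Prop) :
  (\forall t \near +oo, Q t) -> \forall t \near +oo, \forall u \near t, Q u.
Proof.
move=> /near_ooP[T T1 QT]; apply/near_ooP; exists (T + 1); first lra.
move=> t Tt; have := @lt_nbhsr R T t (ltac:(lra)).
by apply: filterS => u /ltW; exact: QT.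
Qed.

Lemma derive1_near_oo f g : (\forall t \near +oo, f t = g t) ->
  \forall t \near +oo, derive1 f t = derive1 g t.
Proof.
move=> /near_oo_nbhs; apply: filterS => t fg.
by rewrite !derive1E; apply: near_eq_derive.
Qed.

Lemma derivable_near_oo f g : (\forall t \near +oo, f t = g t) ->
  (\forall t \near +oo, derivable f t 1) -> \forall t \near +oo, derivable g t 1.
Proof.
move=> /near_oo_nbhs fg df; apply: filterS2 fg df => t fgt.
exact: near_eq_derivable.
Qed.

(* [symbol p a b f]: [f^(j) = O((ln t)^a / t^(b+j))] for all [j <= p]. *)
Fixpoint symbol (p : nat) (a b : nat) (f : R -> R) : Prop :=
  (exists C : R, \forall t \near +oo, `|f t| <= C * (ln t ^+ a / t ^+ b)) /\
  if p is p'.+1 then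
    (\forall t \near +oo, derivable f t 1) /\ symbol p' a b.+1 (derive1 f)
  else True.

Lemma symbol_bound p a b f : symbol p a b f ->
  exists2 C : R, 0 < C & \forall t \near +oo, `|f t| <= C * (ln t ^+ a / t ^+ b).
Proof.
move=> fp; have [C HC] : exists C : R, \forall t \near +oo, `|f t| <= C * (ln t ^+ a / t ^+ b).
  by case: p fp => [|p] [].
exists (Num.max 1 C); first by rewrite lt_max ltr01.
near=> t; apply: (@le_trans _ _ (C * (ln t ^+ a / t ^+ b))); first by near: t.
apply: ler_wpM2r; last by rewrite le_max lexx orbT.
have t1 : 1 <= t by near: t; exact: nbhs_pinfty_ge.
by rewrite divr_ge0// exprn_ge0// ?ln_ge0//; lra.
Unshelve. all: by end_near. Qed.

Lemma symbol_near p a b f g : (\forall t \near +oo, f t = g t) ->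
  symbol p a b f -> symbol p a b g.
Proof.
elim: p b f g => [|p IH] b f g fg /=.
  move=> [[C HC] _]; split=> //; exists C; near=> t.
  have <- : f t = g t by near: t.
  by near: t.
move=> [[C HC] [df sf]]; split; [|split].
- exists C; near=> t.
  have <- : f t = g t by near: t.
  by near: t.
- exact: derivable_near_oo df.
- exact: IH (derive1_near_oo fg) sf.
Unshelve. all: by end_near. Qed.

Lemma near_ln_ge1 : \forall t \near +oo, (1 <= t :> R) /\ 1 <= ln t.
Proof.
near=> t; have te : expR 1 <= t by near: t; exact: nbhs_pinfty_ge.
have t0 : 0 < t by apply: lt_le_trans te; exact: expR_gt0.
split; last by rewrite -[1](@expRK R) ler_ln// posrE expR_gt0.
by apply: le_trans te; rewrite -[X in X <= _]expR0 ler_expR.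
Unshelve. all: by end_near. Qed.

Lemma symbolW p p' a a' b f : (p' <= p)%N -> (a <= a')%N ->
  symbol p a b f -> symbol p' a' b f.
Proof.
move=> pp aa sf.
have B p0 (g : R -> R) b' : symbol p0 a b' g ->
   exists C, \forall t \near +oo, `|g t| <= C * (ln t ^+ a' / t ^+ b').
  move=> /symbol_bound[C C0 H]; exists C; near=> t.
  have [t1 lt1] : 1 <= t /\ 1 <= ln t by near: t; exact: near_ln_ge1.
  apply: (@le_trans _ _ (C * (ln t ^+ a / t ^+ b'))); first by near: t.
  rewrite ler_wpM2l ?(ltW C0)// ler_wpM2r ?invr_ge0 ?exprn_ge0// ?(le_trans ler01)//.
  exact: ler_weXn2l.
elim: p p' b f pp sf => [|p IH] [|p'] b f //= pp sf; split=> //.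
- exact: (B 0).
- exact: (B p.+1).
- exact: (B p.+1).
- by case: sf => _ [df sf]; split=> //; exact: IH.
Unshelve. all: by end_near. Qed.

Lemma symbolD p a b f g : symbol p a b f -> symbol p a b g ->
  symbol p a b (fun t => f t + g t).
Proof.
move=> sf sg.
have B : exists C, \forall t \near +oo, `|f t + g t| <= C * (ln t ^+ a / t ^+ b).
  have [C _ HC] := symbol_bound sf; have [D _ HD] := symbol_bound sg.
  exists (C + D); near=> t; rewrite mulrDl (le_trans (ler_normD _ _))// lerD//.
    by near: t.
  by near: t.
elim: p b f g sf sg B => [|p IH] b f g; first by [].
move=> sf sg B; split=> //; case: sf sg => _ [df sf] [_ [dg sg]]; split.
  by apply: filterS2 df dg => t; exact: derivableD.
apply: (@symbol_near _ _ _ (fun t => derive1 f t + derive1 g t)).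
  by apply: filterS2 df dg => t dft dgt; rewrite !derive1E -deriveD.
apply: IH => //.
have [C _ HC] := symbol_bound sf; have [D _ HD] := symbol_bound sg.
exists (C + D); near=> t; rewrite mulrDl (le_trans (ler_normD _ _))// lerD//.
  by near: t.
by near: t.
Unshelve. all: by end_near. Qed.

Lemma symbolM p a b a' b' f g : symbol p a b f -> symbol p a' b' g ->
  symbol p (a + a') (b + b') (fun t => f t * g t).
Proof.
elim: p a b a' b' f g => [|p IH] a b a' b' f g sf sg.
  have [C C0 HC] := symbol_bound sf; have [D D0 HD] := symbol_bound sg.
  split=> //; exists (C * D); near=> t.
  have -> : C * D * (ln t ^+ (a + a') / t ^+ (b + b')) =
     (C * (ln t ^+ a / t ^+ b)) * (D * (ln t ^+ a' / t ^+ b')).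
    by rewrite !exprD invfM; ring.
  by rewrite normrM ler_pM//; near: t.
have [C C0 HC] := symbol_bound sf; have [D D0 HD] := symbol_bound sg.
split.
  exists (C * D); near=> t.
  have -> : C * D * (ln t ^+ (a + a') / t ^+ (b + b')) =
     (C * (ln t ^+ a / t ^+ b)) * (D * (ln t ^+ a' / t ^+ b')).
    by rewrite !exprD invfM; ring.
  by rewrite normrM ler_pM//; near: t.
case: (sf) (sg) => _ [df sf'] [_ [dg sg']]; split.
  by apply: filterS2 df dg => t; exact: derivableM.
apply: (@symbol_near _ _ _ (fun t => f t * derive1 g t + derive1 f t * g t)).
  apply: filterS2 df dg => t dft dgt; rewrite !derive1E.
  have /= -> := deriveM dft dgt.
  by rewrite /GRing.scale /= [X in _ = _ + X]mulrC.
apply: symbolD; last by rewrite -addSn; apply: IH => //; exact: symbolW sg.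
by rewrite -addnS; apply: IH => //; exact: symbolW sf.
Unshelve. all: by end_near. Qed.

Lemma symbol_cst p (k : R) : symbol p 0 0 (fun=> k).
Proof.
(* Differentiating a constant raises the decay index, so the zero function has to lie in the class
   of every index [b]. *)
have Z p0 b : symbol p0 0 b (fun=> 0 : R).
  elim: p0 b => [|q IH] b; split.
  - by exists 0; near=> t; rewrite normr0 mul0r.
  - by [].
  - by exists 0; near=> t; rewrite normr0 mul0r.
  - split; first by near=> t.
    by apply: (symbol_near _ (IH b.+1)); near=> t; rewrite derive1_cst.
case: p => [|p]; split=> //.
- by exists `|k|; near=> t; rewrite !expr0 divr1 mulr1.
- by exists `|k|; near=> t; rewrite !expr0 divr1 mulr1.
- split; first by near=> t.
  by apply: (symbol_near _ (Z p 1%N)); near=> t; rewrite derive1_cst.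
Unshelve. all: by end_near. Qed.

Lemma symbolN p a b f : symbol p a b f -> symbol p a b (fun t => - f t).
Proof.
move=> sf; have := symbolM (symbol_cst p (-1)) sf; rewrite !add0n.
by apply: symbol_near; near=> t; rewrite mulN1r.
Unshelve. all: by end_near. Qed.

Lemma derive_scale f (a t : R) :
  derivable f (t * a) 1 ->
  is_derive t 1 (fun u => f (u * a)) (derive1 f (t * a) * a).
Proof.
move=> df.
have sc : is_derive t 1 (fun u : R => u * a) a.
  have := @is_deriveM _ _ (fun u : R => u) (fun=> a) t 1 1 0 _ _.
  by move=> H; apply: is_derive_eq; rewrite /GRing.scale /=; ring.
have fd : is_derive (t * a) 1 f (derive1 f (t * a)).
  by rewrite derive1E; apply: DeriveDef.
have := @is_derive1_comp _ f (fun u : R => u * a) t _ _ fd sc.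
by rewrite mulrC.
Qed.

Lemma symbol_scale p a b f (s : R) : 0 < s -> symbol p a b f ->
  symbol p a b (fun t => f (t * s)).
Proof.
move=> s0.
have B p0 g b' : symbol p0 a b' g ->
   exists C, \forall t \near +oo, `|g (t * s)| <= C * (ln t ^+ a / t ^+ b').
  (* For [t >= s] one has [ln (t * s) <= 2 * ln t], whence [2 ^+ a]. *)
  move=> /symbol_bound[C C0 H]; exists (C * (2 ^+ a / s ^+ b')).
  near=> t.
  have [t1 lt1] : 1 <= t /\ 1 <= ln t by near: t; exact: near_ln_ge1.
  have ts : s <= t by near: t; exact: near_pinfty_ge.
  have ts1 : 1 <= t * s.
    by rewrite -ler_pdivrMr// mul1r; near: t; exact: near_pinfty_ge.
  apply: (@le_trans _ _ (C * (ln (t * s) ^+ a / (t * s) ^+ b'))).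
    by rewrite mulrC; near: t; exact: (near_oo_scale s0 H).
  have t0 : 0 < t by lra.
  rewrite [X in _ <= X](_ : _ = C * ((2 * ln t) ^+ a / (t * s) ^+ b')); last first.
    by rewrite !exprMn invfM; ring.
  rewrite ler_wpM2l ?(ltW C0)// ler_wpM2r ?invr_ge0 ?exprn_ge0 ?(le_trans ler01)//.
  apply: lerXn2r; rewrite ?nnegrE ?ln_ge0//; first lra.
  rewrite lnM ?posrE// mulr2n mulrDl mul1r lerD2l ler_ln ?posrE//.
elim: p b f => [|p IH] b f sf; split=> //.
- exact: B sf.
- exact: B sf.
- case: sf => _ [df sf].
  have df' : \forall t \near +oo, derivable f (t * s) 1.
    by near=> t; rewrite mulrC; near: t; exact: (near_oo_scale s0 df).
  split.
    by apply: filterS df' => t /derive_scale[].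
  apply: (@symbol_near _ _ _ (fun t => s * derive1 f (t * s))).
    apply: filterS df' => t /derive_scale[_ H].
    by rewrite [RHS]derive1E H mulrC.
  have := symbolM (symbol_cst p s) (IH _ _ sf); rewrite !add0n.
  exact.
Unshelve. all: by end_near. Qed.

(** * Eventual sign and monotonicity of derivatives *)

Definition monotone_oo f := exists T : R,
  (forall x y, T <= x -> x <= y -> f x <= f y) \/
  (forall x y, T <= x -> x <= y -> f y <= f x).

Lemma monotone_oo_sign f : monotone_oo f ->
  (\forall t \near +oo, 0 <= f t) \/ (\forall t \near +oo, f t <= 0).
Proof.
move=> [T [fT|fT]].
- have [[x Tx fx]|H] := pselect (exists2 x, T <= x & 0 <= f x).
    by left; apply: filterS (near_pinfty_ge x) => t xt; exact/(le_trans fx)/fT.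
  right; apply: filterS (near_pinfty_ge T) => t Tt.
  by rewrite leNgt; apply/negP => /ltW ft; apply: H; exists t.
- have [[x Tx fx]|H] := pselect (exists2 x, T <= x & f x <= 0).
    right; apply: filterS (near_pinfty_ge x) => t xt.
    by apply: (le_trans _ fx); exact: fT.
  left; apply: filterS (near_pinfty_ge T) => t Tt.
  by rewrite leNgt; apply/negP => /ltW ft; apply: H; exists t.
Qed.

Lemma derivable_within (f : R -> R) (a b : R) :
  (forall x, a <= x <= b -> derivable f x 1) -> {within `[a, b], continuous f}.
Proof.
move=> df; apply: continuous_in_subspaceT => x.
rewrite inE /= in_itv /= => /df /derivable1_diffP.
exact: differentiable_continuous.
Qed.

Lemma MVT_derive (f : R -> R) (a b : R) : a <= b ->
  (forall x, a <= x <= b -> derivable f x 1) ->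
  exists2 x, a <= x <= b & f b - f a = derive1 f x * (b - a).
Proof.
move=> ab df.
have [] := @MVT_segment R f (derive1 f) a b ab _ (derivable_within df).
  move=> x; rewrite in_itv /= => /andP[ax xb].
  by rewrite derive1E; apply: DeriveDef => //; apply: df; rewrite !ltW.
by move=> x; rewrite in_itv /=; exists x.
Qed.

Lemma sign_monotone_oo f : (\forall t \near +oo, derivable f t 1) ->
  (\forall t \near +oo, 0 <= derive1 f t) \/ (\forall t \near +oo, derive1 f t <= 0) ->
  monotone_oo f.
Proof.
move=> df [df0|df0].
- have /near_ooP[T T1 HT] : \forall t \near +oo, derivable f t 1 /\ 0 <= derive1 f t.
    by near=> t; split; near: t.
  exists T; left => x y Tx xy.
  have [|z /andP[xz _] fz] := @MVT_derive f x y xy.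
    by move=> z /andP[xz _]; apply: (HT _ _).1; exact: le_trans xz.
  rewrite -subr_ge0 fz mulr_ge0 ?subr_ge0//.
  by apply: (HT _ _).2; exact: le_trans xz.
- have /near_ooP[T T1 HT] : \forall t \near +oo, derivable f t 1 /\ derive1 f t <= 0.
    by near=> t; split; near: t.
  exists T; right => x y Tx xy.
  have [|z /andP[xz _] fz] := @MVT_derive f x y xy.
    by move=> z /andP[xz _]; apply: (HT _ _).1; exact: le_trans xz.
  rewrite -subr_le0 fz mulr_le0_ge0 ?subr_ge0//.
  by apply: (HT _ _).2; exact: le_trans xz.
Unshelve. all: by end_near. Qed.

(** A change of sign would create a zero by the intermediate value theorem. *)
Lemma nonzero_sign_oo f (T : R) : (forall t, T < t -> {for t, continuous f}) ->
  (\forall t \near +oo, f t != 0) ->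
  (\forall t \near +oo, 0 <= f t) \/ (\forall t \near +oo, f t <= 0).
Proof.
move=> cf nz.
have /near_ooP[T' T'1 HT] : \forall t \near +oo, T < t /\ f t != 0.
  by near=> t; split; near: t => //; apply: nbhs_pinfty_gt; exact: num_real.
have key x y : T' <= x -> x <= y -> (0 <= f x) = (0 <= f y).
  move=> Tx xy.
  have cxy : {within `[x, y], continuous f}.
    apply: continuous_in_subspaceT => z; rewrite inE /= in_itv /= => /andP[xz _].
    by apply: cf; apply: (HT _ _).1; exact: le_trans xz.
  have nI : ~ (Num.min (f x) (f y) <= 0 <= Num.max (f x) (f y)).
    move=> H; have [z] := IVT xy cxy H; rewrite in_itv /= => /andP[xz _] fz.
    by have := (HT z (le_trans Tx xz)).2; rewrite fz eqxx.
  apply/idP/idP => H; rewrite leNgt; apply/negP => H'; apply: nI.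
    by rewrite ge_min le_max H (ltW H') orbT.
  by rewrite ge_min le_max H (ltW H') orbT.
have [f0|f0] := boolP (0 <= f T').
  left; near=> t; rewrite -(key T')//; near: t; exact: near_pinfty_ge.
right; near=> t; apply: ltW; rewrite ltNge -(key T')//; near: t; exact: near_pinfty_ge.
Unshelve. all: by end_near. Qed.

(* A monotone derivative lies between difference quotients over [[t/2, t]] and
   [[t, 2t]]. *)
Lemma monotone_derive_bound f a b C : 0 < C ->
  (\forall t \near +oo, derivable f t 1) -> monotone_oo (derive1 f) ->
  (\forall t \near +oo, `|f t| <= C * (ln t ^+ a / t ^+ b)) ->
  exists C : R, \forall t \near +oo, `|derive1 f t| <= C * (ln t ^+ a / t ^+ b.+1).
Proof.
move=> C0 df [T mf] fC.
(* [g t] bounds [|f|] on all of [[t/2, 2t]], where [ln u <= 2 * ln t] and [1/u <= 2/t]. The factor 4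
   below comes from an increment of at most [2 * g t] over the shorter interval, of length [t/2]. *)
pose g t : R := C * (2 ^+ a * ln t ^+ a * 2 ^+ b / t ^+ b).
exists (C * (2 ^+ a * 2 ^+ b * 4)); near=> t.
have [t1 lt1] : 1 <= t /\ 1 <= ln t by near: t; exact: near_ln_ge1.
have t2 : 2 <= t by near: t; exact: near_pinfty_ge.
have t0 : 0 < t by lra.
have mft x y : t / 2 <= x -> x <= t -> t <= y ->
    (derive1 f x <= derive1 f t /\ derive1 f t <= derive1 f y) \/
    (derive1 f y <= derive1 f t /\ derive1 f t <= derive1 f x).
  have Tt : T <= t / 2.
    by rewrite ler_pdivlMr//; near: t; exact: near_pinfty_ge.
  move=> tx xt ty; have Tx := le_trans Tt tx.
  by case: mf => mf; [left|right]; split; apply: mf => //; exact: le_trans xt.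
have gu u : t / 2 <= u -> u <= 2 * t -> `|f u| <= g t.
  move=> tu ut.
  have fu : `|f u| <= C * (ln u ^+ a / u ^+ b).
    move: u tu {ut}; rewrite mulrC; near: t; exact: near_oo_ge fC.
  have u1 : 1 <= u by lra.
  apply: (le_trans fu); rewrite /g ler_wpM2l ?(ltW C0)//.
  apply: (@le_trans _ _ ((2 * ln t) ^+ a / (t / 2) ^+ b)); last first.
    by rewrite !exprMn exprVn invfM invrK; lra.
  apply: ler_pM; rewrite ?invr_ge0 ?exprn_ge0 ?ln_ge0//; try lra.
    apply: lerXn2r; rewrite ?nnegrE ?ln_ge0//; first lra.
    rewrite (_ : 2 * ln t = ln (t * t)); last by rewrite lnM ?posrE//; ring.
    by rewrite ler_ln ?posrE ?mulr_gt0//; [nra|lra].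
  rewrite lef_pV2 ?posrE ?exprn_gt0 ?divr_gt0//; last lra.
  by apply: lerXn2r; rewrite ?nnegrE//; lra.
have dfu u : t / 2 <= u -> derivable f u 1.
  by move: u; rewrite mulrC; near: t; exact: near_oo_ge df.
have [||x /andP[x1 x2] fx] := @MVT_derive f (t / 2) t.
- lra.
- by move=> x /andP[? ?]; exact: dfu.
have [||y /andP[y1 y2] fy] := @MVT_derive f t (2 * t).
- lra.
- by move=> y /andP[? ?]; apply: dfu; lra.
have A := mft x y x1 x2 y1.
clear mft dfu.
have Bd u v : t / 2 <= u -> u <= 2 * t -> t / 2 <= v -> v <= 2 * t ->
    `|f u - f v| <= 2 * g t.
  move: gu; clear => gu.
  move=> u1 u2 v1 v2; rewrite (le_trans (ler_normB _ _))//.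
  by have := gu _ u1 u2; have := gu _ v1 v2; lra.
have Bx : `|derive1 f x| * t <= 4 * g t.
  have : `|f t - f (t / 2)| <= 2 * g t by apply: Bd; move: t0; clear; lra.
  by rewrite fx normrM (gtr0_norm (_ : 0 < t - t / 2)); lra.
have By : `|derive1 f y| * t <= 4 * g t.
  have : `|f (2 * t) - f t| <= 2 * g t by apply: Bd; move: t0; clear; lra.
  have g0 : 0 <= g t.
    by apply: le_trans (gu t _ _); rewrite ?normr_ge0//; move: t0; clear; lra.
  rewrite fy normrM (gtr0_norm (_ : 0 < 2 * t - t)).
    by move: g0; clear; lra.
  by move: t0; clear; lra.
have : `|derive1 f t| * t <= 4 * g t.
  rewrite -[X in _ * X <= _](gtr0_norm t0) -normrM.
  rewrite -[X in _ * X <= _](gtr0_norm t0) -normrM in Bx.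
  rewrite -[X in _ * X <= _](gtr0_norm t0) -normrM in By.
  move: Bx By; rewrite !ler_norml => /andP[Bx1 Bx2] /andP[By1 By2].
  move: A t0 Bx1 Bx2 By1 By2; clear.
  by case=> -[A1 A2] *; apply/andP; split; nra.
rewrite -ler_pdivlMr// => /le_trans; apply.
rewrite /g exprS invfM.
by rewrite le_eqVlt; apply/orP; left; apply/eqP; ring.
Unshelve. all: by end_near. Qed.

(* [h^(m)] is eventually of constant sign, so all lower derivatives are eventually
   monotone and the bound on [h] can be differentiated. *)
Lemma smoothly_varying_symbol (alpha : R) (m : nat) h : (0 < m)%N ->
  smoothly_varying alpha m h ->
  (exists2 C : R, 0 < C & \forall t \near +oo, `|h t| <= C * (ln t ^+ 1 / t ^+ 1)) ->
  symbol m.-1 1 1 h.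
Proof.
move=> m0 [[t0 [dh ch]] [nz _]] [C C0 hC].
have D j : (j < m)%N -> \forall t \near +oo, derivable (derive1n j h) t 1.
  move=> jm; near=> t; apply: dh => //; near: t.
  by apply: nbhs_pinfty_gt; exact: num_real.
have M j : (j < m)%N -> monotone_oo (derive1n (m.-1 - j) h).
  elim: j => [|j IH] jm.
    rewrite subn0; apply: sign_monotone_oo; first by apply: D; rewrite prednK.
    rewrite -derive1nS prednK//; exact: nonzero_sign_oo ch nz.
  have -> : (m.-1 - j.+1 = (m.-1 - j).-1)%N by lia.
  apply: sign_monotone_oo; first by apply: D; lia.
  rewrite -derive1nS prednK; last by lia.
  by apply: monotone_oo_sign; apply: IH; lia.
have K p j : (j + p < m)%N -> (exists2 C : R, 0 < C &
    \forall t \near +oo, `|derive1n j h t| <= C * (ln t ^+ 1 / t ^+ j.+1)) ->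
    symbol p 1 j.+1 (derive1n j h).
  elim: p j => [|p IH] j jp [E E0 EC]; split=> //; first by exists E.
    by exists E.
  split; first by apply: D; lia.
  rewrite -derive1nS; apply: IH; first by lia.
  have [||C' HC'] := @monotone_derive_bound (derive1n j h) 1 j.+1 E E0 _ _ EC.
  - by apply: D; lia.
  - rewrite -derive1nS (_ : j.+1 = (m.-1 - (m.-1 - j.+1)))%N; last by lia.
    by apply: M; lia.
  exists (Num.max 1 C'); first by rewrite lt_max ltr01.
  near=> t; rewrite derive1nS.
  have [t1 lt1] : 1 <= t /\ 1 <= ln t by near: t; exact: near_ln_ge1.
  apply: (@le_trans _ _ (C' * (ln t ^+ 1 / t ^+ j.+2))); first by near: t.
  rewrite ler_wpM2r ?le_max ?lexx ?orbT//.
  by rewrite divr_ge0 ?exprn_ge0//; lra.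
by apply: (K m.-1 0%N); [lia|exists C].
Unshelve. all: by end_near. Qed.

Lemma near_ln_ge (A : R) : \forall t \near +oo, A <= ln t.
Proof.
apply: filterS (near_pinfty_ge (expR A)) => t At.
by rewrite -[A]expRK ler_ln// posrE ?expR_gt0// (lt_le_trans _ At)// expR_gt0.
Qed.

(** * Derivatives of a tail with hazard rate of order [ln t / t] *)

Definition loghaz (lambda t : R) : R := lambda * ln t / t.

(** All that the analysis uses of a tail, in a form stable under scaling of the variable. The symbol
    order is [m.-1] because the [m]-th derivative of [H] involves [h] only up to its derivative of
    order [m - 1]. *)
Definition logtail (lambda : R) (m : nat) (H h : R -> R) : Prop :=
  [/\ (\forall t \near +oo, 0 < H t),
      (\forall t \near +oo, is_derive (t : R) (1 : R) H (- h t * H t)),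
      symbol m.-1 1 1 h & hazard_log_asymp lambda h].

Lemma loghaz_gt0 lambda : 0 < lambda -> \forall t \near +oo, 0 < loghaz lambda t.
Proof.
move=> l0; apply: filterS near_ln_ge1 => t [t1 lt1].
by rewrite divr_gt0// ?mulr_gt0//; apply: lt_le_trans ltr01 _.
Qed.

Lemma loghaz_ge_inv lambda : 0 < lambda -> \forall t \near +oo, t^-1 <= loghaz lambda t.
Proof.
move=> l0; apply: filterS2 (near_pinfty_ge 1) (near_ln_ge lambda^-1) => t t1 lt1.
rewrite -[X in X <= _]mul1r ler_wpM2r ?invr_ge0 ?(le_trans ler01)//.
by rewrite mulrC -ler_pdivrMr// div1r.
Qed.

(** Differentiating [q * H] replaces [q] by [q' - h q]. Here [q' = O((ln t)^j / t^(j+1))] has one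
    factor [ln t] less than [h^(j+1)], so only [- h q] survives in the limit and each step
    multiplies the constant by [-1]. *)
Lemma derive1n_logtail lambda m H h : (0 < m)%N -> 0 < lambda ->
  logtail lambda m H h -> forall j, (j <= m)%N ->
  exists2 q : R -> R, symbol (m - j) j j q /\
    (\forall t \near +oo, derive1n j H t = q t * H t) &
    (q t / loghaz lambda t ^+ j) @[t --> +oo] --> ((-1) ^+ j : R).
Proof.
move=> m0 l0 [H0 dH sh hh]; elim=> [|j IH] jm.
  exists (fun=> 1); first split.
  - exact: symbol_cst.
  - by apply: nearW => t; rewrite mul1r.
  - by under eq_fun do rewrite expr0 divr1; exact: cvg_cst.
have [q [sq qH] q1] := IH (ltnW jm).
have -> : (m - j.+1 = (m - j).-1)%N by lia.
case E : (m - j)%N sq => [|p]; first by lia.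
move=> sq; case: (sq) => _ [dq sq']; rewrite /=.
exists (fun t => derive1 q t + - (h t * q t)); first split.
- apply: symbolD; first exact: symbolW sq'.
  apply: symbolN; rewrite -[j.+1]add1n; apply: symbolM; last exact: symbolW sq.
  by apply: symbolW sh; lia.
- have := derive1_near_oo qH; apply: filterS3 dq dH => t dqt dHt.
  move=> ->; rewrite derive1E.
  have dHt' := @ex_derive _ _ _ _ _ _ _ dHt.
  have /= -> := deriveM dqt dHt'.
  by rewrite derive_val -derive1E /GRing.scale /=; ring.
- rewrite (_ : (-1) ^+ j.+1 = 0 - 1 * (-1) ^+ j :> R); last by rewrite exprS; ring.
  rewrite (_ : (fun t => _) = (fun t => derive1 q t / loghaz lambda t ^+ j.+1) \-
     (fun t => h t / loghaz lambda t * (q t / loghaz lambda t ^+ j))); last first.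
    by apply/funext => t /=; rewrite exprS invfM; ring.
  apply: cvgB; last exact: cvgM.
  have [C C0 HC] := symbol_bound sq'.
  apply/cvgr0Pnorm_le => e e0; near=> t.
  have [t1 lt1] : 1 <= t /\ 1 <= ln t by near: t; exact: near_ln_ge1.
  have t0 : 0 < t by lra.
  have l1 : 0 < ln t by lra.
  have L0 : 0 < loghaz lambda t by rewrite divr_gt0// mulr_gt0.
  rewrite normrM [X in _ * X]gtr0_norm; last by rewrite invr_gt0 exprn_gt0.
  rewrite ler_pdivrMr ?exprn_gt0//.
  apply: (@le_trans _ _ (C * (ln t ^+ j / t ^+ j.+1))); first by near: t.
  rewrite /loghaz -mulrA exprMn expr_div_n exprS [ln t ^+ j.+1]exprS.
  have Y : 0 <= ln t ^+ j / t ^+ j.+1 by rewrite divr_ge0 ?exprn_ge0//; lra.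
  rewrite [X in _ <= X](_ : _ = e * (lambda * lambda ^+ j) * ln t * (ln t ^+ j / t ^+ j.+1)).
    2: by rewrite [lambda ^+ j.+1]exprS [t ^+ j.+1]exprS; ring.
  rewrite -exprS.
  rewrite ler_wpM2r//.
  have Z : 0 < e * (lambda * lambda ^+ j) by rewrite !mulr_gt0 ?exprn_gt0.
  rewrite mulrC -ler_pdivrMr//; near: t; exact: near_ln_ge.
Unshelve. all: by end_near. Qed.

Lemma derivable_derive1n_logtail lambda m H h : (0 < m)%N -> 0 < lambda ->
  logtail lambda m H h -> forall j, (j < m)%N ->
  \forall t \near +oo, derivable (derive1n j H) t 1.
Proof.
move=> m0 l0 HH j jm.
have [q [sq qH] _] := derive1n_logtail m0 l0 HH (ltnW jm).
case: HH => _ dH _ _.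
apply: (@derivable_near_oo (fun t => q t * H t)).
  by apply: filterS qH => t ->.
case E : (m - j)%N sq => [|p]; first by lia.
move=> [_ [dq _]]; apply: filterS2 dq dH => t dqt dHt.
have dHt' := @ex_derive _ _ _ _ _ _ _ dHt.
exact: (@derivableM _ _ q H t 1 dqt dHt').
Qed.

(** * Increments on the scale of [t] and the Taylor formula *)

Lemma derive_lip (f : R -> R) (B a b : R) :
  (forall x, a <= x <= b -> derivable f x 1 /\ `|derive1 f x| <= B) ->
  forall x y, a <= x <= b -> a <= y <= b -> `|f x - f y| <= B * `|x - y|.
Proof.
move=> df.
suff W x y : a <= x <= b -> a <= y <= b -> x <= y -> `|f x - f y| <= B * `|x - y|.
  move=> x y xab yab; have [|/ltW] := leP x y; first exact: W.
  by move=> yx; rewrite distrC (distrC x); exact: W.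
move=> /andP[ax xb] /andP[ay yb] xy.
have D z : x <= z <= y -> a <= z <= b.
  by move=> /andP[xz zy]; rewrite (le_trans ax)//= (le_trans zy).
have [|z /D zab fz] := @MVT_derive f x y xy.
  by move=> z /D /df[].
by rewrite distrC fz normrM (distrC x) ler_wpM2r//; exact: (df z zab).2.
Qed.

Lemma log_lip (L : R -> R) (C : R) : 0 < C ->
  (\forall t \near +oo, derivable L t 1) ->
  (\forall t \near +oo, `|derive1 L t| <= C * (ln t / t)) ->
  \forall t \near +oo, forall s, `|s| <= t / 2 ->
    `|L (t - s) - L t| <= 4 * C * (`|s| * (ln t / t)).
Proof.
move=> C0 dL LC; near=> t => s st.
have [t1 lt1] : 1 <= t /\ 1 <= ln t by near: t; exact: near_ln_ge1.
have t2 : 2 <= t by near: t; exact: near_pinfty_ge.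
have t0 : 0 < t by lra.
have [s1 s2] : - (t / 2) <= s /\ s <= t / 2.
  by move: st; rewrite ler_norml => /andP[].
have dLu u : t / 2 <= u -> derivable L u 1.
  by move: u; rewrite mulrC; near: t; exact: near_oo_ge dL.
have LCu u : t / 2 <= u -> `|derive1 L u| <= C * (ln u / u).
  by move: u; rewrite mulrC; near: t; exact: near_oo_ge LC.
(* This interval holds every [t - s]; on it [ln] is at most [2 * ln t] and the inverse at most
   [2 / t], whence the factor 4. *)
have := @derive_lip L (4 * C * (ln t / t)) (t / 2) (3 / 2 * t) _ (t - s) t.
rewrite (_ : t - s - t = - s); last by ring.
rewrite normrN => H.
rewrite (_ : _ * (_ * _) = 4 * C * (ln t / t) * `|s|); last by ring.
apply: H; [|lra|lra].
move=> x /andP[x1 x2]; split; first exact: dLu.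
apply: (le_trans (LCu _ x1)).
rewrite [X in _ <= X](_ : _ = C * ((2 * ln t) * (t / 2)^-1)); last by field; lra.
rewrite ler_wpM2l ?(ltW C0)// ler_pM ?ln_ge0 ?invr_ge0//; try lra.
  rewrite (_ : 2 * ln t = ln (t * t)); last by rewrite lnM ?posrE//; ring.
  by rewrite ler_ln ?posrE ?mulr_gt0//; [move: x2 t2; clear; nra|lra].
by rewrite lef_pV2 ?posrE//; lra.
Unshelve. all: by end_near. Qed.

(** With [r = 1 + |s|] and [t = x * r], the quantity [r * ln t / t] is [(ln x + ln r) / x], where
    [x >= 1] and [ln x <= x]. The bound does not depend on [t]. *)
Lemma ln_div_le (s t : R) : 0 < t -> `|s| <= t / 2 -> 2 <= t ->
  `|s| * (ln t / t) <= ln (1 + `|s|) + 1.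
Proof.
move=> t0 st t2; set r := 1 + `|s|.
have r1 : 1 <= r by rewrite /r lerDl.
have rt : r <= t by rewrite /r; lra.
have r0 : 0 < r by lra.
apply: (@le_trans _ _ (r * (ln t / t))).
  by rewrite ler_wpM2r ?divr_ge0 ?ln_ge0 /r//; lra.
set x := t / r.
have x1 : 1 <= x by rewrite /x ler_pdivlMr// mul1r.
have -> : t = x * r by rewrite /x divfK//; lra.
rewrite lnM ?posrE//; last by lra.
have x0 : 0 < x by lra.
rewrite (_ : r * _ = (ln x + ln r) / x); last by field; rewrite !gt_eqF.
rewrite ler_pdivrMr// mulrDl mul1r [X in _ <= X]addrC lerD//.
  by apply/ltW/ln_sublinear.
by rewrite ler_peMr// ln_ge0.
Qed.

Lemma log_poly (L : R -> R) (C : R) : 0 < C ->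
  (\forall t \near +oo, derivable L t 1) ->
  (\forall t \near +oo, `|derive1 L t| <= C * (ln t / t)) ->
  exists K : R, exists2 p : nat, 0 < K &
  \forall t \near +oo, forall s, `|s| <= t / 2 ->
    expR (L (t - s)) <= K * (1 + `|s|) ^+ p * expR (L t).
Proof.
move=> C0 dL LC; have H := log_lip C0 dL LC.
(* The increment of [L] is at most [4 * C * (ln (1 + |s|) + 1)]; rounding [4 * C] up to an integer
   makes its exponential a genuine polynomial times [expR p]. *)
pose p := (Num.truncn (4 * C)).+1.
have pC : 4 * C <= p%:R.
  by rewrite /p ltW// truncnS_gt.
exists (expR p%:R), p; first exact: expR_gt0.
apply: filterS2 H (near_pinfty_ge 2) => t Ht t2 s st.
have r0 : 0 < 1 + `|s| by rewrite ltr_wpDr.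
rewrite -[X in X ^+ p](@lnK R) ?posrE// -expRM_natl -!expRD ler_expR -lerBlDr.
apply: (le_trans (ler_norm _)); apply: (le_trans (Ht s st)).
have A := @ln_div_le s t ltac:(lra) st t2.
apply: (@le_trans _ _ (p%:R * (`|s| * (ln t / t)))).
  by rewrite ler_wpM2r// mulr_ge0// divr_ge0// ?ln_ge0//; lra.
by rewrite -[X in X + _]mulr1 -mulrDr ler_wpM2l// addrC.
Qed.

(** As a function of [u], the remainder of order [n + 1] vanishes at 0 and its derivative is minus
    the remainder of order [n] of [f'], so the mean value theorem and induction suffice. Only the
    oscillation of the [n]-th derivative is used, not a further derivative, which allows [n = m]. *)
Lemma taylor_bound (n : nat) (f : R -> R) (t r B : R) :
  (forall j, (j < n)%N -> forall u, `|u| <= r -> derivable (derive1n j f) (t - u) 1) ->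
  (forall u, `|u| <= r -> `|derive1n n f (t - u) - derive1n n f t| <= B) ->
  forall s, `|s| <= r ->
  `|f (t - s) - \sum_(j < n.+1) (-1) ^+ j / j`!%:R * s ^+ j * derive1n j f t|
    <= `|s| ^+ n * B.
Proof.
elim: n f => [|n IH] f df fB s sr.
  by rewrite big_ord1 !expr0 fact0 divr1 !mul1r; exact: fB.
have B0 : 0 <= B.
  by apply: le_trans (fB 0 _); rewrite ?normr0 ?normr_ge0// (le_trans _ sr).
set g := fun u : R => f (t - u) - \sum_(j < n.+2) (-1) ^+ j / j`!%:R * u ^+ j * derive1n j f t.
have dg (u : R) : `|u| <= r -> is_derive u (1 : R) g
   (- (derive1 f (t - u) - \sum_(j < n.+1) (-1) ^+ j / j`!%:R * u ^+ j * derive1n j (derive1 f) t)).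
  move=> ur.
  have d1 : is_derive u 1 (fun u => f (t - u)) (- derive1 f (t - u)).
    have fd : is_derive (t - u) 1 f (derive1 f (t - u)).
      by rewrite derive1E; apply: DeriveDef => //; exact: (df 0%N).
    have sd : is_derive u 1 (fun u : R => t - u) (-1).
      have := @is_deriveB _ _ _ (fun=> t) id u 1 0 1 _ _.
      by move=> X; apply: is_derive_eq; rewrite sub0r.
    by have := @is_derive1_comp _ f (fun u : R => t - u) u _ _ fd sd; rewrite mulrN1.
  have d2 : is_derive u 1 (fun u : R => \sum_(j < n.+2) (-1) ^+ j / j`!%:R * u ^+ j * derive1n j f t)
      (\sum_(j < n.+2) (-1) ^+ j / j`!%:R * (j%:R * u ^+ j.-1) * derive1n j f t).
    rewrite (_ : (fun u : R => _) = \sum_(j < n.+2) (fun u => (-1) ^+ j / j`!%:R * u ^+ j * derive1n j f t)); last first.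
      by apply/funext => z; rewrite fct_sumE.
    apply: is_derive_sum => j.
    have dX : is_derive u 1 (fun u : R => u ^+ j) (j%:R * u ^+ j.-1).
      have := @is_deriveX _ _ (@id R) j u 1 1 (is_derive_id _ _).
      rewrite (_ : (id ^+ j : R -> R) = (fun u : R => u ^+ j)).
        by move=> X; apply: is_derive_eq; rewrite /GRing.scale /= mulr1.
      by apply/funext => z; rewrite exprfctE.
    have -> : (fun u => (-1) ^+ j / j`!%:R * u ^+ j * derive1n j f t) =
       ((-1) ^+ j / j`!%:R * derive1n j f t) *: (fun u : R => u ^+ j).
      by apply/funext => z; rewrite fctE /GRing.scale /= mulrAC.
    by apply: is_derive_eq; rewrite /GRing.scale /=; ring.
  have := @is_deriveB _ _ _ _ _ u 1 _ _ d1 d2.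
  move=> X; apply: is_derive_eq.
  rewrite opprB addrC; congr (_ - _).
  rewrite big_ord_recl /= mul0r mulr0 mul0r add0r -sumrN; apply: eq_bigr => j _.
  rewrite /bump /= add1n -derive1nS derive1Sn add0n factS natrM exprS.
  have : (j`!%:R : R) != 0 by rewrite pnatr_eq0 -lt0n fact_gt0.
  have : (j.+1%:R : R) != 0 by rewrite pnatr_eq0.
  have gen (a b x y z : R) : a != 0 -> b != 0 ->
      - (-1 * x / (a * b) * (a * y) * z) = x / b * y * z.
    by move=> a0 b0; field; rewrite a0 b0.
  by move=> ? ?; exact: gen.
have g0 : g 0 = 0.
  rewrite /g subr0 big_ord_recl /= !expr0 fact0 divr1 !mul1r big1 ?addr0 ?subrr//.
  move=> j _; rewrite (_ : 0 ^+ lift ord0 j = 0) ?mulr0 ?mul0r//.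
  by rewrite /= exprS mul0r.
have := @derive_lip g (`|s| ^+ n * B) (- `|s|) `|s| _ s 0.
rewrite g0 !subr0 exprSr mulrAC; apply.
- move=> x; rewrite -ler_norml => xs.
  have xr := le_trans xs sr.
  have [d1 d2] := dg x xr; split => //.
  rewrite derive1E d2 normrN; apply: (@le_trans _ _ (`|x| ^+ n * B)); last first.
    by rewrite ler_wpM2r// lerXn2r ?nnegrE.
  apply: IH => //.
  + by move=> j jn u ur; rewrite -derive1Sn; exact: df.
  + by move=> u ur; rewrite -derive1Sn; exact: fB.
- by rewrite -ler_norml.
- by rewrite -ler_norml normr0.
Qed.

Lemma loghaz_scale lambda (a : R) : 0 < a -> 0 < lambda ->
  (loghaz lambda (t * a) * a / loghaz lambda t) @[t --> +oo] --> (1 : R).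
Proof.
move=> a0 l0.
apply/cvgrPdist_le => e e0; near=> t.
have [t1 lt1] : 1 <= t /\ 1 <= ln t by near: t; exact: near_ln_ge1.
have t0 : 0 < t by lra.
have lt0 : 0 < ln t by lra.
rewrite distrC (_ : _ - 1 = ln a / ln t); last first.
  by rewrite /loghaz lnM ?posrE//; field; rewrite !gt_eqF.
rewrite normrM normfV (gtr0_norm lt0) ler_pdivrMr// mulrC -ler_pdivrMr//.
by near: t; exact: near_ln_ge.
Unshelve. all: by end_near. Qed.

Lemma near_oo_cvg_scale (f : R -> R) (l a : R) : 0 < a ->
  f t @[t --> +oo] --> l -> f (t * a) @[t --> +oo] --> l.
Proof.
move=> a0 /cvgrPdist_le fl; apply/cvgrPdist_le => e /fl fe.
by apply: filterS (near_oo_scale a0 fe) => t; rewrite mulrC.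
Qed.

Lemma hazard_log_asympE lambda h : hazard_log_asymp lambda h <->
  (h t / loghaz lambda t) @[t --> +oo] --> (1 : R).
Proof. by []. Qed.

Lemma cvg_near_oo (f g : R -> R) (l : R) : (\forall t \near +oo, f t = g t) ->
  f t @[t --> +oo] --> l -> g t @[t --> +oo] --> l.
Proof. by move=> fg fl; apply: cvg_trans fl; exact: near_eq_cvg. Qed.

Lemma logtail_scale lambda m H h (a : R) : (0 < m)%N -> 0 < lambda -> 0 < a ->
  logtail lambda m H h -> logtail lambda m (fun t => H (t * a)) (fun t => a * h (t * a)).
Proof.
move=> m0 l0 a0 [H0 dH sh hh]; split.
- by apply: filterS (near_oo_scale a0 H0) => t; rewrite mulrC.
- apply: filterS (near_oo_scale a0 dH) => t; rewrite mulrC => dHt.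
  have dHt' := @ex_derive _ _ _ _ _ _ _ dHt.
  have [d1 d2] := derive_scale dHt'.
  apply: DeriveDef => //; rewrite d2 derive1E.
  by have -> := @derive_val _ _ _ _ _ _ _ dHt; ring.
- have := symbolM (symbol_cst m.-1 a) (symbol_scale a0 sh); rewrite !add0n.
  exact.
- apply/hazard_log_asympE; rewrite -[1]mulr1.
  apply: (@cvg_near_oo (fun t => (h (t * a) / loghaz lambda (t * a)) *
     (loghaz lambda (t * a) * a / loghaz lambda t))).
    near=> t.
    have : 0 < loghaz lambda (t * a).
      by rewrite mulrC; near: t; exact: near_oo_scale a0 (loghaz_gt0 l0).
    have : 0 < loghaz lambda t by near: t; exact: loghaz_gt0.
    by move=> x y; field; rewrite !gt_eqF.
  apply: cvgM; last exact: loghaz_scale.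
  exact: near_oo_cvg_scale a0 hh.
Unshelve. all: by end_near. Qed.

Lemma derivable_ln_logtail lambda m H h : logtail lambda m H h ->
  \forall t \near +oo, is_derive (t : R) (1 : R) (fun u => ln (H u)) (- h t).
Proof.
move=> [H0 dH _ _]; apply: filterS2 H0 dH => t H0 dH.
have := @is_derive1_comp _ (@ln R) H t _ _ (is_derive1_ln H0) dH.
have -> // : (H t)^-1 * (- h t * H t) = - h t by field; rewrite gt_eqF.
Qed.

Lemma derivable_lnln : \forall t \near +oo,
  is_derive (t : R) (1 : R) (fun u : R => ln (ln u)) (t^-1 / ln t).
Proof.
apply: filterS near_ln_ge1 => t [t1 lt1].
have t0 : 0 < t by lra.
have l0 : 0 < ln t by lra.
have := @is_derive1_comp _ (@ln R) (@ln R) t _ _ (is_derive1_ln l0) (is_derive1_ln t0).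
by rewrite mulrC.
Qed.

(** The logarithm of [(ln t / t)^n H(t)], the size of the [n]-th derivative of [H]. On this scale
    ratios become increments, to which the mean value theorem applies. *)
Definition logscale (n : nat) (H : R -> R) (t : R) : R :=
  n%:R * (ln (ln t) - ln t) + ln (H t).

Lemma expR_logscale lambda m H h n : 0 < lambda -> logtail lambda m H h ->
  \forall t \near +oo, lambda ^+ n * expR (logscale n H t) = loghaz lambda t ^+ n * H t.
Proof.
move=> l0 [H0 _ _ _]; apply: filterS2 H0 near_ln_ge1 => t H0 [t1 lt1].
have t0 : 0 < t by lra.
have lt0 : 0 < ln t by lra.
rewrite /logscale expRD lnK ?posrE// mulrA; congr (_ * _).
by rewrite expRM_natl expRB !lnK ?posrE// -exprMn mulrA.
Qed.

Lemma logscale_derive lambda m H h n : 0 < lambda -> logtail lambda m H h ->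
  (\forall t \near +oo, derivable (logscale n H) t 1) /\
  exists2 C, 0 < C & \forall t \near +oo, `|derive1 (logscale n H) t| <= C * (ln t / t).
Proof.
move=> l0 HH.
have D : \forall t \near +oo, is_derive (t : R) (1 : R) (logscale n H)
   (n%:R * (t^-1 / ln t - t^-1) - h t).
  apply: filterS3 (derivable_ln_logtail HH) derivable_lnln near_ln_ge1.
  move=> t d1 d2 [t1 _].
  have d3 := is_derive1_ln (lt_le_trans ltr01 t1).
  have d4 := @is_deriveB _ _ _ _ _ t 1 _ _ d2 d3.
  have d5 := @is_deriveZ _ _ _ _ n%:R t 1 _ d4.
  exact: (@is_deriveD _ _ _ _ _ t 1 _ _ d5 d1).
split; first by apply: filterS D => t dt; exact: (@ex_derive _ _ _ _ _ _ _ dt).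
have [_ _ sh _] := HH; have [C C0 hC] := symbol_bound sh.
exists (n%:R + C); first by rewrite ltr_wpDl.
apply: filterS3 D hC near_ln_ge1 => t dt; rewrite !expr1 => hC' [t1 lt1].
rewrite derive1E; have -> := @derive_val _ _ _ _ _ _ _ dt.
rewrite mulrDl (le_trans (ler_normB _ _))// lerD//.
have t0 : 0 < t by lra.
have lt0 : 0 < ln t by lra.
rewrite normrM normr_nat ler_wpM2l//.
have i1 : 0 <= (ln t)^-1 <= 1 by rewrite invr_ge0 ltW//= invf_le1.
have i2 : 0 < t^-1 by rewrite invr_gt0.
rewrite -[X in `|_ - X|]mulr1 -mulrBr normrM (gtr0_norm i2) mulrC ler_wpM2r// ?(ltW i2)//.
by rewrite ler_norml; apply/andP; split; lra.
Qed.

(** Only the tail is truncated to [|s| <= t / 2]. The Taylor polynomial is kept for all [s], so that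
    its integral produces complete moments. *)
Definition remainder (n : nat) (H : R -> R) (t s : R) : R :=
  (if `|s| <= t / 2 then H (t - s) else 0) -
  \sum_(j < n.+1) (-1) ^+ j / j`!%:R * s ^+ j * derive1n j H t.

Lemma derive1n_equiv lambda m H h : (0 < m)%N -> 0 < lambda ->
  logtail lambda m H h -> forall j, (j <= m)%N ->
  exists2 phi : R -> R, (\forall t \near +oo,
      derive1n j H t = phi t * (loghaz lambda t ^+ j * H t)) &
    phi t @[t --> +oo] --> ((-1) ^+ j : R).
Proof.
move=> m0 l0 HH j jm; have [q [_ qH] q1] := derive1n_logtail m0 l0 HH jm.
exists (fun t => q t / loghaz lambda t ^+ j) => //.
apply: filterS2 qH (loghaz_gt0 l0) => t -> L0.
by rewrite mulrA divfK// expf_neq0// gt_eqF.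
Qed.

Lemma derive1n_bound lambda m H h : (0 < m)%N -> 0 < lambda ->
  logtail lambda m H h -> forall j, (j <= m)%N ->
  \forall t \near +oo, `|derive1n j H t| <= 2 * (loghaz lambda t ^+ j * H t).
Proof.
move=> m0 l0 HH j jm; have [phi pH /cvgrPdist_le p1] := derive1n_equiv m0 l0 HH jm.
have [H0 _ _ _] := HH; have p1' := p1 1 ltr01.
near=> t; have -> : derive1n j H t = phi t * (loghaz lambda t ^+ j * H t) by near: t.
have L0 : 0 < loghaz lambda t by near: t; exact: loghaz_gt0.
have Ht : 0 < H t by near: t.
rewrite normrM [X in _ * X]gtr0_norm; last by rewrite mulr_gt0 ?exprn_gt0.
rewrite ler_wpM2r ?mulr_ge0 ?exprn_ge0 ?(ltW L0) ?(ltW Ht)//.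
have : `|(-1) ^+ j - phi t| <= 1 by near: t.
have : `|(-1) ^+ j| = 1 :> R by rewrite normrX normrN1 expr1n.
move=> N1 N2; rewrite -[phi t](subrKC ((-1) ^+ j)) (le_trans (ler_normD _ _))//.
by rewrite N1 distrC; lra.
Unshelve. all: by end_near. Qed.

(** The majorant, polynomial in [s] uniformly in [t], that dominated convergence will use. *)
Lemma remainder_dominated lambda m H h n : (0 < m)%N -> 0 < lambda ->
  logtail lambda m H h -> (n <= m)%N ->
  exists K : R, exists2 p : nat, 0 < K & \forall t \near +oo, forall s,
    `|remainder n H t s| <= K * (1 + `|s|) ^+ p * (loghaz lambda t ^+ n * H t).
Proof.
move=> m0 l0 HH nm; have [dL [C C0 LC]] := logscale_derive n l0 HH.
have [K [p K0 HK]] := log_poly C0 dL LC.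
have E := expR_logscale n l0 HH.
have Bn := derive1n_bound m0 l0 HH nm.
have [H0 _ _ _] := HH.
have D : \forall t \near +oo, forall j, (j < n)%N -> derivable (derive1n j H) t 1.
  elim: n nm {dL C C0 LC K p K0 HK E Bn} => [|n IH] nm; first by apply: nearW.
  have [IH' D] := (IH (ltnW nm), derivable_derive1n_logtail m0 l0 HH nm).
  apply: filterS2 IH' D => t IHt Dt j; rewrite ltnS leq_eqVlt => /orP[/eqP->//|].
  exact: IHt.
have Bj : \forall t \near +oo, forall j, (j <= n)%N ->
    `|derive1n j H t| <= 2 * (loghaz lambda t ^+ j * H t).
  have : forall n', (n' <= n)%N -> \forall t \near +oo, forall j, (j <= n')%N ->
    `|derive1n j H t| <= 2 * (loghaz lambda t ^+ j * H t).
    elim=> [|n' IH] nn'.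
      apply: filterS (derive1n_bound m0 l0 HH (leq0n _)) => t Ht j.
      by rewrite leqn0 => /eqP->.
    have [IH' D'] := (IH (ltnW nn'), derive1n_bound m0 l0 HH (leq_trans nn' nm)).
    apply: filterS2 IH' D' => t IHt Dt j; rewrite leq_eqVlt => /orP[/eqP->//|].
    exact: IHt.
  exact.
(* The first summand serves [|s| > t/2], the second [|s| <= t/2]; the degree is [n] from the Taylor
   bound plus [p] from the oscillation. *)
exists (n.+1%:R * 2 * 2 ^+ n + (2 * K + 2)), (n + p)%N.
  have : 0 <= n.+1%:R * 2 * 2 ^+ n :> R by rewrite !mulr_ge0// exprn_ge0.
  lra.
near=> t => s.
have t2 : 2 <= t by near: t; exact: near_pinfty_ge.
have t0 : 0 < t by lra.
have L0 : 0 < loghaz lambda t by near: t; exact: loghaz_gt0.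
have Ht : 0 < H t by near: t.
have Lt : t^-1 <= loghaz lambda t by near: t; exact: loghaz_ge_inv.
set r := 1 + `|s|; have r1 : 1 <= r by rewrite /r lerDl.
set W := loghaz lambda t ^+ n * H t; have W0 : 0 < W by rewrite mulr_gt0 ?exprn_gt0.
have Kn0 : 0 <= n.+1%:R * 2 * 2 ^+ n :> R by rewrite !mulr_ge0// exprn_ge0.
have r0 : 0 <= r by lra.
have rp1 k : 1 <= r ^+ k by exact: exprn_ege1.
have sr : `|s| <= r by rewrite /r lerDr.
rewrite /remainder; case: ifPn => st.
- have HKt u : `|u| <= t / 2 -> expR (logscale n H (t - u)) <= K * (1 + `|u|) ^+ p * expR (logscale n H t).
    by move: u; near: t.
  have Et : lambda ^+ n * expR (logscale n H t) = W by rewrite /W; near: t.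
  have Eu u : t / 2 <= u -> lambda ^+ n * expR (logscale n H u) = loghaz lambda u ^+ n * H u.
    by move: u; rewrite mulrC; near: t; exact: near_oo_ge E.
  have Bu u : t / 2 <= u -> `|derive1n n H u| <= 2 * (loghaz lambda u ^+ n * H u).
    by move: u; rewrite mulrC; near: t; exact: near_oo_ge Bn.
  have Du u : t / 2 <= u -> forall j, (j < n)%N -> derivable (derive1n j H) u 1.
    by move: u; rewrite mulrC; near: t; exact: near_oo_ge D.
  have ut u : `|u| <= `|s| -> t / 2 <= t - u.
    by move=> /le_trans/(_ st); rewrite ler_norml => /andP[_]; lra.
  have := @taylor_bound n H t `|s| ((2 * K + 2) * r ^+ p * W) _ _ s (lexx _).
  move=> /(_ _ _)/le_trans; apply.
  + by move=> j jn u us; apply: Du => //; exact: ut.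
  + move=> u us; rewrite (le_trans (ler_normB _ _))//.
    have B1 := Bu _ (ut _ us); rewrite -Eu ?ut// in B1.
    have B2 := HKt u (le_trans us st).
    have B3 : `|derive1n n H t| <= 2 * W by apply: Bu; move: t0; clear; lra.
    have B4 : loghaz lambda (t - u) ^+ n * H (t - u) <= K * r ^+ p * W.
      rewrite -Eu ?ut// -Et mulrCA ler_pM2l ?exprn_gt0// (le_trans B2)//.
      rewrite ler_wpM2r ?expR_ge0// ler_wpM2l ?(ltW K0)// lerXn2r ?nnegrE//.
      by rewrite /r lerD2l.
    rewrite Eu ?ut// in B1.
    have B5 : W <= r ^+ p * W by rewrite ler_peMl// ltW.
    by move: B1 B3 B4 B5; clear; lra.
  + rewrite mulrA ler_wpM2r ?(ltW W0)// mulrCA exprD [X in _ <= X]mulrC.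
    rewrite -mulrA [X in _ <= X]mulrC.
    have P0 : 0 <= r ^+ n * r ^+ p by rewrite mulr_ge0 ?exprn_ge0.
    rewrite (@le_trans _ _ ((2 * K + 2) * (r ^+ n * r ^+ p)))//.
      rewrite ler_wpM2l//; first by move: K0; clear; lra.
      by rewrite ler_wpM2r ?exprn_ge0// lerXn2r ?nnegrE.
    by rewrite ler_wpM2r// lerDr.
- rewrite sub0r normrN.
  (* Only the polynomial is left. Since [t <= 2 * r] and [1/t <= loghaz], one has
     [1 <= 2 * r * loghaz]; the power [n - j] of this raises the term of order [j] to the order [n],
     at the price of a power of [r]. *)
  have s2 : t <= 2 * r by move: st; rewrite -ltNge /r; lra.
  apply: (@le_trans _ _ (\sum_(j < n.+1) 2 * 2 ^+ n * r ^+ n * W)).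
    apply: (le_trans (ler_norm_sum _ _ _)); apply: ler_sum => j _.
    have jn : (j <= n)%N by rewrite -ltnS.
    rewrite !normrM normfV normrX normrN1 expr1n normr_nat normrX mul1r.
    have F : `|derive1n j H t| <= 2 * (loghaz lambda t ^+ j * H t).
      by move: (j : nat) jn; near: t.
    have f1 : (j`!%:R : R)^-1 <= 1.
      by rewrite invf_le1 ?ltr0n ?fact_gt0// ler1n fact_gt0.
    apply: (@le_trans _ _ (1 * r ^+ j * (2 * ((2 * r) ^+ (n - j) * loghaz lambda t ^+ (n - j) * loghaz lambda t ^+ j * H t)))).
      apply: ler_pM; rewrite ?mulr_ge0 ?invr_ge0 ?exprn_ge0//.
        by apply: ler_pM; rewrite ?invr_ge0 ?exprn_ge0// lerXn2r ?nnegrE.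
      apply: (le_trans F); rewrite ler_pM2l// ler_wpM2r ?(ltW Ht)//.
      rewrite ler_peMl ?exprn_ge0 ?(ltW L0)// -exprMn exprn_ege1//.
      apply: (@le_trans _ _ (t * t^-1)); first by rewrite divff// gt_eqF.
      by apply: ler_pM => //; rewrite ?invr_ge0 ltW.
    rewrite /W -[in X in _ <= X](subnK jn) !exprD ![(2 * r) ^+ _]exprMn.
    have g1 : 1 <= 2 ^+ j :> R by rewrite exprn_ege1// ler1n.
    set A := r ^+ j; set B := r ^+ (n - j); set D' := 2 ^+ (n - j).
    set E' := loghaz lambda t ^+ (n - j); set F' := loghaz lambda t ^+ j.
    rewrite (_ : 1 * A * _ = 1 * (2 * D' * (B * A) * (E' * F' * H t))); last by ring.
    rewrite (_ : _ * (D' * 2 ^+ j) * _ * _ = 2 ^+ j * (2 * D' * (B * A) * (E' * F' * H t))); last by ring.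
    by rewrite ler_wpM2r// !mulr_ge0 ?exprn_ge0// ltW.
  rewrite sumr_const card_ord -[_ *+ n.+1]mulr_natl.
  rewrite [X in X <= _](_ : _ = n.+1%:R * 2 * 2 ^+ n * r ^+ n * W); last by ring.
  rewrite ler_wpM2r ?(ltW W0)// exprD ler_pM ?exprn_ge0//.
    by rewrite lerDl; move: K0; clear; lra.
  by rewrite ler_peMr ?exprn_ge0.
Unshelve. all: by end_near. Qed.

(** For fixed [s] the increments of [logscale] are [O(ln t / t)], so the [n]-th derivative at
    [t - u] is equivalent to the one at [t], uniformly in [|u| <= |s|]. *)
Lemma remainder_cvg0 lambda m H h n (s : R) : (0 < m)%N -> 0 < lambda ->
  logtail lambda m H h -> (n <= m)%N -> forall e : R, 0 < e ->
  \forall t \near +oo, `|remainder n H t s| <= e * (loghaz lambda t ^+ n * H t).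
Proof.
move=> m0 l0 HH nm e e0; have [dL [C C0 LC]] := logscale_derive n l0 HH.
have HL := log_lip C0 dL LC.
have E := expR_logscale n l0 HH.
have [H0 _ _ _] := HH.
have [phi pH p1] := derive1n_equiv m0 l0 HH nm.
have D : \forall t \near +oo, forall j, (j < n)%N -> derivable (derive1n j H) t 1.
  elim: n nm {dL C C0 LC HL E phi pH p1} => [|n IH] nm; first by apply: nearW.
  have [IH' D] := (IH (ltnW nm), derivable_derive1n_logtail m0 l0 HH nm).
  apply: filterS2 IH' D => t IHt Dt j; rewrite ltnS leq_eqVlt => /orP[/eqP->//|].
  exact: IHt.
(* [e1] absorbs the factor [|s| ^+ n] of the Taylor bound. Below, [e2 <= 1] keeps [|phi| <= 2], and
   the three errors add up to [4 * e2 <= e1]. *)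
pose e1 := e / (1 + `|s|) ^+ n.
have s1 : 0 < 1 + `|s| by rewrite ltr_wpDr.
have e10 : 0 < e1 by rewrite divr_gt0// exprn_gt0.
pose e2 := Num.min 1 (e1 / 6).
have e20 : 0 < e2 by rewrite lt_min ltr01/=; move: e10; clear; lra.
have /cvgrPdist_le/(_ _ e20)[d /= d0 hd] := @continuous_expR R 0.
have /cvgrPdist_le/(_ _ e20) P := p1.
near=> t.
have t2 : 2 <= t by near: t; exact: near_pinfty_ge.
have ts : 2 * `|s| <= t by near: t; exact: near_pinfty_ge.
have t0 : 0 < t by lra.
have L0 : 0 < loghaz lambda t by near: t; exact: loghaz_gt0.
have Ht : 0 < H t by near: t.
set W := loghaz lambda t ^+ n * H t; have W0 : 0 < W by rewrite mulr_gt0 ?exprn_gt0.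
have st : `|s| <= t / 2 by lra.
have LL : 4 * C * (`|s| * (ln t / t)) < d.
  (* [ln t <= 2 * sqrt t], so [ln t / t] tends to 0 *)
  have : ln t <= 2 * Num.sqrt t.
    rewrite -[X in ln X](sqr_sqrtr (ltW t0)) lnXn ?sqrtr_gt0// mulr2n mulrDl mul1r.
    have := @ln_sublinear R (Num.sqrt t); rewrite sqrtr_gt0 => /(_ t0) /ltW X.
    exact: lerD.
  have st0 : 0 < Num.sqrt t by rewrite sqrtr_gt0.
  have : 8 * C * `|s| < d * Num.sqrt t.
    rewrite mulrC -ltr_pdivrMl//.
    have : ((8 * C * `|s|) / d + 1) ^+ 2 <= t by near: t; exact: near_pinfty_ge.
    move=> /ler_wsqrtr; rewrite sqrtr_sqr ger0_norm; last first.
      by rewrite addr_ge0// divr_ge0 ?(ltW d0)// !mulr_ge0// ltW.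
    move=> X; apply: lt_le_trans X.
    by rewrite (_ : d^-1 * _ = 8 * C * `|s| / d) ?ltrDl//; ring.
  move=> A B.
  rewrite (_ : _ * _ = (4 * C * `|s|) * ln t / t); last by ring.
  rewrite ltr_pdivrMr// -[X in _ < _ * X](sqr_sqrtr (ltW t0)) expr2 mulrA.
  apply: (@le_lt_trans _ _ (4 * C * `|s| * (2 * Num.sqrt t))).
    by rewrite ler_wpM2l// !mulr_ge0// ltW.
  rewrite mulrA ltr_pM2r//; move: A; clear; lra.
have HLu u : `|u| <= `|s| -> `|logscale n H (t - u) - logscale n H t| < d.
  move=> us; apply: le_lt_trans LL.
  apply: (@le_trans _ _ (4 * C * (`|u| * (ln t / t)))).
    by move: u us (le_trans us st) => u _; move: u; near: t.
  rewrite ler_wpM2l//; first by move: C0; clear; lra.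
  by rewrite ler_wpM2r// divr_ge0 ?ln_ge0//; move: t2; clear; lra.
have Eu u : t / 2 <= u -> lambda ^+ n * expR (logscale n H u) = loghaz lambda u ^+ n * H u.
  by move: u; rewrite mulrC; near: t; exact: near_oo_ge E.
have Pu u : t / 2 <= u -> derive1n n H u = phi u * (loghaz lambda u ^+ n * H u).
  by move: u; rewrite mulrC; near: t; exact: near_oo_ge pH.
have P1u u : t / 2 <= u -> `|(-1) ^+ n - phi u| <= e2.
  by move: u; rewrite mulrC; near: t; exact: near_oo_ge P.
have Du u : t / 2 <= u -> forall j, (j < n)%N -> derivable (derive1n j H) u 1.
  by move: u; rewrite mulrC; near: t; exact: near_oo_ge D.
have ut u : `|u| <= `|s| -> t / 2 <= t - u.
  by move=> /le_trans/(_ st); rewrite ler_norml => /andP[_]; lra.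
rewrite /remainder st.
have := @taylor_bound n H t `|s| (e1 * W) _ _ s (lexx _).
move=> /(_ _ _)/le_trans; apply.
- by move=> j jn u us; apply: Du => //; exact: ut.
- move=> u us; have tu := ut _ us.
  have tt : t / 2 <= t by lra.
  rewrite (Pu _ tu) (Pu _ tt) -(Eu _ tu) -/W.
  have W1 : lambda ^+ n * expR (logscale n H t) = W by rewrite Eu.
  set x := logscale n H (t - u) - logscale n H t.
  have -> : logscale n H (t - u) = x + logscale n H t by rewrite subrK.
  rewrite expRD [lambda ^+ n * _]mulrCA W1 mulrA -mulrBl normrM (gtr0_norm W0) ler_wpM2r ?(ltW W0)//.
  have X : `|1 - expR x| <= e2.
    rewrite -[X in X - _]expR0; apply: hd => /=; rewrite sub0r normrN.
    exact: HLu.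
  have := P1u _ tu; have := P1u _ tt.
  have : `|(-1) ^+ n| = 1 :> R by rewrite normrX normrN1 expr1n.
  have e21 : e2 <= 1 by rewrite ge_min lexx.
  have e26 : e2 <= e1 / 6 by rewrite ge_min lexx orbT.
  set a := phi (t - u); set b := phi t; set z := (-1) ^+ n.
  move=> zn bz az.
  have a2 : `|a| <= 2.
    rewrite (_ : a = z - (z - a)); last by ring.
    by rewrite (le_trans (ler_normB _ _))// zn; move: az e21; clear; lra.
  rewrite (_ : a * expR x - b = - (a * (1 - expR x)) + (z - b) - (z - a)); last by ring.
  apply: (@le_trans _ _ (2 * e2 + e2 + e2)); last by move: e26 e10; clear; lra.
  rewrite (le_trans (ler_normB _ _))// lerD//.
  rewrite (le_trans (ler_normD _ _))// lerD// normrN normrM ler_pM//.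
- rewrite mulrA ler_wpM2r ?(ltW W0)// /e1 mulrCA -[X in _ <= X]mulr1.
  rewrite ler_wpM2l ?(ltW e0)// ler_pdivrMr ?exprn_gt0// mul1r.
  by rewrite lerXn2r ?nnegrE ?(ltW s1)// lerDr.
Unshelve. all: by end_near. Qed.

(** * Comparison of the tail at two points *)

Lemma hazard_ge lambda (mu : R) h : 0 < lambda -> mu < lambda ->
  hazard_log_asymp lambda h -> \forall t \near +oo, mu * (ln t / t) <= h t.
Proof.
move=> l0 ml /hazard_log_asympE /cvgrPdist_le hh.
have e0 : 0 < 1 - mu / lambda by rewrite subr_gt0 ltr_pdivrMr ?mul1r.
have := hh _ e0; apply: filterS2 (loghaz_gt0 l0) => t L0 H.
have : mu / lambda <= h t / loghaz lambda t.
  by move: H; rewrite ler_norml => /andP[_]; lra.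
by rewrite ler_pdivlMr// /loghaz !mulrA divfK// gt_eqF.
Qed.

Lemma hazard_le lambda (mu : R) h : 0 < lambda -> lambda < mu ->
  hazard_log_asymp lambda h -> \forall t \near +oo, h t <= mu * (ln t / t).
Proof.
move=> l0 ml /hazard_log_asympE /cvgrPdist_le hh.
have e0 : 0 < mu / lambda - 1 by rewrite subr_gt0 ltr_pdivlMr ?mul1r.
have := hh _ e0; apply: filterS2 (loghaz_gt0 l0) => t L0 H.
have : h t / loghaz lambda t <= mu / lambda.
  by move: H; rewrite ler_norml => /andP[]; lra.
by rewrite ler_pdivrMr// /loghaz !mulrA divfK// gt_eqF.
Qed.

Lemma derive_npos_noninc (L L' : R -> R) :
  (\forall t \near +oo, is_derive (t : R) (1 : R) L (L' t)) ->
  (\forall t \near +oo, L' t <= 0) ->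
  \forall x \near +oo, forall y, x <= y -> L y <= L x.
Proof.
move=> dL dL0.
have /near_ooP[T T1 HT] : \forall t \near +oo, derivable L t 1 /\ derive1 L t <= 0.
  apply: filterS2 dL dL0 => t dt dt0; split.
    exact: (@ex_derive _ _ _ _ _ _ _ dt).
  by rewrite derive1E; have -> := @derive_val _ _ _ _ _ _ _ dt.
apply: filterS (near_pinfty_ge T) => x Tx y xy.
have [|z /andP[xz _] fz] := @MVT_derive L x y xy.
  by move=> z /andP[xz _]; apply: (HT _ _).1; exact: le_trans xz.
rewrite -subr_le0 fz mulr_le0_ge0 ?subr_ge0//.
by apply: (HT _ _).2; exact: le_trans xz.
Qed.

(** [mu / 2 * (ln t)^2] is a primitive of [mu * ln t / t]. The sign of this derivative is eventually
    that of [mu - lambda], and monotonicity then compares [H] with a function Gaussian in [ln t]. *)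
Lemma derivable_ln_sqr lambda m H h (mu : R) : logtail lambda m H h ->
  \forall t \near +oo, is_derive (t : R) (1 : R)
     (fun u => ln (H u) + mu / 2 * (ln u * ln u)) (mu * (ln t / t) - h t).
Proof.
move=> HH; apply: filterS2 (derivable_ln_logtail HH) near_ln_ge1 => t d1 [t1 _].
have d3 := is_derive1_ln (lt_le_trans ltr01 t1).
have d4 := @is_deriveM _ _ _ _ t 1 _ _ d3 d3.
have d5 := @is_deriveZ _ _ _ _ (mu / 2) t 1 _ d4.
have := @is_deriveD _ _ _ _ _ t 1 _ _ d1 d5.
by have -> : - h t + (mu / 2) *: (ln t *: t^-1 + ln t *: t^-1) =
   mu * (ln t / t) - h t by rewrite /GRing.scale /=; field; rewrite gt_eqF// (lt_le_trans ltr01 t1).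
Qed.

Lemma tail_ratio_le lambda m H h (mu : R) : 0 < lambda -> mu < lambda ->
  logtail lambda m H h -> \forall x \near +oo, forall y, x <= y ->
    H y <= H x * expR (mu / 2 * (ln x * ln x - ln y * ln y)).
Proof.
move=> l0 ml HH; have [H0 _ _ hh] := HH.
have D := derivable_ln_sqr mu HH.
have S : \forall t \near +oo, mu * (ln t / t) - h t <= 0.
  by apply: filterS (hazard_ge l0 ml hh) => t; rewrite subr_le0.
have a1 : 0 < 1 :> R by [].
apply: filterS2 (derive_npos_noninc D S) (near_oo_ge a1 H0) => x Hx H0x y xy.
have hx : 0 < H x by apply: H0x; rewrite mul1r.
have hy : 0 < H y by apply: H0x; rewrite mul1r.
rewrite -[X in X <= _](@lnK R) ?posrE// -[X in X * _](@lnK R) ?posrE//.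
by rewrite -expRD ler_expR; move: (Hx _ xy); lra.
Qed.

Lemma tail_ratio_ge lambda m H h (mu : R) : 0 < lambda -> lambda < mu ->
  logtail lambda m H h -> \forall x \near +oo, forall y, x <= y ->
    H x * expR (mu / 2 * (ln x * ln x - ln y * ln y)) <= H y.
Proof.
move=> l0 ml HH; have [H0 _ _ hh] := HH.
have D := derivable_ln_sqr mu HH.
have D' : \forall t \near +oo, is_derive (t : R) (1 : R)
     (- (fun u => ln (H u) + mu / 2 * (ln u * ln u))) (- (mu * (ln t / t) - h t)).
  by apply: filterS D => t; exact: is_deriveN.
have S : \forall t \near +oo, - (mu * (ln t / t) - h t) <= 0.
  by apply: filterS (hazard_le l0 ml hh) => t; rewrite oppr_le0 subr_ge0.
have a1 : 0 < 1 :> R by [].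
apply: filterS2 (derive_npos_noninc D' S) (near_oo_ge a1 H0) => x Hx H0x y xy.
have hx : 0 < H x by apply: H0x; rewrite mul1r.
have hy : 0 < H y by apply: H0x; rewrite mul1r.
rewrite -[X in _ <= X](@lnK R) ?posrE// -[X in X * _](@lnK R) ?posrE//.
rewrite -expRD ler_expR; have := Hx _ xy; rewrite lerN2.
lra.
Qed.

Lemma tail_noninc lambda m H h : 0 < lambda ->
  logtail lambda m H h -> \forall x \near +oo, forall y, x <= y -> H y <= H x.
Proof.
move=> l0 HH; apply: filterS (tail_ratio_le l0 l0 HH) => x Hx y /Hx.
by rewrite !mul0r expR0 mulr1.
Qed.

(** Factor [(ln x)^2 - (ln y)^2]: the coefficient of [ln x - ln y] is at least [lambda / 2 * ln x],
    which exceeds any given [p]. The bound is uniform in [y >= x]. *)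
Lemma tail_decay lambda m H h (p : R) : 0 < lambda -> 0 <= p ->
  logtail lambda m H h -> \forall x \near +oo, forall y, x <= y ->
    H y <= H x * (x / y) `^ p.
Proof.
move=> l0 p0 HH; have l2 : lambda / 2 < lambda by lra.
have [H0 _ _ _] := HH.
near=> x => y xy.
have [x1 lx1] : 1 <= x /\ 1 <= ln x by near: x; exact: near_ln_ge1.
have hx : 0 < H x by near: x.
have x0 : 0 < x by lra.
have y0 : 0 < y by lra.
apply: (@le_trans _ _ (H x * expR (lambda / 2 / 2 * (ln x * ln x - ln y * ln y)))).
  by move: y xy {y0}; near: x; exact: tail_ratio_le l0 l2 HH.
rewrite ler_pM2l// /powR gt_eqF ?divr_gt0// ler_expR ln_div ?posrE//.
have lxy : ln x <= ln y by rewrite ler_ln ?posrE.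
have lp : p <= lambda / 2 * ln x.
  rewrite mulrC -ler_pdivrMr; last lra.
  by near: x; exact: near_ln_ge.
have -> : lambda / 2 / 2 * (ln x * ln x - ln y * ln y) =
  lambda / 2 * ((ln y + ln x) / 2) * (ln x - ln y) by field.
apply: ler_wnM2r; first by rewrite subr_le0.
apply: (le_trans lp); rewrite ler_wpM2l//; lra.
Unshelve. all: by end_near. Qed.

(** The squares [(ln t)^2] cancel and the cross term, linear in [ln t], becomes a power of [t]. *)
Lemma expR_sqr_scale (mu a b t : R) : 0 < a -> 0 < b -> 0 < t ->
  expR (mu / 2 * (ln (a * t) * ln (a * t) - ln (b * t) * ln (b * t))) =
  expR (- (mu / 2 * ln (b / a) * (ln a + ln b))) * t `^ (- (mu * ln (b / a))).
Proof.
move=> a0 b0 t0; rewrite /powR gt_eqF// -expRD; congr expR.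
by rewrite !lnM ?posrE ?invr_gt0// lnV ?posrE//; field.
Qed.

Lemma tail_scale_le lambda m H h (mu a b : R) : 0 < lambda -> mu < lambda ->
  0 < a -> a <= b -> logtail lambda m H h ->
  exists2 C, 0 < C & \forall t \near +oo,
    H (b * t) <= C * t `^ (- (mu * ln (b / a))) * H (a * t).
Proof.
move=> l0 ml a0 ab HH; have b0 : 0 < b by lra.
exists (expR (- (mu / 2 * ln (b / a) * (ln a + ln b)))); first exact: expR_gt0.
apply: filterS2 (near_oo_scale a0 (tail_ratio_le l0 ml HH)) (near_pinfty_ge 1) => t Ht t1.
have t0 : 0 < t by lra.
have := Ht (b * t); rewrite ler_wpM2r ?(ltW t0)// => /(_ isT).
by rewrite expR_sqr_scale// [H (a * t) * _]mulrC.
Qed.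

Lemma tail_scale_ge lambda m H h (a b : R) : 0 < lambda ->
  0 < a -> 0 < b -> logtail lambda m H h ->
  exists2 p : nat, True & exists2 C, 0 < C & \forall t \near +oo,
    H (a * t) <= C * t ^+ p * H (b * t).
Proof.
move=> l0 a0 b0 HH; have [ab|ba] := leP a b; last first.
  exists 0%N => //; exists 1 => //.
  apply: filterS2 (near_oo_scale b0 (tail_noninc l0 HH)) (near_pinfty_ge 0) => t Ht t0.
  by rewrite !mul1r; apply: Ht; rewrite ler_wpM2r// ltW.
have ml : lambda < lambda + 1 by rewrite ltrDl.
pose q := (lambda + 1) * ln (b / a).
have [H0 _ _ _] := HH.
exists (Num.truncn q).+1 => //.
exists (expR (((lambda + 1) / 2 * ln (b / a) * (ln a + ln b)))); first exact: expR_gt0.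
apply: filterS3 (near_oo_scale a0 (tail_ratio_ge l0 ml HH)) (near_pinfty_ge 1) (near_oo_scale b0 H0) => t Ht t1 Hb.
have t0 : 0 < t by lra.
have := Ht (b * t); rewrite ler_wpM2r ?(ltW t0)// => /(_ isT).
rewrite expR_sqr_scale// expRN powRN -/q -invfM ler_pdivrMr; last first.
  by rewrite mulr_gt0 ?expR_gt0// powR_gt0.
move=> /le_trans; apply; rewrite mulrC ler_pM2r// ler_pM2l ?expR_gt0//.
by rewrite -powR_mulrn ?(ltW t0)// ler_powR// ltW// truncnS_gt.
Qed.

Lemma tail_superpoly lambda m H h (p : nat) : 0 < lambda ->
  logtail lambda m H h -> exists2 C, 0 < C & \forall t \near +oo, H t <= C / t ^+ p.
Proof.
move=> l0 HH; have [H0 _ _ _] := HH.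
have [T [T1 HT HT0]] : exists T, [/\ 1 <= T,
    forall y, T <= y -> H y <= H T * (T / y) `^ p%:R & 0 < H T].
  have /near_ooP[T T1 HT] : \forall x \near +oo, (forall y, x <= y -> H y <= H x * (x / y) `^ p%:R) /\ 0 < H x.
    by apply: filterS2 (tail_decay l0 (ler0n R p) HH) H0.
  by exists T; split => //; have [] := HT T (lexx _).
exists (H T * T ^+ p); first by rewrite mulr_gt0// exprn_gt0// (lt_le_trans ltr01).
apply: filterS (near_pinfty_ge T) => t Tt; apply: (le_trans (HT _ Tt)).
rewrite powR_mulrn; last by rewrite divr_ge0//; lra.
by rewrite expr_div_n mulrA.
Qed.
End Eventually.

(** * Sums of independent terms *)

Section IntSums.
Context {R : realType}.
Implicit Types (a : int -> R).

(** The integers from [- n] to [n], in the order in which [wpsum] adds its terms. *)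
Definition ints (n : nat) : seq int :=
  [seq k%:Z - n%:Z | k <- iota 0 (2 * n).+1].

Lemma mem_ints n (i : int) : (i \in ints n) = (`|i| <= n)%N.
Proof.
apply/mapP/idP => [[k]|iN]; first by rewrite mem_iota => H ->; lia.
exists (absz (i + n%:Z)); last by lia.
by rewrite mem_iota; lia.
Qed.

Lemma ints_uniq n : uniq (ints n).
Proof. by rewrite map_inj_uniq ?iota_uniq// => x y; lia. Qed.

Definition isum a (n : nat) : R := \sum_(i <- ints n) a i.

Lemma isum_ord a n : \sum_(k < (2 * n).+1) a (k%:Z - n%:Z) = isum a n.
Proof.
by rewrite -(big_mkord xpredT (fun k : nat => a (k%:Z - n%:Z))) /isum big_map
  /index_iota subn0.
Qed.

Lemma isum_homo a : (forall i, 0 <= a i) -> nondecreasing_seq (isum a).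
Proof.
move=> a0 n n' nn'; rewrite /isum.
rewrite [X in _ <= X](bigID (fun i => i \in ints n)) /=.
rewrite -[X in _ <= X + _]big_filter.
have -> : \sum_(i <- [seq i <- ints n' | i \in ints n]) a i = \sum_(i <- ints n) a i.
  apply: perm_big; apply: uniq_perm; rewrite ?filter_uniq ?ints_uniq// => i.
  by rewrite mem_filter !mem_ints; lia.
by rewrite lerDl sumr_ge0.
Qed.

(** [a] is the difference of [|a| + a] and [|a|], both nonnegative with bounded, nondecreasing
    partial sums. *)
Lemma isum_cvg a (B : R) : (forall s, uniq s -> \sum_(i <- s) `|a i| <= B) ->
  cvgn (isum a) /\ `|limn (isum a)| <= B.
Proof.
move=> aB.
have c1 : cvgn (isum (fun i => `|a i|)).
  apply: nondecreasing_is_cvgn; first by apply: isum_homo.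
  by exists B => _ [n _ <-]; apply: aB; exact: ints_uniq.
have c2 : cvgn (isum (fun i => `|a i| + a i)).
  apply: nondecreasing_is_cvgn.
    by apply: isum_homo => i; rewrite -lerBlDr sub0r -normrN ler_norm.
  exists (B + B) => _ [n _ <-]; rewrite /isum big_split lerD ?aB ?ints_uniq//.
  by apply: le_trans (aB _ (ints_uniq n)); apply: ler_sum => i _; exact: ler_norm.
have E : isum a = (isum (fun i => `|a i| + a i)) \- (isum (fun i => `|a i|)).
  by apply/funext => n; rewrite /isum /= big_split /= [X in _ = X - _]addrC addrK.
have c3 : cvgn (isum a) by rewrite E; exact: is_cvgB.
split=> //.
have nB n : `|isum a n| <= B.
  by apply: le_trans (aB _ (ints_uniq n)); exact: ler_norm_sum.
rewrite ler_norml; apply/andP; split.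
  apply: limr_ge => //; apply: nearW => n.
  by have := nB n; rewrite ler_norml => /andP[].
apply: limr_le => //; apply: nearW => n.
by have := nB n; rewrite ler_norml => /andP[].
Qed.

Lemma limn_isumD a b : cvgn (isum a) -> cvgn (isum b) ->
  limn (isum (fun i => a i + b i)) = limn (isum a) + limn (isum b).
Proof.
move=> ca cb; rewrite -limD//; congr (limn _).
by apply/funext => n; rewrite /isum big_split.
Qed.

Lemma limn_isum_fin a (N : nat) : (forall i : int, (N < `|i|)%N -> a i = 0) ->
  cvgn (isum a) /\ limn (isum a) = isum a N.
Proof.
move=> a0.
have E : \forall n \near \oo, isum a n = isum a N.
  exists N => // n /= Nn; rewrite /isum (bigID (fun i => i \in ints N)) /=.
  rewrite -big_filter (perm_big (ints N)).
    rewrite [X in _ + X]big1 ?addr0// => i; rewrite mem_ints -ltnNge; exact: a0.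
  apply: uniq_perm; rewrite ?filter_uniq ?ints_uniq// => i.
  by rewrite mem_filter !mem_ints; lia.
split; first by apply/cvg_ex; exists (isum a N); exact: cvg_near_cst.
exact: lim_near_cst.
Qed.
End IntSums.

(** * Measurability of pointwise limits *)

Section MeasurableLimit.
Context {R : realType} d (T : measurableType d).

(** The Cauchy criterion describes convergence with countably many quantifiers. *)
Lemma measurable_cvgn (f : nat -> T -> R) : (forall n, measurable_fun setT (f n)) ->
  measurable [set w | cvgn (f ^~ w)].
Proof.
move=> mf.
rewrite (_ : [set w | _] = \bigcap_k \bigcup_N \bigcap_m
   [set w | `|f (N + m)%N w - f N w| < k.+1%:R^-1]); last first.
  apply/seteqP; split=> w /=.
    move=> /cvg_ex[l /cvgrPdist_lt fl] k _.
    have k0 : 0 < k.+1%:R^-1 / 2 :> R by rewrite divr_gt0.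
    have [N _ HN] := fl _ k0; exists N => // m _ /=.
    have H1 := HN _ (leqnn N); have H2 := HN (N + m)%N (leq_addr _ _).
    rewrite -[_ - _](subrKA l) (splitr k.+1%:R^-1) (le_lt_trans (ler_normD _ _))// ltrD//.
    by rewrite distrC.
  move=> H; apply: cauchy_cvg; apply: cauchy_exP => e e0.
  have [k _ /= ke] := near_infty_natSinv_lt (PosNum e0).
  have [N _ HN] := H k I; exists (f N w); exists N => // m /= Nm.
  rewrite -ball_normE /= distrC; apply: lt_trans (ke _ (leqnn k)).
  by have := HN (m - N)%N I; rewrite /= subnKC.
apply: bigcapT_measurable => k; apply: bigcupT_measurable => N.
apply: bigcapT_measurable => m.
rewrite (_ : [set w | _] = (fun w => `|f (N + m)%N w - f N w|) @^-1` `]-oo, k.+1%:R^-1[).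
  rewrite -[X in measurable X]setTI; apply: measurableT_comp => //.
  exact: measurable_funB.
by apply/seteqP; split=> w /=; rewrite in_itv.
Qed.

Lemma measurable_limn (f : nat -> T -> R) : (forall n, measurable_fun setT (f n)) ->
  measurable_fun setT (fun w => limn (f ^~ w)).
Proof.
move=> mf; have mC := measurable_cvgn mf; set C := [set w | _] in mC.
rewrite -(setUv C); apply/measurable_funU => //; first exact: measurableC.
split.
  apply: (measurable_realfun.measurable_fun_cvg (h := f)) => //.
  by move=> n; exact: measurable_funS (mf n).
(* Where the sequence diverges, [limn] takes the constant default value [point]; no null set has to
   be removed. *)
apply: (eq_measurable_fun (cst (point : R))) => //.
by move=> w; rewrite inE /C /= => nc; rewrite dvgP.
Qed.

Lemma measurable_isum (a : int -> T -> R) n : (forall i, measurable_fun setT (a i)) ->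
  measurable_fun setT (fun w => isum (a ^~ w) n).
Proof. by move=> ma; rewrite /isum; apply: measurable_sum. Qed.
End MeasurableLimit.

(** * Independence of one term and the sum of the others *)

Section Independence.
Context {R : realType} d (T : measurableType d) (P : probability T R).
Variable X : int -> {RV P >-> R}.
Hypothesis indep : mutually_independent P (fun i => (X i : T -> R)).

(** Generators, stable under intersection, of the sigma-algebra of all the [X j] with [j != i]. *)
Definition cylinder (i : int) : set_system T :=
  [set E | exists s : seq int, exists B : int -> set R,
     [/\ uniq s, i \notin s, (forall j, measurable (B j)) &
         E = \bigcap_(j in [set` s]) (X j @^-1` B j)]].

Lemma cylinder_setI i : setI_closed (cylinder i).
Proof.
move=> _ _ [s [B [us si mB ->]]] [s' [B' [us' si' mB' ->]]].
exists (undup (s ++ s')).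
exists (fun j => (if j \in s then B j else setT) `&` (if j \in s' then B' j else setT)).
split.
- exact: undup_uniq.
- by rewrite mem_undup mem_cat negb_or si si'.
- by move=> j; apply: measurableI; case: ifP.
apply/seteqP; split=> w /=.
  move=> [H H'] j; rewrite /= mem_undup mem_cat => js; split.
    by case: ifPn => // /H.
  by case: ifPn => // /H'.
move=> H; split=> j /= js.
  have : j \in undup (s ++ s') by rewrite mem_undup mem_cat js.
  by move=> /H /=; rewrite js => -[].
have : j \in undup (s ++ s') by rewrite mem_undup mem_cat js orbT.
by move=> /H /=; rewrite js => -[].
Qed.

Lemma measurable_RV (i : int) (B : set R) : measurable B -> measurable (X i @^-1` B).
Proof. by move=> mB; rewrite -[X in measurable X]setTI; exact: measurable_funP. Qed.

Lemma cylinder_measurable i : cylinder i `<=` measurable.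
Proof.
move=> _ [s [B [_ _ mB ->]]]; apply: fin_bigcap_measurable => // j _.
exact: measurable_RV.
Qed.

Lemma indep_cylinder i (A : set R) (E : set T) : measurable A -> <<s cylinder i >> E ->
  measurable E /\ P (X i @^-1` A `&` E) = (P (X i @^-1` A) * P E)%E.
Proof.
move=> mA; set Y := X i @^-1` A.
have mY : measurable Y by exact: measurable_RV.
pose H : set_system T := [set E | measurable E /\ P (Y `&` E) = (P Y * P E)%E].
suff : <<s cylinder i >> `<=` H by move=> sH /sH.
apply: lambda_system_subset => //; first exact: cylinder_setI.
- split.
  + by [].
  + by split => //; rewrite setIT probability_setT mule1.
  + move=> A' B BA [mA' EA] [mB EB]; split; first exact: measurableD.
    have D U V : measurable U -> measurable V -> V `<=` U -> P (U `\` V) = (P U - P V)%E.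
      move=> mU mV VU; rewrite measureD//; last by rewrite -ge0_fin_numE// fin_num_measure.
      by rewrite (setIidr VU).
    rewrite (_ : Y `&` (A' `\` B) = (Y `&` A') `\` (Y `&` B)); last first.
      by apply/seteqP; split=> w /= [] => [? []|[? ?]]; tauto.
    rewrite !D//; [|exact: measurableI|exact: measurableI|by move=> w [? /BA]].
    by rewrite EA EB muleBr ?fin_num_measure ?fin_num_adde_defr// fin_num_measure.
  + move=> F ndF HF; have mF n : measurable (F n) by case: (HF n).
    have mUF : measurable (\bigcup_n F n) by exact: bigcupT_measurable.
    split=> //; rewrite setI_bigcupr.
    have c1 : (P \o F) n @[n --> \oo] --> P (\bigcup_n F n).
      exact: nondecreasing_cvg_mu.
    have c2 : (P \o (fun n => Y `&` F n)) n @[n --> \oo] --> P (\bigcup_n (Y `&` F n)).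
      apply: nondecreasing_cvg_mu.
      * by move=> n; exact: measurableI.
      * by rewrite -setI_bigcupr; exact: measurableI.
      * by move=> n m nm; apply/subsetPset; apply: setIS; apply/subsetPset; exact: ndF.
    have c3 : (P \o (fun n => Y `&` F n)) n @[n --> \oo] --> (P Y * P (\bigcup_n F n))%E.
      rewrite (_ : _ \o _ = fun n => (P Y * P (F n))%E); last first.
        by apply/funext => n /=; case: (HF n).
      by apply: cvgeZl => //; exact: fin_num_measure.
    exact: cvg_unique c2 c3.
- move=> E' cE; split; first exact: cylinder_measurable cE.
  case: cE => s [B [us si mB ->]].
  have H1 := indep us mB.
  have us' : uniq (i :: s) by rewrite /= si.
  have mB' j : measurable ((fun j => if j == i then A else B j) j).
    by case: ifP.
  have := indep us' mB'.
  rewrite big_cons eqxx H1 => K; rewrite (_ : Y `&` _ =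
      \bigcap_(j in [set` i :: s]) X j @^-1` (if j == i then A else B j)); last first.
    apply/seteqP; split=> w /=.
      move=> [Yw H'] j /=; rewrite inE => /orP[/eqP->|js]; first by rewrite eqxx.
      by case: eqP => [->//|_]; exact: H'.
    move=> H'; split; first by have := H' i; rewrite /= inE eqxx => /(_ isT).
    move=> j /= js; have := H' j; rewrite /= inE js orbT => /(_ isT).
    by case: eqP => // ji; rewrite -ji js in si.
  rewrite K; congr (_ * _)%E; rewrite !big_seq; apply: eq_bigr => j js.
  by case: eqP => // ji; rewrite -ji js in si.
Qed.

Lemma indep_pair i j (A B : set R) : i != j -> measurable A -> measurable B ->
  P (X i @^-1` A `&` X j @^-1` B) = (P (X i @^-1` A) * P (X j @^-1` B))%E.
Proof.
move=> ij mA mB; apply: (indep_cylinder _ _).2 => //.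
apply: sub_sigma_algebra; exists [:: j], (fun=> B); split=> //.
  by rewrite inE.
by rewrite set_cons1 bigcap_set1.
Qed.

Lemma indep_limn i (a : int -> T -> R) :
  (forall j, j != i -> exists c : R, a j = (fun w => c * X j w)) -> a i = cst 0 ->
  forall A B : set R, measurable A -> measurable B ->
  P (X i @^-1` A `&` (fun w => limn (isum (a ^~ w))) @^-1` B) =
  (P (X i @^-1` A) * P ((fun w => limn (isum (a ^~ w))) @^-1` B))%E.
Proof.
move=> aj ai A B mA mB; apply: (indep_cylinder _ _).2 => //.
(* The measurability of limits is applied to [T] with the coarser sigma-algebra of the cylinders in
   place of its own. *)
pose T' := g_sigma_algebraType (cylinder i).
have ma j : measurable_fun [set: T'] (a j).
  have [->|ji] := eqVneq j i; first by rewrite ai; exact: measurable_cst.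
  have [c ->] := aj _ ji; apply: measurable_funM => //.
  move=> _ B' mB'; rewrite setTI.
  apply: sub_sigma_algebra; exists [:: j], (fun=> B'); split=> //.
    by rewrite inE eq_sym.
  by rewrite set_cons1 bigcap_set1.
have mn n : measurable_fun [set: T'] (fun w => isum (a ^~ w) n).
  exact: (@measurable_isum R _ T' a n ma).
have := @measurable_limn R _ T' (fun n w => isum (a ^~ w) n) mn measurableT B mB.
by rewrite setTI.
Qed.
End Independence.

(** * Elementary probability estimates *)

Section Prob.
Context {R : realType} d (T : measurableType d) (P : probability T R).
Implicit Types A B : set T.

Lemma probE A : measurable A -> P A = (prob P A)%:E.
Proof. by move=> mA; rewrite /prob fineK// fin_num_measure. Qed.

Lemma prob_ge0 A : 0 <= prob P A.
Proof. by rewrite /prob fine_ge0. Qed.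

Lemma le_prob A B : measurable A -> measurable B -> A `<=` B -> prob P A <= prob P B.
Proof. by move=> mA mB AB; rewrite -lee_fin -!probE// le_measure// inE. Qed.

Lemma probU_le A B : measurable A -> measurable B ->
  prob P (A `|` B) <= prob P A + prob P B.
Proof.
move=> mA mB; rewrite -lee_fin EFinD -!probE//; last exact: measurableU.
exact: measureU2.
Qed.

Lemma probC A : measurable A -> prob P (~` A) = 1 - prob P A.
Proof.
move=> mA; apply: EFin_inj; rewrite -probE; last exact: measurableC.
by rewrite probability_setC// EFinB -probE.
Qed.

Lemma prob_bigsetU_le (I : choiceType) (s : seq I) (E : I -> set T) :
  (forall i, measurable (E i)) ->
  prob P (\big[setU/set0]_(i <- s) E i) <= \sum_(i <- s) prob P (E i).
Proof.
move=> mE; elim: s => [|i s IH]; first by rewrite !big_nil /prob measure0.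
rewrite !big_cons (le_trans (probU_le _ _))// ?lerD2l//.
exact: bigsetU_measurable.
Qed.

Lemma prob_disjoint_sum (I : choiceType) (s : seq I) (E : I -> set T) : uniq s ->
  (forall i, measurable (E i)) ->
  (forall i j, i \in s -> j \in s -> i != j -> E i `&` E j = set0) ->
  prob P (\big[setU/set0]_(i <- s) E i) = \sum_(i <- s) prob P (E i).
Proof.
move=> us mE; elim: s us => [|i s IH] /=; first by rewrite !big_nil /prob measure0.
move=> /andP[si us] tE; rewrite !big_cons -IH//; last first.
  by move=> j k js ks; apply: tE; rewrite inE ?js ?ks orbT.
have mU : measurable (\big[setU/set0]_(j <- s) E j) by exact: bigsetU_measurable.
apply: EFin_inj; rewrite EFinD -!probE//; last exact: measurableU.
rewrite measureU//; rewrite -subset0 => w [Ew].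
rewrite -bigcup_seq => -[j /= js Ejw].
have : (E i `&` E j) w by split.
rewrite tE// ?inE ?eqxx ?js ?orbT//.
by apply: contraNneq si => ->.
Qed.

(* Inclusion-exclusion up to an exceptional set [Z]. *)
Lemma prob_sum_approx (I : choiceType) (s : seq I) (A Z : set T) (E : I -> set T) :
  uniq s -> measurable A -> measurable Z -> (forall i, measurable (E i)) ->
  (forall w, A w -> ~ Z w -> exists2 i, i \in s & E i w) ->
  (forall i w, i \in s -> E i w -> ~ Z w -> A w) ->
  (forall i j w, i \in s -> j \in s -> i != j -> E i w -> E j w -> Z w) ->
  `|prob P A - \sum_(i <- s) prob P (E i)| <= (size s).+1%:R * prob P Z.
Proof.
move=> us mA mZ mE AE EA EE.
have mD i : measurable (E i `\` Z) by exact: measurableD.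
have H1 : prob P A <= \sum_(i <- s) prob P (E i) + prob P Z.
  apply: (@le_trans _ _ (prob P (\big[setU/set0]_(i <- s) E i `|` Z))).
    apply: le_prob => //.
      by apply: measurableU => //; exact: bigsetU_measurable.
    move=> w Aw; have [Zw|nZw] := pselect (Z w); [by right|left].
    by have [i si Ei] := AE _ Aw nZw; rewrite -bigcup_seq; exists i.
  rewrite (le_trans (probU_le _ _))//; first exact: bigsetU_measurable.
  by rewrite lerD2r prob_bigsetU_le.
have H2 : \sum_(i <- s) prob P (E i) <= prob P A + (size s)%:R * prob P Z.
  apply: (@le_trans _ _ (\sum_(i <- s) (prob P (E i `\` Z) + prob P Z))).
    apply: ler_sum => i _; apply: (le_trans _ (probU_le _ _)) => //.
    apply: le_prob => //; first exact: measurableU.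
    by move=> w Ew; have [Zw|nZw] := pselect (Z w); [right|left].
  rewrite big_split /= big_const_seq count_predT iter_addr_0 -[_ *+ size s]mulr_natl lerD//.
  rewrite -prob_disjoint_sum//.
    apply: le_prob => //; first exact: bigsetU_measurable.
    by move=> w; rewrite -bigcup_seq => -[i /= si [Ei nZ]]; exact: EA Ei nZ.
  move=> i j si sj ij; rewrite -subset0 => w [[Ei nZ] [Ej _]].
  by apply: nZ; exact: EE Ei Ej.
rewrite ler_norml -natr1 mulrDl mul1r.
have Z0 : 0 <= prob P Z by exact: prob_ge0.
have SZ : 0 <= (size s)%:R * prob P Z by rewrite mulr_ge0.
by apply/andP; split; lra.
Qed.

Lemma measurable_abs_gt (Y : {RV P >-> R}) (v : R) : measurable [set w | v < `|Y w|].
Proof.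
rewrite (_ : [set w | _] = Y @^-1` ((fun x : R => `|x|) @^-1` `]v, +oo[)); last first.
  by apply/seteqP; split=> w /=; rewrite in_itv /= andbT.
rewrite -[X in measurable X]setTI; apply: measurable_funP => //.
by rewrite -[X in measurable X]setTI; apply: normr_measurable => //; exact: measurable_itv.
Qed.

(** The rays []x, +oo[] generate the Borel sets and are stable under intersection. *)
Lemma prob_preimage_unique (Y Z : {RV P >-> R}) :
  (forall t, dfun P Y t = dfun P Z t) ->
  forall B : set R, measurable B -> P (Y @^-1` B) = P (Z @^-1` B).
Proof.
move=> YZ B mB.
apply: (measure_unique (@RGenOInfty.G R) (fun n : nat => `]-(n%:R : R), +oo[%classic)
  _ _ _ _ (distribution P Y) (distribution P Z)) => //.
- exact: RGenOInfty.measurableE.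
- move=> _ _ [x ->] [y ->]; exists (Num.max x y).
  by apply/seteqP; split=> w /=; rewrite !in_itv /= !andbT gt_max;
    [move=> [-> ->]|move=> /andP].
- by move=> n; exists (- n%:R).
- apply/seteqP; split=> // x _; exists (Num.truncn `|x|).+1 => //=.
  rewrite in_itv /= andbT ltrNl (le_lt_trans (ler_norm _))// normrN.
  exact: truncnS_gt.
- move=> _ [x ->]; rewrite /= /distribution /pushforward.
  have E (W : {RV P >-> R}) : P (W @^-1` `]x, +oo[) = (1 - dfun P W x)%:E.
    rewrite (_ : W @^-1` `]x, +oo[ = ~` [set w | W w <= x]); last first.
      by apply/seteqP; split=> w /=; rewrite in_itv /= andbT ltNge => /negP.
    have mW : measurable [set w | W w <= x].
      rewrite (_ : [set w | W w <= x] = W @^-1` `]-oo, x]); last first.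
        by apply/seteqP; split=> w /=; rewrite in_itv.
      by rewrite -[X in measurable X]setTI; exact: measurable_funP.
    by rewrite probE ?probC//; exact: measurableC.
  by rewrite !E YZ.
- by move=> n; rewrite (le_lt_trans (probability_le1 _ _)) ?ltry//;
    exact: measurable_itv.
Qed.

End Prob.

(** * Tail of an infinite weighted sum *)

Section SeriesTail.
Context {R : realType} d (T : measurableType d) (P : probability T R).
Variable X : int -> {RV P >-> R}.
Hypothesis idd : forall i (B : set R), measurable B -> P (X i @^-1` B) = P (X 0 @^-1` B).

Definition abs_tail (v : R) : R := prob P [set w | v < `|X 0 w|].

Lemma abs_tailE i v : prob P [set w | v < `|X i w|] = abs_tail v.
Proof.
have mB : measurable ((fun x : R => `|x|) @^-1` `]v, +oo[ : set R).
  by rewrite -[X in measurable X]setTI; apply: normr_measurable => //; exact: measurable_itv.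
have E j : [set w | v < `|X j w|] = X j @^-1` ((fun x : R => `|x|) @^-1` `]v, +oo[).
  by apply/seteqP; split=> w /=; rewrite in_itv /= andbT.
by rewrite /abs_tail !E /prob idd.
Qed.

(* If all [|b j X j| <= |b j|^delta u] then the series is at most [eps u]:
   only single-term tails enter the union bound. *)
Lemma series_tail (delta eps v : R) (b : int -> R) :
  0 < delta -> delta < 1 -> 0 < eps -> 0 <= v ->
  (forall s : seq int, uniq s -> \sum_(j <- s) `|b j| `^ delta <= eps) ->
  (forall theta : R, 0 < theta -> theta <= 1 ->
     abs_tail (v / theta) <= theta `^ (delta / (1 - delta)) * abs_tail v) ->
  exists Z : set T, [/\ measurable Z, prob P Z <= abs_tail v &
    forall w, ~ Z w -> forall s : seq int, uniq s ->
      \sum_(j <- s) `|b j * X j w| <= eps `^ (delta^-1) * v].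
Proof.
move=> d0 d1 e0 v0 be decay.
set rho := eps `^ delta^-1.
have r0 : 0 < rho by exact: powR_gt0.
have rE : rho `^ delta = eps.
  by rewrite /rho -powRrM mulVf ?gt_eqF// powRr1// ltW.
have br j : `|b j| <= rho.
  have := be [:: j] isT; rewrite big_seq1 => H.
  have := @ge0_ler_powR R delta^-1 _ (`|b j| `^ delta) eps _ _ H.
  rewrite !nnegrE invr_ge0 (ltW d0) powR_ge0 (ltW e0) => /(_ isT isT isT).
  by rewrite -powRrM mulfV ?gt_eqF// powRr1.
(* With this threshold the bounds [|b j|^delta * u] add up to at most [eps * u = rho * v]. *)
set u := v * rho `^ (1 - delta).
have u0 : 0 <= u by rewrite mulr_ge0// powR_ge0.
pose E j := [set w | `|b j| `^ delta * u < `|b j| * `|X j w|].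
have EE j : measurable (E j) /\ prob P (E j) <= `|b j| `^ delta / eps * abs_tail v.
  have [bj|bj] := eqVneq (b j) 0.
    have -> : E j = set0.
      apply/seteqP; split=> w //; rewrite /E /= bj normr0 powR0 ?gt_eqF//.
      by rewrite !mul0r ltxx.
    split=> //; rewrite /prob measure0 /= mulr_ge0 ?divr_ge0 ?powR_ge0 ?(ltW e0)//.
    exact: prob_ge0.
  have b0 : 0 < `|b j| by rewrite normr_gt0.
  (* [E j] is the event [|X j| > v / theta]. The exponent [delta / (1 - delta)] of the decay
     hypothesis turns [theta] into [|b j|^delta / eps], and these ratios sum to at most 1. *)
  pose theta := (`|b j| / rho) `^ (1 - delta).
  have t0 : 0 < theta by rewrite powR_gt0// divr_gt0.
  have d10 : 0 <= 1 - delta by lra.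
  have t1 : theta <= 1.
    apply: (@le_trans _ _ (1 `^ (1 - delta))); last by rewrite powR1.
    rewrite ge0_ler_powR ?nnegrE ?divr_ge0 ?(ltW r0)//.
    by rewrite ler_pdivrMr// mul1r.
  have bE : `|b j| = `|b j| `^ delta * `|b j| `^ (1 - delta).
    rewrite -powRD ?subrKC ?powRr1//; last by apply/implyP => _; rewrite gt_eqF.
  have -> : E j = [set w | v / theta < `|X j w|].
    have uE : v / theta * `|b j| `^ (1 - delta) = u.
      rewrite /theta powRM ?invr_ge0 ?(ltW b0) ?(ltW r0)//.
      rewrite -[rho^-1]powR_inv1 ?(ltW r0)// -powRrM mulN1r powRN /u.
      have B0 : `|b j| `^ (1 - delta) != 0 by rewrite gt_eqF// powR_gt0.
      have R0 : rho `^ (1 - delta) != 0 by rewrite gt_eqF// powR_gt0.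
      by rewrite invfM invrK mulrA mulrAC divfK.
    have EEq w : (`|b j| `^ delta * u < `|b j| * `|X j w|) = (v / theta < `|X j w|).
      by rewrite [X in _ < X * _]bE -mulrA ltr_pM2l ?powR_gt0// -uE
        [_ * `|X j w|]mulrC ltr_pM2r ?powR_gt0.
    by apply/seteqP; split=> w; rewrite /E /= EEq.
  split; first exact: measurable_abs_gt.
  rewrite abs_tailE (le_trans (decay _ t0 t1))//.
  rewrite /theta -powRrM mulrCA mulfV ?mulr1 ?gt_eqF//; last lra.
  rewrite powRM ?invr_ge0 ?(ltW b0) ?(ltW r0)//.
  by rewrite -powR_inv1 ?(ltW r0)// -powRrM mulN1r powRN rE.
(* The events are reindexed by [nat] in order to use countable subadditivity. *)
pose F n := if pickle_inv n is Some j then E j else set0.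
have mF n : measurable (F n) by rewrite /F; case: pickle_inv => [j|//]; exact: (EE j).1.
exists (\bigcup_n F n); split; first exact: bigcupT_measurable.
- have mU := bigcupT_measurable _ mF.
  rewrite -lee_fin -probE// (le_trans (measure_sigma_subadditive P mF mU (subset_refl _)))//.
  apply: lime_le; first exact: is_cvg_nneseries.
  apply: nearW => n.
  apply: (@le_trans _ _ (\sum_(0 <= k < n) (oapp (fun j => `|b j| `^ delta / eps * abs_tail v) 0 (pickle_inv k))%:E)%E).
    apply: lee_sum => k _; rewrite /F; case: pickle_inv => [j|] /=; last by rewrite measure0.
    by rewrite probE ?lee_fin; [exact: (EE j).2|exact: (EE j).1].
  rewrite sumEFin lee_fin -big_pmap -mulr_suml -mulr_suml.
  rewrite -[X in _ <= X]mul1r ler_wpM2r ?prob_ge0// ler_pdivrMr// mul1r.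
  by apply: be; apply: (pmap_uniq (@pickle_invK _)); exact: iota_uniq.
- move=> w nZ s us.
  apply: (@le_trans _ _ (\sum_(j <- s) `|b j| `^ delta * u)).
    apply: ler_sum => j _; rewrite normrM leNgt; apply/negP => Ejw.
    apply: nZ; exists (pickle j); first exact: I.
    by rewrite /F pickleK_inv.
  rewrite -mulr_suml (le_trans (ler_wpM2r u0 (be _ us)))//.
  have rr : rho `^ delta * rho `^ (1 - delta) = rho.
    rewrite -powRD; last by apply/implyP => _; rewrite gt_eqF.
    by rewrite subrKC powRr1// ltW.
  by rewrite /u -rE mulrCA rr mulrC.
Qed.
End SeriesTail.

(** * Moments from polynomial decay of the tail *)

Section Moments.
Context {R : realType} d (T : measurableType d) (P : probability T R).

Lemma sum_inv_telescope n :
  \sum_(0 <= k < n) ((k.+1%:R * k.+2%:R)^-1 : R) = 1 - n.+1%:R^-1.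
Proof.
elim: n => [|n IH]; first by rewrite big_geq// invr1 subrr.
rewrite big_nat_recr//= IH -[n.+2%:R]natr1.
have : (0 : R) < n.+1%:R by rewrite ltr0n.
move: (n.+1%:R : R) => a a0.
by field; rewrite !gt_eqF//; lra.
Qed.

(** Cut along the events [A n] that [|Y| > n - 1]: the integrand is at most the sum of [(n + 2)^q]
    over the [A n]. A tail exponent [q + 2] leaves [1 / ((n + 1) (n + 2))], whose sum telescopes. *)
Lemma all_moments (Y : T -> R) : measurable_fun setT Y ->
  (forall q : nat, exists2 C : R, 0 < C &
     \forall v \near +oo, prob P [set w | v < `|Y w|] <= C / v ^+ q) ->
  forall q : nat, P.-integrable setT (fun w => ((1 + `|Y w|) ^+ q)%:E).
Proof.
move=> mY tY q; have [C C0 /near_ooP[V V1 HV]] := tY q.+2.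
pose A (n : nat) := [set w | n%:R - 1 < `|Y w|].
have mA n : measurable (A n).
  rewrite (_ : A n = (fun w => `|Y w|) @^-1` `]n%:R - 1, +oo[); last first.
    by apply/seteqP; split=> w /=; rewrite in_itv /= andbT.
  by rewrite -[X in measurable X]setTI; apply: measurableT_comp mY _ _ _ => //; exact: measurable_itv.
pose N := (Num.truncn V).+3.
(* The first summand serves [n >= N], where the tail bound holds and [(n + 2) / 4 <= n - 1]; the
   second serves [n < N], where the probability is bounded by 1. *)
pose C' : R := C * 4 ^+ q.+2 + N.+2%:R ^+ q.+2.
have C'0 : 0 <= C'.
  by rewrite /C'; apply: addr_ge0; rewrite ?exprn_ge0// mulr_ge0 ?exprn_ge0// ltW.
have bnd n : n.+2%:R ^+ q * prob P (A n) <= C' / (n.+1%:R * n.+2%:R).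
  have n10 : 0 < n.+1%:R :> R by rewrite ltr0n.
  have n20 : 0 < n.+2%:R :> R by rewrite ltr0n.
  have n12 : n.+1%:R <= n.+2%:R :> R by rewrite ler_nat.
  have W : n.+1%:R * n.+2%:R <= n.+2%:R ^+ 2 :> R by rewrite expr2 ler_wpM2r// ltW.
  rewrite ler_pdivlMr ?mulr_gt0//.
  apply: (@le_trans _ _ (n.+2%:R ^+ q * prob P (A n) * n.+2%:R ^+ 2)).
    by rewrite ler_wpM2l// mulr_ge0 ?prob_ge0// exprn_ge0// ltW.
  rewrite mulrAC -exprD addn2 /C'.
  have [Nn|nN] := leqP N n.
    have nV : V <= n%:R - 1.
      have : V < (Num.truncn V).+1%:R by exact: truncnS_gt.
      have : (Num.truncn V).+3%:R <= n%:R :> R by rewrite ler_nat.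
      rewrite -[X in X <= _]natr1 -[X in X + _ <= _]natr1; lra.
    have n4 : n.+2%:R / 4 <= n%:R - 1 :> R.
      have : 3%:R <= n%:R :> R by rewrite ler_nat (leq_trans _ Nn).
      rewrite -[n.+2%:R]natr1 -[n.+1%:R]natr1; lra.
    rewrite (@le_trans _ _ (C * 4 ^+ q.+2))//; last by rewrite lerDl exprn_ge0.
    apply: (@le_trans _ _ (n.+2%:R ^+ q.+2 * (C / (n%:R - 1) ^+ q.+2))).
      by rewrite ler_wpM2l ?exprn_ge0// ?(ltW n20)//; exact: HV.
    rewrite mulrCA ler_wpM2l ?(ltW C0)// -expr_div_n.
    rewrite lerXn2r ?nnegrE//; first by rewrite divr_ge0 ?(ltW n20)//; lra.
    by rewrite ler_pdivrMr; [rewrite -ler_pdivrMl//; lra|lra].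
  apply: (@le_trans _ _ (N.+2%:R ^+ q.+2)); last first.
    by rewrite lerDr mulr_ge0 ?exprn_ge0 ?(ltW C0).
  rewrite -[X in _ <= X]mulr1 ler_pM ?exprn_ge0 ?prob_ge0 ?(ltW n20)//.
    by rewrite lerXn2r ?nnegrE ?ler_nat//; lia.
  by rewrite -lee_fin -probE//; exact: probability_le1.
have mf : measurable_fun setT (fun w => ((1 + `|Y w|) ^+ q)%:E).
  apply/measurable_EFinP; apply: measurable_funX; apply: measurable_funD => //.
  exact: measurableT_comp.
apply/integrableP; split=> //.
pose f n w := ((n.+2%:R ^+ q)%:E * (\1_(A n) w)%:E : \bar R)%E.
have f0 n w : (0 <= f n w)%E by rewrite mule_ge0// lee_fin exprn_ge0.
have mfn n : measurable_fun setT (f n).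
  apply: measurable_funeM; apply/measurable_EFinP; exact: measurable_indic.
apply: (@le_lt_trans _ _ (\int[P]_w (\sum_(n <oo) f n w))%E).
  apply: ge0_le_integral => //.
  - exact: measurableT_comp.
  - exact: ge0_emeasurable_sum.
  move=> w _; set n := Num.truncn `|Y w|.
  have nY : n%:R <= `|Y w| < n.+1%:R by exact: truncn_itv.
  apply: (@le_trans _ _ (f n w)).
    rewrite /f indicE mem_set /A /=; last by case/andP: nY; lra.
    rewrite mule1 lee_fin ger0_norm ?exprn_ge0 ?addr_ge0//.
    have n2 : 1 + `|Y w| <= n.+2%:R.
      by rewrite -[n.+2%:R]natr1; case/andP: nY; lra.
    have y0 : 0 <= 1 + `|Y w| by rewrite addr_ge0.
    have n0 := le_trans y0 n2.
    by apply: lerXn2r => //; rewrite nnegrE.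
  apply: le_trans (nneseries_lim_ge n.+1 _) => //.
  by rewrite big_nat_recr//= leeDr// sume_ge0.
rewrite integral_nneseries//.
apply: (@le_lt_trans _ _ C'%:E); last exact: ltry.
apply: lime_le; first by apply: is_cvg_nneseries => n _ _; exact: integral_ge0.
apply: nearW => n.
apply: (@le_trans _ _ (\sum_(0 <= k < n) (C' / (k.+1%:R * k.+2%:R))%:E)%E).
  apply: lee_sum => k _; rewrite /f ge0_integralZl//; last first.
    by apply/measurable_EFinP; exact: measurable_indic.
  rewrite integral_indic// setIT.
  rewrite [X in (_ * X <= _)%E](probE P (mA k)).
  by rewrite -EFinM lee_fin.
rewrite sumEFin lee_fin -mulr_sumr sum_inv_telescope.
by rewrite -[X in _ <= X]mulr1 ler_wpM2l// gerBl invr_ge0.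
Qed.
End Moments.

(** * Expansion of the probability of one jump *)

Section Expansion.
Context {R : realType} d (T : measurableType d) (P : probability T R).

Lemma measurable_remainder n (H : R -> R) t : measurable_fun setT H ->
  measurable_fun setT (remainder n H t).
Proof.
move=> mH; apply: measurable_funB.
  apply: measurable_fun_ifT.
  - by apply: measurable_fun_ler => //; exact: normr_measurable.
  - by apply: measurableT_comp mH _; apply: measurable_funB.
  - exact: measurable_cst.
apply: measurable_sum => j; apply: measurable_funM => //.
by apply: measurable_funM => //; exact: measurable_funX.
Qed.

(** Dividing by [W t] makes the polynomial majorant independent of [t], so dominated convergence
    applies to [Phi]. *)
Lemma remainder_integral lambda m H h n (Y : T -> R) : (0 < m)%N -> 0 < lambda ->
  logtail lambda m H h -> (n <= m)%N -> measurable_fun setT H ->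
  measurable_fun setT Y ->
  (forall q : nat, P.-integrable setT (fun w => ((1 + `|Y w|) ^+ q)%:E)) ->
  forall e : R, 0 < e -> \forall t \near +oo,
    P.-integrable setT (fun w => (remainder n H t (Y w))%:E) /\
    (`|\int[P]_w (remainder n H t (Y w))%:E| <= (e * (loghaz lambda t ^+ n * H t))%:E)%E.
Proof.
move=> m0 l0 HH nm mH mY iY e e0.
have [K [p K0 HK]] := remainder_dominated m0 l0 HH nm.
have [H0 _ _ _] := HH.
pose W t := loghaz lambda t ^+ n * H t.
have W0 : \forall t \near +oo, 0 < W t.
  by apply: filterS2 H0 (loghaz_gt0 l0) => t ? ?; rewrite mulr_gt0// exprn_gt0.
have /near_ooP[T0 T01 HT0] : \forall t \near +oo, 0 < W t /\ forall s,
    `|remainder n H t s| <= K * (1 + `|s|) ^+ p * W t.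
  by apply: filterS2 W0 HK => t ? ?; split.
have mr t : measurable_fun setT (fun w => (remainder n H t (Y w))%:E).
  by apply/measurable_EFinP; apply: measurableT_comp mY; exact: measurable_remainder.
have ig : P.-integrable setT (fun w => (K * (1 + `|Y w|) ^+ p)%:E).
  by under eq_fun do rewrite EFinM; exact: integrableZl.
have ir t : T0 <= t -> P.-integrable setT (fun w => (remainder n H t (Y w))%:E).
  move=> /HT0[Wt Bt].
  apply: (@le_integrable _ _ _ _ _ _ _ (fun w => (W t)%:E * (K * (1 + `|Y w|) ^+ p)%:E)%E) => //.
    move=> w _; rewrite /= lee_fin (le_trans (Bt _))// mulrC.
    exact: ler_norm.
  exact: integrableZl.
pose Phi t : \bar R := (\int[P]_w (remainder n H t (Y w) / W t)%:E)%E.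
have PhiE t : T0 <= t -> (\int[P]_w (remainder n H t (Y w))%:E = (W t)%:E * Phi t)%E.
  move=> Tt; have [Wt _] := HT0 _ Tt.
  rewrite /Phi -integralZl//.
    by apply: eq_integral => w _; rewrite -EFinM mulrC divfK// gt_eqF.
  under eq_fun do rewrite mulrC EFinM.
  by apply: integrableZl => //; exact: ir.
have Phi0 : Phi t @[t --> +oo] --> 0%E.
  apply/cvge_pinftyP => u uoo.
  (* Convergence at infinity is tested along sequences [u]; the value 0 before [T0] makes the
     domination hold for every [k]. *)
  pose f k w : \bar R := (if T0 <= u k then remainder n H (u k) (Y w) / W (u k) else 0)%:E.
  have uT : \forall k \near \oo, T0 <= u k by move/cvgryPge: uoo; exact.
  have : (\int[P]_w f k w)%E @[k --> \oo] --> (\int[P]_w (cst 0%E w))%E.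
    apply: (@dominated_cvg _ _ _ _ _ _ f (cst 0%E) (fun w => (K * (1 + `|Y w|) ^+ p)%:E)) => //.
    - move=> k; rewrite /f; apply/measurable_EFinP.
      case: (T0 <= u k); last exact: measurable_cst.
      apply: measurable_funM => //; apply: measurableT_comp mY.
      exact: measurable_remainder.
    - move=> w _; apply: cvg_EFin; first by apply: nearW.
      apply/cvgr0Pnorm_le => e1 e10.
      have := uoo _ (remainder_cvg0 (Y w) m0 l0 HH nm e10).
      apply: filterS2 uT => k Tu; rewrite /= Tu => Hk.
      have [Wt _] := HT0 _ Tu.
      by rewrite normrM normfV (gtr0_norm Wt) ler_pdivrMr.
    - move=> k w _; rewrite /f; case: ifPn => [Tu|_]; last first.
        by rewrite abse0 lee_fin mulr_ge0 ?exprn_ge0 ?addr_ge0// ltW.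
      have [Wt Bt] := HT0 _ Tu.
      by rewrite lee_fin normrM normfV (gtr0_norm Wt) ler_pdivrMr.
  rewrite integral0 => F0.
  apply: cvg_trans F0; apply: near_eq_cvg.
  by apply: filterS uT => k Tu; rewrite /f Tu.
have [_ /cvgr0Pnorm_le/(_ _ e0) Phie] := (fine_cvgP _ _).1 Phi0.
apply: filterS2 (near_pinfty_ge T0) Phie => t Tt Pt; split; first exact: ir.
have [Wt _] := HT0 _ Tt.
have fP : Phi t \is a fin_num.
  apply: integrable_fin_num => //.
  under eq_fun do rewrite mulrC EFinM.
  by apply: integrableZl => //; exact: ir.
rewrite PhiE// -(fineK fP) -EFinM abse_EFin lee_fin normrM (gtr0_norm Wt) mulrC.
by rewrite ler_wpM2r// ltW.
Qed.

Lemma measurable_pair (Y S : T -> R) : measurable_fun setT Y -> measurable_fun setT S ->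
  measurable_fun setT (fun w => (Y w, S w)).
Proof. by move=> mY mS; exact/measurable_fun_prod. Qed.

(* The law of [(Y, S)] is the product measure, by uniqueness on rectangles. *)
Lemma indep_section_prob (Y S : {RV P >-> R}) (A : set (R * R)) : measurable A ->
  (forall B C : set R, measurable B -> measurable C ->
    P (Y @^-1` B `&` S @^-1` C) = (P (Y @^-1` B) * P (S @^-1` C))%E) ->
  P [set w | A (Y w, S w)] = (\int[P]_w P [set v | A (Y v, S w)])%E.
Proof.
move=> mA YS.
have mYS : measurable_fun setT (fun w => (Y w, S w)).
  by apply: measurable_pair; exact: measurable_funP.
pose g : {mfun T >-> (R * R)%type} :=
  HB.pack (fun w => (Y w, S w)) (isMeasurableFun.Build _ _ _ _ _ mYS).
pose m1 := distribution P Y; pose m2 := distribution P S.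
have E1 : (m1 \x m2)%E A = distribution P g A.
  by apply: product_measure_unique => //.
have E2 : (m1 \x m2)%E A = (m1 \x^ m2)%E A.
  by apply: product_measure_unique => // B C mB mC; exact: product_measure2E.
rewrite [LHS](_ : _ = distribution P g A)// -E1 E2 /product_measure2.
rewrite ge0_integral_distribution//; last exact: measurable_fun_ysection.
apply: eq_integral => w _ /=; rewrite /m1 /distribution /pushforward /=; congr (P _).
by apply/seteqP; split=> v; rewrite /ysection /= inE.
Qed.

Lemma jump_expansion lambda m n c (Y S : {RV P >-> R}) h : (0 < m)%N -> 0 < lambda ->
  logtail lambda m (tailM P Y c) h -> (n <= m)%N ->
  (forall B C : set R, measurable B -> measurable C ->
    P (Y @^-1` B `&` S @^-1` C) = (P (Y @^-1` B) * P (S @^-1` C))%E) ->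
  (forall q : nat, P.-integrable setT (fun w => ((1 + `|S w|) ^+ q)%:E)) ->
  forall e : R, 0 < e -> \forall t \near +oo,
  `|prob P [set w | t < c * Y w + S w /\ `|S w| <= t / 2] -
    \sum_(j < n.+1) (-1) ^+ j / j`!%:R * rv_moment P S j * derive1n j (tailM P Y c) t|
    <= e * (loghaz lambda t ^+ n * tailM P Y c t).
Proof.
move=> m0 l0 HH nm YS iS e e0; set H := tailM P Y c.
have mgt x : measurable [set v | x < c * Y v].
  rewrite (_ : [set v | _] = Y @^-1` ((fun y => c * y) @^-1` `]x, +oo[)); last first.
    by apply/seteqP; split=> v /=; rewrite in_itv /= andbT.
  rewrite -[X in measurable X]setTI; apply: measurable_funP => //.
  rewrite -[X in measurable X]setTI.
  have mc : measurable_fun setT (fun y : R => c * y) by exact: measurable_funM.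
  by apply: mc => //; exact: measurable_itv.
have mH : measurable_fun setT H.
  apply: nonincreasing_measurable => // x y xy; apply: le_prob => // v /=.
  exact: le_lt_trans.
have mS : measurable_fun setT S by exact: measurable_funP.
apply: filterS (remainder_integral m0 l0 HH nm mH mS iS e0) => t [ir Ht].
have iSj j : P.-integrable setT (fun w => ((S w) ^+ j)%:E).
  apply: le_integrable (iS j) => //.
    by apply/measurable_EFinP; exact: measurable_funX.
  move=> w _; rewrite /= lee_fin normrX (le_trans _ (ler_norm _))//.
  by rewrite lerXn2r ?nnegrE ?addr_ge0// lerDr.
pose b w := \sum_(j < n.+1) (-1) ^+ j / j`!%:R * S w ^+ j * derive1n j H t.
have ibj (j : 'I_n.+1) : P.-integrable setT
    (fun w => ((-1) ^+ j / j`!%:R * S w ^+ j * derive1n j H t)%:E).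
  under eq_fun do rewrite mulrAC EFinM.
  exact: integrableZl.
have ib : P.-integrable setT (EFin \o b).
  rewrite (_ : EFin \o b = fun w => (\sum_(j < n.+1)
     ((-1) ^+ j / j`!%:R * S w ^+ j * derive1n j H t)%:E)%E); last first.
    by apply/funext => w; rewrite /b /= sumEFin.
  by apply: integrable_sum => // j _; exact: ibj.
have Eb : (\int[P]_w (b w)%:E = (\sum_(j < n.+1) (-1) ^+ j / j`!%:R *
    rv_moment P S j * derive1n j H t)%:E)%E.
  under eq_integral do rewrite /b -sumEFin.
  rewrite integral_sum// -sumEFin; apply: eq_bigr => j _.
  under eq_integral do rewrite mulrAC EFinM.
  rewrite integralZl// [in RHS]mulrAC [in RHS]EFinM /rv_moment fineK//.
  exact: integrable_fin_num.
pose E := [set w | t < c * Y w + S w /\ `|S w| <= t / 2].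
pose A := [set z : R * R | t < c * z.1 + z.2 /\ `|z.2| <= t / 2].
have mA : measurable A.
  have m1 : measurable_fun setT (fun z : R * R => c * z.1 + z.2).
    by apply: measurable_funD => //; apply: measurable_funM.
  have m2 : measurable_fun setT (fun z : R * R => `|z.2|).
    by apply: measurableT_comp.
  rewrite (_ : A = ((fun z : R * R => c * z.1 + z.2) @^-1` `]t, +oo[) `&`
     ((fun z : R * R => `|z.2|) @^-1` `]-oo, t / 2])); last first.
    by apply/seteqP; split=> z /=; rewrite !in_itv /= andbT.
  apply: measurableI; rewrite -[X in measurable X]setTI.
    by apply: m1 => //; exact: measurable_itv.
  by apply: m2 => //; exact: measurable_itv.
pose a w := if `|S w| <= t / 2 then H (t - S w) else 0.
have mE : measurable E.
  rewrite (_ : E = (fun w => (Y w, S w)) @^-1` A)//.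
  rewrite -[X in measurable X]setTI.
  by apply: (measurable_pair (Y := Y) (S := S)) => //; exact: measurable_funP.
have PE : P E = (\int[P]_w (a w)%:E)%E.
  rewrite (indep_section_prob mA YS); apply: eq_integral => w _.
  rewrite /a; case: ifPn => Sw.
    rewrite /H /tailM -probE//; congr (P _).
    by apply/seteqP; split=> v /=; rewrite ltrBlDr; [move=> []|move=> ?; split].
  rewrite (_ : [set v | _] = set0) ?measure0//.
  by apply/seteqP; split=> v //= -[_]; rewrite (negbTE Sw).
have ia : P.-integrable setT (EFin \o a).
  rewrite (_ : EFin \o a = (fun w => (remainder n H t (S w))%:E + (b w)%:E)%E).
    exact: integrableD.
  by apply/funext => w; rewrite /= -EFinD /remainder -/(b w) subrK.
rewrite -lee_fin; apply: le_trans Ht.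
rewrite (_ : (\int[P]_w (remainder n H t (S w))%:E)%E =
   (\int[P]_w ((a w)%:E - (b w)%:E))%E); last first.
  by apply: eq_integral => w _.
rewrite integralB_EFin// Eb -PE probE// -EFinB abse_EFin lexx.
Qed.
End Expansion.

Lemma near_ex {R : realType} (Q : R -> Prop) : (\forall t \near +oo, Q t) -> exists t, Q t.
Proof. by move=> /near_ooP[T _ HT]; exists T; exact: HT. Qed.

Lemma near_ex3 {R : realType} (Q1 Q2 Q3 : R -> Prop) : (\forall t \near +oo, Q1 t) ->
  (\forall t \near +oo, Q2 t) -> (\forall t \near +oo, Q3 t) ->
  exists t, [/\ Q1 t, Q2 t & Q3 t].
Proof. by move=> H1 H2 H3; apply: near_ex; apply: filterS3 H1 H2 H3. Qed.

(** * Calculus of little-o *)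

Section Littleo.
Context {R : realType}.
Implicit Types f g : R -> R.

Lemma littleo_add f1 f2 g : littleo_infty f1 g -> littleo_infty f2 g ->
  littleo_infty (fun t => f1 t + f2 t) g.
Proof.
move=> o1 o2 e e0; have e2 : 0 < e / 2 by rewrite divr_gt0.
apply: filterS2 (o1 _ e2) (o2 _ e2) => t H1 H2.
by rewrite (le_trans (ler_normD _ _))// (splitr e) mulrDl lerD.
Qed.

Lemma littleo_sum (I : eqType) (s : seq I) (f : I -> R -> R) g :
  (forall i, i \in s -> littleo_infty (f i) g) ->
  littleo_infty (fun t => \sum_(i <- s) f i t) g.
Proof.
elim: s => [|i s IH] H.
  by move=> e e0; apply: nearW => t; rewrite big_nil normr0 mulr_ge0 ?(ltW e0).
under eq_fun do rewrite big_cons.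
apply: littleo_add; first by apply: H; rewrite inE eqxx.
by apply: IH => j js; apply: H; rewrite inE js orbT.
Qed.

Lemma littleo_le f1 f2 g C : 0 < C -> (\forall t \near +oo, `|f1 t| <= C * `|f2 t|) ->
  littleo_infty f2 g -> littleo_infty f1 g.
Proof.
move=> C0 H o2 e e0; have eC : 0 < e / C by rewrite divr_gt0.
apply: filterS2 H (o2 _ eC) => t H1 H2; apply: (le_trans H1).
by rewrite mulrC -ler_pdivlMr// -mulrA [_ * C^-1]mulrC mulrA.
Qed.

Lemma littleo_ler f g1 g2 C : 0 < C -> (\forall t \near +oo, `|g1 t| <= C * `|g2 t|) ->
  littleo_infty f g1 -> littleo_infty f g2.
Proof.
move=> C0 H o1 e e0; have eC : 0 < e / C by rewrite divr_gt0.
apply: filterS2 H (o1 _ eC) => t H1 H2; apply: (le_trans H2).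
by rewrite -mulrA ler_wpM2l ?(ltW e0)// mulrC ler_pdivrMr// mulrC.
Qed.

Lemma littleo_near f1 f2 g : (\forall t \near +oo, f1 t = f2 t) ->
  littleo_infty f1 g -> littleo_infty f2 g.
Proof. by move=> E o1 e e0; apply: filterS2 E (o1 _ e0) => t <-. Qed.

Lemma near_powR_le (C s e : R) : 0 < C -> 0 < s -> 0 < e ->
  \forall t \near +oo, C * t `^ (- s) <= e.
Proof.
move=> C0 s0 e0; apply: filterS2 (near_pinfty_ge 1) (near_ln_ge (ln (C / e) / s)) => t t1.
rewrite ler_pdivrMr// => H.
have t0 : 0 < t by lra.
rewrite mulrC -ler_pdivlMr// powRN.
rewrite -[X in _ <= X]invrK lef_pV2 ?posrE ?powR_gt0 ?invr_gt0 ?divr_gt0//.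
rewrite invf_div -[X in X <= _]lnK ?posrE ?divr_gt0// /powR gt_eqF// ler_expR.
by rewrite [s * _]mulrC.
Qed.
End Littleo.

(** * Summable families of weights *)

Section Summability.
Context {R : realType}.

Lemma esum_seq_bound (x : int -> R) : (forall i, 0 <= x i) ->
  (\esum_(i in [set: int]) (x i)%:E < +oo)%E ->
  exists2 A : R, 0 < A & forall s : seq int, uniq s -> \sum_(i <- s) x i <= A.
Proof.
move=> x0 xoo.
have e0 : (0 <= \esum_(i in [set: int]) (x i)%:E)%E.
  by apply: esum_ge0 => i _; rewrite lee_fin.
have fin : (\esum_(i in [set: int]) (x i)%:E)%E \is a fin_num by rewrite ge0_fin_numE.
exists (fine (\esum_(i in [set: int]) (x i)%:E)%E + 1).
  by rewrite ltr_wpDl// fine_ge0.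
move=> s us; apply: (@le_trans _ _ (fine (\esum_(i in [set: int]) (x i)%:E)%E)).
  rewrite -lee_fin fineK// -sumEFin; apply: esum_ge.
  by exists [set` s]; [split => //; exact: finite_seq|rewrite -fsbig_seq].
by rewrite lerDl.
Qed.

(** Take a finite list whose sum is within [e] of the supremum: whatever lies outside it adds at
    most [e]. *)
Lemma seq_bound_tail (x : int -> R) (A e : R) : (forall i, 0 <= x i) ->
  (forall s : seq int, uniq s -> \sum_(i <- s) x i <= A) -> 0 < e ->
  exists N : nat, forall s : seq int, uniq s ->
    \sum_(i <- s) (if (N < `|i|)%N then x i else 0) <= e.
Proof.
move=> x0 xA e0.
pose B := [set \sum_(i <- s) x i | s in [set s : seq int | uniq s]].
have hB : has_sup B.
  by split; [exists 0, [::] => //; rewrite big_nil|exists A => _ [s us <-]; exact: xA].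
have [_ [s0 us0 <-] Hs0] := sup_adherent e0 hB.
exists (\max_(i <- s0) `|i|)%N => s us.
rewrite -big_mkcond -big_filter.
set s' := [seq i <- s | _].
have : \sum_(i <- s0 ++ s') x i <= sup B.
  apply: ub_le_sup; first by case: hB.
  exists (s0 ++ s') => //; rewrite /= cat_uniq us0 filter_uniq// andbT/=.
  apply/hasPn => i; rewrite mem_filter => /andP[Hi _]; apply/negP => is0.
  by move: Hi; rewrite ltnNge => /negP; apply; exact: (@leq_bigmax_seq _ _ _ (fun i : int => `|i|%N)).
by rewrite big_cat /=; lra.
Qed.
End Summability.

(** * Weighted tails and the order on the weights *)

Section WeightedTails.
Context {R : realType} d (T : measurableType d) (P : probability T R).

Lemma logtail_of_hazard (K h : R -> R) lambda m alpha : (0 < m)%N -> 0 < lambda ->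
  hazard_rate K h -> hazard_log_asymp lambda h -> smoothly_varying alpha m h ->
  logtail lambda m (fun t => 1 - K t) h.
Proof.
move=> m0 l0 [t0 hK] hh sh; split=> //.
- by apply: filterS (near_pinfty_ge t0) => t /hK[].
- apply: filterS (near_pinfty_ge t0) => t /hK[dK K0 hE].
  have d1 : is_derive t 1 K (derive1 K t) by rewrite derive1E; apply: DeriveDef.
  have := @is_deriveB _ _ _ (fun=> 1 : R) K t 1 0 _ (is_derive_cst _ _ _) d1.
  move=> X; apply: is_derive_eq; rewrite sub0r hE mulNr divfK// gt_eqF//.
- apply: (smoothly_varying_symbol m0 sh).
  exists (lambda + 1); first by rewrite addr_gt0.
  have l1 : lambda < lambda + 1 by rewrite ltrDl.
  apply: filterS2 (hazard_ge l0 l0 hh) (hazard_le l0 l1 hh) => t.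
  by rewrite mul0r !expr1 => h0 h1; rewrite ger0_norm.
Qed.

Variable Y : {RV P >-> R}.

Let Hp : R -> R := tailM P Y 1.
Let Hn : R -> R := tailM P Y (-1).

Lemma measurable_tail (c t : R) : measurable [set w | t < c * Y w].
Proof.
rewrite (_ : [set v | _] = Y @^-1` ((fun y => c * y) @^-1` `]t, +oo[)); last first.
  by apply/seteqP; split=> v /=; rewrite in_itv /= andbT.
rewrite -[X in measurable X]setTI; apply: measurable_funP => //.
rewrite -[X in measurable X]setTI.
have mc : measurable_fun setT (fun y : R => c * y) by exact: measurable_funM.
by apply: mc => //; exact: measurable_itv.
Qed.

Lemma tailM_ge0 c t : 0 <= tailM P Y c t. Proof. exact: prob_ge0. Qed.

Lemma tailM_pos c : 0 < c -> tailM P Y c = fun t => Hp (t * c^-1).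
Proof.
move=> c0; apply/funext => t; congr (prob P _).
by apply/seteqP; split=> w /=; rewrite mul1r ltr_pdivrMr// mulrC.
Qed.

Lemma tailM_neg c : c < 0 -> tailM P Y c = fun t => Hn (t * (- c)^-1).
Proof.
move=> c0; apply/funext => t; congr (prob P _).
by apply/seteqP; split=> w /=; rewrite mulN1r ltr_pdivrMr ?oppr_gt0// mulrNN mulrC.
Qed.

Lemma tailM_dfun t : Hp t = 1 - dfun P Y t.
Proof.
rewrite /Hp /tailM /dfun -probC.
  by congr (prob P _); apply/seteqP; split=> w /=; rewrite mul1r ltNge => /negP.
rewrite (_ : [set w | _] = Y @^-1` `]-oo, t]); last first.
  by apply/seteqP; split=> w /=; rewrite in_itv.
by rewrite -[X in measurable X]setTI; exact: measurable_funP.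
Qed.

Lemma tailM_dfunN t : Hn t = 1 - dfun P (fun w => - Y w) t.
Proof.
rewrite /Hn /tailM /dfun -probC.
  by congr (prob P _); apply/seteqP; split=> w /=; rewrite mulN1r ltNge => /negP.
rewrite (_ : [set w | _] = Y @^-1` `[- t, +oo[); last first.
  by apply/seteqP; split=> w /=; rewrite in_itv /= andbT lerNl.
by rewrite -[X in measurable X]setTI; exact: measurable_funP.
Qed.

Variables (lambda : R) (m : nat) (h : R -> R).
Hypotheses (m_gt0 : (0 < m)%N) (lambda_gt0 : 0 < lambda).
Hypothesis HHp : logtail lambda m Hp h.

(** The limit of the ratio of the two tails is weakened to two-sided bounds, and the left tail keeps
    its own [lambda'] and [h']. *)
Definition balanced : Prop :=
  (exists2 C : R, 0 < C & \forall v \near +oo, Hp v <= C * Hn v /\ Hn v <= C * Hp v) /\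
  (exists lambda' : R, exists2 h' : R -> R, 0 < lambda' & logtail lambda' m Hn h').

Hypothesis left_tail : (\forall v \near +oo, Hn v = 0) \/ balanced.

(** The weights whose tail is eventually positive; under [left_tail], all others, 0 included, have
    an eventually null tail. *)
Definition active (a : R) : Prop := 0 < a \/ (balanced /\ a < 0).

Lemma active_neq0 a : active a -> a != 0.
Proof. by case=> [/gt_eqF->|[_ /lt_eqF->]]. Qed.

Lemma active_logtail a : active a ->
  exists l', exists2 h', 0 < l' & logtail l' m (tailM P Y a) h'.
Proof.
case=> [a0|[[_ [l' [h' l0 H']]] a0]].
  exists lambda, (fun t => a^-1 * h (t * a^-1)) => //.
  by rewrite tailM_pos//; apply: logtail_scale => //; rewrite invr_gt0.
exists l', (fun t => (- a)^-1 * h' (t * (- a)^-1)) => //.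
by rewrite tailM_neg//; apply: logtail_scale => //; rewrite invr_gt0 oppr_gt0.
Qed.

(** Balance removes the sign of [a]: up to constants, tails of active weights are values of the
    single function [Hp] at different scales. *)
Lemma active_compare a : active a ->
  exists2 C : R, 0 < C & \forall t \near +oo,
    tailM P Y a t <= C * Hp (`|a|^-1 * t) /\ Hp (`|a|^-1 * t) <= C * tailM P Y a t.
Proof.
case=> [a0|[[[C C0 HC] _] a0]].
  exists 1 => //; apply: nearW => t.
  by rewrite tailM_pos// gtr0_norm// !mul1r mulrC.
have na0 : 0 < `|a|^-1 by rewrite invr_gt0 normr_gt0 lt_eqF.
exists C => //; apply: filterS (near_oo_scale na0 HC) => t [H1 H2].
by rewrite tailM_neg// -ltr0_norm// [t * _]mulrC.
Qed.

Lemma inactive_tail a : ~ active a -> \forall t \near +oo, tailM P Y a t = 0.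
Proof.
move=> na; have [a0|a0|a0] := ltgtP a 0; last first.
- apply: filterS (near_pinfty_ge 0) => t t0; rewrite /tailM a0.
  rewrite (_ : [set w | _] = set0) /prob ?measure0//.
  by apply/seteqP; split=> w //=; rewrite mul0r ltNge t0.
- by exfalso; apply: na; left.
- case: left_tail => [H0|B]; last by exfalso; apply: na; right.
  have na0 : 0 < (- a)^-1 by rewrite invr_gt0 oppr_gt0.
  by apply: filterS (near_oo_scale na0 H0) => t <-; rewrite tailM_neg// mulrC.
Qed.

Lemma active_gt0 a : active a -> \forall t \near +oo, 0 < tailM P Y a t.
Proof. by move=> /active_logtail[l' [h' _ []]]. Qed.

Lemma active_ratio_lt a b mu : active a -> active b -> `|a| < `|b| -> mu < lambda ->
  exists2 C : R, 0 < C & \forall t \near +oo,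
    tailM P Y a t <= C * t `^ (- (mu * ln (`|b| / `|a|))) * tailM P Y b t.
Proof.
move=> aa ab lab ml.
have a0 : 0 < `|a| by rewrite normr_gt0 active_neq0.
have b0 : 0 < `|b| by rewrite normr_gt0 active_neq0.
have [Ca Ca0 HCa] := active_compare aa; have [Cb Cb0 HCb] := active_compare ab.
have [] := @tail_scale_le _ lambda m Hp h mu `|b|^-1 `|a|^-1 lambda_gt0 ml _ _ HHp.
- by rewrite invr_gt0.
- by rewrite lef_pV2 ?posrE// ltW.
rewrite invrK [_^-1 * _]mulrC => C C0 HC.
exists (Ca * C * Cb); first by rewrite !mulr_gt0.
apply: filterS3 HCa HCb HC => t [A1 _] [_ B2] K.
apply: (le_trans A1); rewrite -!mulrA ler_wpM2l ?(ltW Ca0)//.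
apply: (le_trans K); rewrite -mulrA ler_wpM2l ?(ltW C0)//.
by rewrite mulrCA ler_wpM2l ?powR_ge0.
Qed.

Lemma active_ratio_eq a b : active a -> active b -> `|a| = `|b| ->
  exists2 C : R, 0 < C & \forall t \near +oo, tailM P Y a t <= C * tailM P Y b t.
Proof.
move=> aa ab lab.
have [Ca Ca0 HCa] := active_compare aa; have [Cb Cb0 HCb] := active_compare ab.
exists (Ca * Cb); first by rewrite mulr_gt0.
apply: filterS2 HCa HCb => t [A1 _] [_]; rewrite -lab => B2.
by apply: (le_trans A1); rewrite -mulrA ler_wpM2l ?(ltW Ca0).
Qed.

Lemma active_wprec a b : active a -> active b -> `|a| < `|b| -> wprec P Y a b.
Proof.
move=> aa ab lab e e0.
have l2 : lambda / 2 < lambda by rewrite ltr_pdivrMr// ltr_pMr// ltr1n.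
have [C C0 HC] := active_ratio_lt aa ab lab l2.
have a0 : 0 < `|a| by rewrite normr_gt0 active_neq0.
have s0 : 0 < lambda / 2 * ln (`|b| / `|a|).
  by rewrite mulr_gt0 ?divr_gt0// ln_gt0// ltr_pdivlMr// mul1r.
apply: filterS2 HC (near_powR_le C0 s0 e0) => t H1 H2.
rewrite !ger0_norm ?tailM_ge0// (le_trans H1)// ler_wpM2r//; exact: tailM_ge0.
Qed.

(** An eventually null tail is a little-o of itself, so maximality with [j = i1] already forces
    [c i1] to be active. *)
Lemma maximal_active (c : int -> R) i1 : (forall j, ~ wprec P Y (c i1) (c j)) ->
  active (c i1) /\ forall j, active (c j) -> `|c j| <= `|c i1|.
Proof.
move=> cmax; have a1 : active (c i1).
  apply: contrapT => na; apply: (cmax i1) => e e0.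
  by apply: filterS (inactive_tail na) => t ->; rewrite normr0 mulr0.
split=> // j aj; rewrite leNgt; apply/negP => lt; apply: (cmax j).
exact: active_wprec.
Qed.

(** Equal moduli give equivalent tails and distinct moduli a strict order, which positivity of the
    tails makes irreversible. *)
Lemma wsucceqP a b : active b -> wsucceq P Y a b <-> active a /\ `|b| <= `|a|.
Proof.
move=> ab; split.
  have [aa|na] := pselect (active a); last first.
    have H := inactive_tail na; have H' := active_gt0 ab.
    case=> [/(_ 1 ltr01) W|[e e0 W]]; exfalso.
      have [t [-> Tb]] := near_ex3 H H' W.
      by rewrite normr0 mulr0 gtr0_norm// leNgt Tb.
    have [t [-> Tb []]] := near_ex3 H H' W.
    by rewrite leNgt mulr_gt0.
  move=> H; split=> //; rewrite leNgt; apply/negP => lab.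
  have ab' := active_wprec aa ab lab; have Ta := active_gt0 aa; have Tb := active_gt0 ab.
  case: H => [ba|[e e0 W]].
    have h0 : 0 < 1 / 2 :> R by rewrite divr_gt0.
    have [t [x y z]] := near_ex3 (ba _ h0) (ab' _ h0) Tb.
    by move: x y; rewrite !ger0_norm ?tailM_ge0//; lra.
  have e2 : 0 < e / 2 by rewrite divr_gt0.
  have [t [[x _] y z]] := near_ex3 W (ab' _ e2) Tb.
  move: x y; rewrite !ger0_norm ?tailM_ge0// => x y.
  by have := le_trans x y; rewrite ler_pM2r// leNgt ltr_pdivrMr// ltr_pMr// ltr1n.
move=> [aa]; rewrite le_eqVlt => /orP[/eqP lab|lab]; last by left; exact: active_wprec.
right; have [C C0 HC] := active_ratio_eq ab aa lab.
have [D D0 HD] := active_ratio_eq aa ab (esym lab).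
have CD0 : 0 < C + D by rewrite addr_gt0.
exists (C + D)^-1; first by rewrite invr_gt0.
apply: filterS2 HC HD => t H1 H2; rewrite invrK; split.
  rewrite mulrC ler_pdivrMr// (le_trans H1)// mulrC ler_wpM2l ?tailM_ge0//.
  by rewrite lerDl ltW.
rewrite (le_trans H2)// ler_wpM2r ?tailM_ge0//.
by rewrite lerDr ltW.
Qed.

Let Q v := prob P [set w | v < `|Y w|].

Lemma abs_tail_split v : 0 <= v -> Q v = Hp v + Hn v.
Proof.
move=> v0; apply: EFin_inj; rewrite EFinD /Q /Hp /Hn /tailM.
rewrite -!probE; [|exact: measurable_tail|exact: measurable_tail|exact: measurable_abs_gt].
rewrite -measureU; [|exact: measurable_tail|exact: measurable_tail|].
  congr (P _); apply/seteqP; split=> w /=; rewrite mul1r mulN1r lter_normr.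
    by move/orP.
  by move=> H; apply/orP.
apply/seteqP; split=> w //= []; rewrite mul1r mulN1r.
by lra.
Qed.

(** Supplies [series_tail] with its decay hypothesis, for [p = delta / (1 - delta)]. *)
Lemma abs_tail_decay p : 0 <= p -> \forall v \near +oo, forall theta : R,
  0 < theta -> theta <= 1 -> Q (v / theta) <= theta `^ p * Q v.
Proof.
move=> p0.
have gen l' (H : R -> R) h' : 0 < l' -> logtail l' m H h' ->
   \forall v \near +oo, forall theta : R, 0 < theta -> theta <= 1 ->
      H (v / theta) <= theta `^ p * H v.
  move=> l0 HH; apply: filterS2 (tail_decay l0 p0 HH) (near_pinfty_ge 1) => v Hv v1 th th0 th1.
  have v0 : 0 < v by lra.
  have := Hv (v / th); rewrite ler_pdivlMr// ler_piMr ?(ltW v0)// => /(_ isT).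
  by rewrite invf_div mulrCA mulfV ?mulr1 ?gt_eqF// [H v * _]mulrC.
have gn : \forall v \near +oo, forall theta : R, 0 < theta -> theta <= 1 ->
      Hn (v / theta) <= theta `^ p * Hn v.
  case: left_tail => [H0|[_ [l' [h' l0 H']]]]; last exact: gen H'.
  have a1 : 0 < 1 :> R by [].
  apply: filterS2 (near_oo_ge a1 H0) (near_pinfty_ge 1) => v Hv v1 th th0 th1.
  have v0 : 0 < v by lra.
  rewrite !Hv ?mulr0// mul1r// ler_pdivlMr// ler_piMr// ltW//.
apply: filterS3 (gen _ _ _ lambda_gt0 HHp) gn (near_pinfty_ge 0) => v H1 H2 v0 th th0 th1.
rewrite !abs_tail_split// ?divr_ge0 ?(ltW th0)// mulrDr.
by apply: lerD; [exact: H1|exact: H2].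
Qed.

Lemma abs_tail_le : exists2 C : R, 0 < C & \forall v \near +oo, Q v <= C * Hp v.
Proof.
case: left_tail => [H0|[[C C0 HC] _]].
  exists 1 => //; apply: filterS2 H0 (near_pinfty_ge 0) => v H v0.
  by rewrite abs_tail_split// H addr0 mul1r.
exists (1 + C); first by rewrite addr_gt0.
apply: filterS2 HC (near_pinfty_ge 0) => v [_ H] v0.
by rewrite abs_tail_split// mulrDl mul1r lerD2l.
Qed.

Lemma abs_tail_superpoly q : exists2 C : R, 0 < C & \forall v \near +oo, Q v <= C / v ^+ q.
Proof.
have [C C0 HC] := abs_tail_le; have [D D0 HD] := tail_superpoly q lambda_gt0 HHp.
exists (C * D); first by rewrite mulr_gt0.
apply: filterS2 HC HD => v H1 H2; rewrite (le_trans H1)// -mulrA.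
by rewrite ler_wpM2l// ltW.
Qed.

Let W k b t := loghaz lambda t ^+ k * tailM P Y b t.

(** As [1/t <= loghaz], one extra power of [1/t] beyond [k] is enough. *)
Lemma littleo_poly k b f C : 0 < C -> active b ->
  (\forall t \near +oo, `|f t| <= C / t ^+ k.+1 * tailM P Y b t) ->
  littleo_infty f (W k b).
Proof.
move=> C0 ab Hf e e0.
apply: filterS3 (filterI (near_pinfty_ge 1) (near_pinfty_ge (C / e)))
  (loghaz_ge_inv lambda_gt0) Hf => t [t1 tC] L H.
have t0 : 0 < t by lra.
have i0 : 0 <= t^-1 by rewrite invr_ge0 ltW.
have L0 := le_trans i0 L.
apply: (le_trans H); rewrite /W ger0_norm; last first.
  by rewrite mulr_ge0 ?tailM_ge0 ?exprn_ge0.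
rewrite mulrA ler_wpM2r ?tailM_ge0//.
apply: (@le_trans _ _ (e * t^-1 ^+ k)).
  rewrite exprS invfM mulrA exprVn ler_wpM2r ?invr_ge0 ?exprn_ge0 ?(ltW t0)//.
  by rewrite ler_pdivrMr// mulrC -ler_pdivrMr.
by rewrite ler_wpM2l ?(ltW e0)// lerXn2r ?nnegrE.
Qed.

Lemma abs_tail_far k b : active b -> exists2 K : R, 0 < K &
  littleo_infty (fun t => Q (K * t)) (W k b).
Proof.
move=> ab; have b0 : 0 < `|b| by rewrite normr_gt0 active_neq0.
have [C C0 HC] := abs_tail_le; have [D D0 HD] := active_compare ab.
have l2 : lambda / 2 < lambda by rewrite ltr_pdivrMr// ltr_pMr// ltr1n.
(* Chosen so that [lambda / 2 * ln (K * |b|) = k + 1]: moving the tail from scale [1 / |b|] to scale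
   [K] gains [t^-(k+1)]. *)
pose x := expR (2 * k.+1%:R / lambda); pose K := x / `|b|.
have x1 : 1 <= x by rewrite -[1](@expR0 R) ler_expR divr_ge0 ?mulr_ge0// ltW.
have K0 : 0 < K by rewrite divr_gt0// expR_gt0.
have bi : 0 < `|b|^-1 by rewrite invr_gt0.
have bK : `|b|^-1 <= K by rewrite /K ler_peMl// ltW.
have [E E0 HE] := tail_scale_le lambda_gt0 l2 bi bK HHp.
exists K => //; apply: (@littleo_poly _ _ _ (C * E * D)) => //; first by rewrite !mulr_gt0.
apply: filterS3 (filterI (near_oo_scale K0 HC) HE) HD (near_pinfty_ge 1) => t [H1 H2] [_ H3] t1.
have kE : lambda / 2 * ln (K / `|b|^-1) = k.+1%:R.
  rewrite /K invrK divfK ?gt_eqF// /x expRK; field.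
  by rewrite gt_eqF.
rewrite ger0_norm ?prob_ge0// (le_trans H1)//.
apply: (@le_trans _ _ (C * (E * t `^ (- k.+1%:R) * (D * tailM P Y b t)))).
  rewrite ler_wpM2l ?(ltW C0)// -kE (le_trans H2)// ler_wpM2l//.
  by rewrite mulr_ge0 ?powR_ge0 ?(ltW E0).
rewrite powRN powR_mulrn; last lra.
by rewrite le_eqVlt; apply/orP; left; apply/eqP; ring.
Qed.

(** Replacing the first factor by the tail of [b] costs some power [t^p]; the second factor is
    smaller than [t^-(p+k+1)]. *)
Lemma abs_tail_pair k b (x y : R) : active b -> 0 < x -> 0 < y ->
  littleo_infty (fun t => Q (x * t) * Q (y * t)) (W k b).
Proof.
move=> ab x0 y0; have b0 : 0 < `|b|^-1 by rewrite invr_gt0 normr_gt0 active_neq0.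
have [C C0 HC] := abs_tail_le; have [D D0 HD] := active_compare ab.
have [p _ [E E0 HE]] := tail_scale_ge lambda_gt0 x0 b0 HHp.
have [G G0 HG] := abs_tail_superpoly (p + k.+1).
apply: (@littleo_poly _ _ _ (C * E * D * (G / y ^+ (p + k.+1)))) => //.
  by rewrite !mulr_gt0 ?invr_gt0 ?exprn_gt0.
apply: filterS3 (filterI (near_oo_scale x0 HC) HE) HD
  (filterI (near_oo_scale y0 HG) (near_pinfty_ge 1)) => t [H1 H2] [_ H3] [H4 t1].
have t0 : 0 < t by lra.
rewrite ger0_norm ?mulr_ge0 ?prob_ge0//.
apply: (@le_trans _ _ ((C * E * D * t ^+ p * tailM P Y b t) * (G / (y * t) ^+ (p + k.+1)))).
  apply: ler_pM; rewrite ?prob_ge0//.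
  apply: (le_trans H1); rewrite -!mulrA ler_wpM2l ?(ltW C0)//.
  apply: (le_trans H2); rewrite -!mulrA ler_wpM2l ?(ltW E0)//.
  by rewrite mulrCA ler_wpM2l ?exprn_ge0 ?(ltW t0).
rewrite exprMn [t ^+ (p + k.+1)]exprD !invfM.
have tp : t ^+ p != 0 by rewrite expf_neq0// gt_eqF.
rewrite le_eqVlt; apply/orP; left; apply/eqP.
have gen (u v w z r : R) : u != 0 -> (C * E * D * u * z) * (G * (v * (u^-1 * w))) =
   C * E * D * (G * v) * w * z by move=> u0; field.
exact: gen.
Qed.

Lemma active_order_littleo k q a b : active a -> active b -> `|a| < `|b| ->
  (q <= k)%N -> (k - q)%:R < lambda * ln (`|b| / `|a|) ->
  littleo_infty (fun t => loghaz lambda t ^+ q * tailM P Y a t) (W k b).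
Proof.
move=> aa ab lab qk kq.
have a0 : 0 < `|a| by rewrite normr_gt0 active_neq0.
set L := ln (`|b| / `|a|) in kq *.
have L0 : 0 < L by rewrite ln_gt0// ltr_pdivlMr// mul1r.
(* The midpoint: below [lambda], as [active_ratio_lt] requires, yet with [mu * L > k - q], so a
   positive power of [t] is left over. *)
pose mu := (lambda + (k - q)%:R / L) / 2.
have kL : (k - q)%:R / L < lambda by rewrite ltr_pdivrMr.
have ml : mu < lambda by rewrite /mu; lra.
have s0 : 0 < mu * L - (k - q)%:R.
  rewrite subr_gt0 -ltr_pdivrMr// /mu; lra.
have [C C0 HC] := active_ratio_lt aa ab lab ml.
move=> e e0.
apply: filterS3 (filterI (near_pinfty_ge 1) HC) (loghaz_ge_inv lambda_gt0)
  (near_powR_le C0 s0 e0) => t [t1 H1] Li H2.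
have t0 : 0 < t by lra.
have L1 : 0 < loghaz lambda t by apply: lt_le_trans Li; rewrite invr_gt0.
rewrite !ger0_norm ?mulr_ge0 ?exprn_ge0 ?tailM_ge0 ?(ltW L1)//.
apply: (@le_trans _ _ (loghaz lambda t ^+ q * (C * t `^ (- (mu * L)) * tailM P Y b t))).
  by rewrite ler_wpM2l ?exprn_ge0 ?(ltW L1).
rewrite /W [e * _]mulrA [loghaz _ _ ^+ q * _]mulrA ler_wpM2r ?tailM_ge0//.
have -> : e * loghaz lambda t ^+ k = loghaz lambda t ^+ q * (e * loghaz lambda t ^+ (k - q)).
  by rewrite mulrCA -exprD subnKC.
rewrite ler_wpM2l ?exprn_ge0 ?(ltW L1)//.
apply: (@le_trans _ _ (e * t^-1 ^+ (k - q))); last first.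
  by rewrite ler_wpM2l ?(ltW e0)// lerXn2r ?nnegrE ?invr_ge0 ?(ltW t0) ?(ltW L1).
rewrite exprVn ler_pdivlMr ?exprn_gt0// -powR_mulrn ?(ltW t0)// -mulrA -powRD.
  by rewrite (le_trans _ H2)// opprB addrC.
by apply/implyP => _; rewrite gt_eqF.
Qed.
End WeightedTails.

(** * The two cases of the left tail *)

Section LeftTail.
Context {R : realType} d (T : measurableType d) (P : probability T R).
Variable Y : {RV P >-> R}.

Lemma measurable_le (t : R) : measurable [set w | Y w <= t].
Proof.
rewrite (_ : [set w | _] = Y @^-1` `]-oo, t]); last first.
  by apply/seteqP; split=> w /=; rewrite in_itv.
by rewrite -[X in measurable X]setTI; exact: measurable_funP.
Qed.

Lemma left_tail_null (t0 : R) : (forall t, t <= t0 -> dfun P Y t = 0) ->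
  \forall v \near +oo, tailM P Y (-1) v = 0.
Proof.
move=> H; apply: filterS (near_pinfty_ge (- t0)) => v vt.
apply/eqP; rewrite eq_le tailM_ge0 andbT -(H (- v)); last by rewrite lerNl.
apply: le_prob; [exact: measurable_tail|exact: measurable_le|].
by move=> w /=; rewrite mulN1r ltrNr => /ltW.
Qed.

(** The distribution function at [- v] counts [Y <= - v], the tail of [- Y] counts [Y < - v]. A
    shift by 1 passes from one to the other at the cost of a constant factor. *)
Lemma tail_balanced lambda m h (l : R) : (0 < m)%N -> 0 < lambda ->
  logtail lambda m (tailM P Y 1) h -> 0 < l ->
  ((1 - dfun P Y t) / dfun P Y (- t)) @[t --> +oo] --> l ->
  exists2 C : R, 0 < C & \forall v \near +oo,
    tailM P Y 1 v <= C * tailM P Y (-1) v /\ tailM P Y (-1) v <= C * tailM P Y 1 v.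
Proof.
move=> m0 l0 HH ll /cvgrPdist_le cl.
have l2 : 0 < l / 2 by rewrite divr_gt0.
have B : \forall v \near +oo,
   dfun P Y (- v) <= (2 / l) * tailM P Y 1 v /\ tailM P Y 1 v <= (2 * l) * dfun P Y (- v).
  apply: filterS (cl _ l2) => v; rewrite -tailM_dfun ler_norml => /andP[H1 H2].
  have F0 : 0 < dfun P Y (- v).
    rewrite lt_neqAle prob_ge0 andbT eq_sym; apply/eqP => F0.
    by move: H2; rewrite F0 invr0 mulr0; lra.
  have H3 : tailM P Y 1 v / dfun P Y (- v) <= 2 * l by lra.
  have H4 : l / 2 <= tailM P Y 1 v / dfun P Y (- v) by lra.
  split; last by rewrite -ler_pdivrMr.
  by move: H4; rewrite ler_pdivlMr// mulrC -ler_pdivlMr// invf_div mulrC.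
(* At order 0 with [s = 1] and [e = 1] this says that the tail at [t - 1] is at most twice the tail
   at [t]. *)
have /near_oo_ge - /(_ _ ltr01) D := remainder_cvg0 1 m0 l0 HH (leq0n m) ltr01.
have C0 : 0 < 2 / l + 4 * l by apply: addr_gt0; [rewrite divr_gt0|rewrite mulr_gt0].
exists (2 / l + 4 * l) => //.
have a1 : 0 < 1 :> R by [].
apply: filterS3 (near_oo_ge a1 B) D (near_pinfty_ge 2) => v Bv Dv v2; split.
  have := Dv (v + 1); rewrite mul1r lerDl => /(_ ler01).
  rewrite /remainder normr1 ifT; last lra.
  rewrite addrK big_ord1 !expr0 fact0 divr1 !mul1r.
  rewrite ler_norml => /andP[_ H1].
  have /Bv[_ H2] : 1 * v <= v + 1 by lra.
  have H3 : dfun P Y (- (v + 1)) <= tailM P Y (-1) v.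
    apply: le_prob; [exact: measurable_le|exact: measurable_tail|].
    by move=> w /=; rewrite mulN1r; lra.
  have H4 : 2 * l * dfun P Y (- (v + 1)) <= 2 * l * tailM P Y (-1) v.
    by rewrite ler_wpM2l// mulr_ge0// ltW.
  rewrite mulrDl; have := @mulr_ge0 _ (2 / l) (tailM P Y (-1) v).
  rewrite tailM_ge0 divr_ge0 ?(ltW ll)// => /(_ isT isT).
  by move: H1 H2 H4; rewrite -[4 * l * _]mulrA -[2 * l * _]mulrA; lra.
have /Bv[H1 _] : 1 * v <= v by rewrite mul1r.
have H2 : tailM P Y (-1) v <= dfun P Y (- v).
  apply: le_prob; [exact: measurable_tail|exact: measurable_le|].
  by move=> w /=; rewrite mulN1r ltrNr => /ltW.
rewrite (le_trans H2)// (le_trans H1)// ler_wpM2r ?tailM_ge0// lerDl.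
by rewrite mulr_ge0// ltW.
Qed.
End LeftTail.

(** * Decomposition of the series tail into single jumps *)

Section Series.
Context {R : realType} d (T : measurableType d) (P : probability T R).
Variable X : int -> {RV P >-> R}.
Variable c : int -> R.
Hypothesis indep : mutually_independent P (fun i => (X i : T -> R)).
Hypothesis idd : forall i (B : set R), measurable B -> P (X i @^-1` B) = P (X 0 @^-1` B).

Let term (excl : option int) (j : int) (w : T) : R :=
  if excl == Some j then 0 else c j * X j w.
Let S (excl : option int) : T -> R := wseries c (fun i => X i : T -> R) excl.

Lemma wseriesE excl w : S excl w = limn (isum (term excl ^~ w)).
Proof.
rewrite /S /wseries; congr (limn _); apply/funext => n.
by rewrite /wpsum -isum_ord.
Qed.

Lemma measurable_term excl j : measurable_fun setT (term excl j).
Proof.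
rewrite /term; case: (excl == Some j); first exact: measurable_cst.
exact: measurable_funM.
Qed.

Lemma measurable_wseries excl : measurable_fun setT (S excl).
Proof.
rewrite (_ : S excl = fun w => limn (isum (term excl ^~ w))).
  apply: (measurable_limn (f := fun n w => isum (term excl ^~ w) n)) => n.
  by apply: measurable_isum => j; exact: measurable_term.
by apply/funext => w; exact: wseriesE.
Qed.

Lemma indep_wseries i (B C : set R) : measurable B -> measurable C ->
  P (X i @^-1` B `&` S (Some i) @^-1` C) = (P (X i @^-1` B) * P (S (Some i) @^-1` C))%E.
Proof.
move=> mB mC.
rewrite (_ : S (Some i) = fun w => limn (isum (term (Some i) ^~ w))); last first.
  by apply/funext => w; exact: wseriesE.
apply: (indep_limn indep) => //.
  move=> j ji; exists (c j); apply/funext => w; rewrite /term.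
  by case: eqP => // -[ij]; rewrite ij eqxx in ji.
by apply/funext => w; rewrite /term eqxx.
Qed.

(* Splitting off finitely many terms, on the event where the rest converges. *)
Lemma wseries_split excl N w (B : R) :
  (forall i, excl = Some i -> (`|i| <= N)%N) ->
  (forall s : seq int, uniq s ->
     \sum_(j <- s) `|(if (N < `|j|)%N then c j else 0) * X j w| <= B) ->
  exists2 r : R, `|r| <= B & S excl w = \sum_(j <- ints N) term excl j w + r /\
    S None w = \sum_(j <- ints N) term None j w + r.
Proof.
move=> eN HB; pose b j := (if (N < `|j|)%N then c j else 0) * X j w.
have [cb bB] := isum_cvg (a := b) HB.
exists (limn (isum b)) => //.
have gen e : (forall i, e = Some i -> (`|i| <= N)%N) ->
    S e w = \sum_(j <- ints N) term e j w + limn (isum b).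
  move=> eN'; rewrite wseriesE.
  pose a j := if (`|j| <= N)%N then term e j w else 0.
  have aN (j : int) : (N < `|j|)%N -> a j = 0 by rewrite /a ltnNge => /negbTE->.
  have [ca aE] := limn_isum_fin aN.
  rewrite (_ : term e ^~ w = fun j => a j + b j); last first.
    apply/funext => j; rewrite /a /b ltnNge; case: ifPn => jN /=.
      by rewrite mul0r addr0.
    rewrite add0r /term; case: eqP => // ej.
    by move: (eN' _ ej); rewrite (negbTE jN).
  rewrite limn_isumD// aE; congr (_ + _).
  by rewrite /isum; apply: eq_big_seq => j; rewrite mem_ints /a => ->.
by split; exact: gen.
Qed.

Variables (delta A : R).
Hypotheses (delta_gt0 : 0 < delta) (delta_lt1 : delta < 1) (A_gt0 : 0 < A).
Hypothesis sumA : forall s : seq int, uniq s -> \sum_(j <- s) `|c j| `^ delta <= A.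

Let Q v := prob P [set w | v < `|X 0 w|].

Hypothesis Qdecay : \forall v \near +oo, forall theta : R, 0 < theta -> theta <= 1 ->
  Q (v / theta) <= theta `^ (delta / (1 - delta)) * Q v.
Hypothesis Qpoly : forall q : nat, exists2 C : R, 0 < C & \forall v \near +oo, Q v <= C / v ^+ q.

(** [series_tail] with [eps = A] bounds the tail of the series at [v] by [Q] at [v / rho], which
    decays faster than any power. *)
Lemma wseries_moments excl q :
  P.-integrable setT (fun w => ((1 + `|S excl w|) ^+ q)%:E).
Proof.
move: q; apply: all_moments; first exact: measurable_wseries.
move=> q; have [C C0 HC] := Qpoly q.
pose rho := A `^ delta^-1; have r0 : 0 < rho by rewrite powR_gt0.
have ri : 0 < rho^-1 by rewrite invr_gt0.
exists (C * rho ^+ q); first by rewrite mulr_gt0 ?exprn_gt0.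
apply: filterS3 (near_oo_scale ri HC) (near_oo_scale ri Qdecay) (near_pinfty_ge 1) => v H1 H2 v1.
have v0 : 0 < v by lra.
have x0 : 0 <= rho^-1 * v by rewrite mulr_ge0// ltW.
have sb : forall s : seq int, uniq s ->
    \sum_(j <- s) `|if excl == Some j then 0 else c j| `^ delta <= A.
  move=> s us; apply: le_trans (sumA us); apply: ler_sum => j _.
  by case: ifP => // _; rewrite normr0 powR0 ?gt_eqF// powR_ge0.
have [Z [mZ PZ HZ]] := series_tail idd delta_gt0 delta_lt1 A_gt0 x0 sb H2.
apply: (@le_trans _ _ (prob P Z)).
  apply: le_prob => //.
    rewrite (_ : [set w | _] = (fun w => `|S excl w|) @^-1` `]v, +oo[); last first.
      by apply/seteqP; split=> w /=; rewrite in_itv /= andbT.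
    rewrite -[X in measurable X]setTI.
    have mS : measurable_fun setT (fun w => `|S excl w|).
      by apply: measurableT_comp => //; exact: measurable_wseries.
    by apply: mS => //; exact: measurable_itv.
  move=> w /= vS; apply: contrapT => nZ.
  have := HZ w nZ; rewrite -/rho mulrA divff ?gt_eqF// mul1r => K.
  have bnd s : uniq s -> \sum_(i <- s) `|term excl i w| <= v.
    move=> us; apply: le_trans (K s us); apply: ler_sum => j _.
    by rewrite /term; case: ifP => // _; rewrite mul0r.
  by have [_] := isum_cvg bnd; rewrite -wseriesE leNgt vS.
rewrite (le_trans PZ)// (le_trans H1)// exprMn invfM exprVn invrK mulrA.
by rewrite mulrAC.
Qed.

Variable g : R -> R.
Hypothesis Qfar : exists2 K : R, 0 < K & littleo_infty (fun t => Q (K * t)) g.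
Hypothesis Qpair : forall x y : R, 0 < x -> 0 < y ->
  littleo_infty (fun t => Q (x * t) * Q (y * t)) g.

Let jump i t := [set w | t < c i * X i w + S (Some i) w /\ `|S (Some i) w| <= t / 2].

Lemma measurable_jump i t : measurable (jump i t).
Proof.
have mS := measurable_wseries (Some i).
have m1 : measurable_fun setT (fun w => c i * X i w + S (Some i) w).
  by apply: measurable_funD => //; exact: measurable_funM.
have m2 : measurable_fun setT (fun w => `|S (Some i) w|) by apply: measurableT_comp.
rewrite (_ : jump i t = ((fun w => c i * X i w + S (Some i) w) @^-1` `]t, +oo[) `&`
   ((fun w => `|S (Some i) w|) @^-1` `]-oo, t / 2])); last first.
  by apply/seteqP; split=> w /=; rewrite !in_itv /= andbT.
apply: measurableI; rewrite -[X in measurable X]setTI.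
  by apply: m1 => //; exact: measurable_itv.
by apply: m2 => //; exact: measurable_itv.
Qed.

Lemma measurable_wseries_gt t : measurable [set w | t < S None w].
Proof.
rewrite (_ : [set w | _] = S None @^-1` `]t, +oo[); last first.
  by apply/seteqP; split=> w /=; rewrite in_itv /= andbT.
rewrite -[X in measurable X]setTI.
by apply: (measurable_wseries None) => //; exact: measurable_itv.
Qed.

Let big i (t : R) := [set w | t < `|c i * X i w|].

Lemma measurable_big i t : measurable (big i t).
Proof.
rewrite (_ : big i t = (fun w => `|c i * X i w|) @^-1` `]t, +oo[); last first.
  by apply/seteqP; split=> w /=; rewrite in_itv /= andbT.
rewrite -[X in measurable X]setTI.
have mc : measurable_fun setT (fun w => `|c i * X i w|).
  by apply: measurableT_comp => //; exact: measurable_funM.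
by apply: mc => //; exact: measurable_itv.
Qed.

Lemma big_pair_littleo i j (a : R) : i != j -> 0 < a ->
  littleo_infty (fun t => prob P (big i (a * t) `&` big j (a * t))) g.
Proof.
move=> ij a0.
have Z k : c k = 0 -> \forall t \near +oo, big k (a * t) = set0.
  move=> ck; apply: filterS (near_pinfty_ge 0) => t t0.
  apply/seteqP; split=> w //; rewrite /big /= ck mul0r normr0 ltNge.
  by rewrite mulr_ge0// ltW.
have zero : littleo_infty (fun=> 0) g.
  by move=> e e0; apply: nearW => t; rewrite normr0 mulr_ge0// ltW.
have [ci|ci] := eqVneq (c i) 0.
  apply: littleo_near zero; apply: filterS (Z _ ci) => t ->.
  by rewrite set0I /prob measure0.
have [cj|cj] := eqVneq (c j) 0.
  apply: littleo_near zero; apply: filterS (Z _ cj) => t ->.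
  by rewrite setI0 /prob measure0.
have ci0 : 0 < `|c i| by rewrite normr_gt0.
have cj0 : 0 < `|c j| by rewrite normr_gt0.
have := Qpair (divr_gt0 a0 ci0) (divr_gt0 a0 cj0).
apply: littleo_near; apply: nearW => t.
pose B k := (fun x : R => `|x|) @^-1` `](a / `|c k|) * t, +oo[.
have mB k : measurable (B k).
  rewrite -[X in measurable X]setTI.
  by apply: normr_measurable => //; exact: measurable_itv.
have E k : 0 < `|c k| -> big k (a * t) = X k @^-1` (B k).
  move=> ck; apply/seteqP; split=> w; rewrite /big /B /= in_itv /= andbT normrM.
    by rewrite [_ / _ * t]mulrAC ltr_pdivrMr// [`|X k w| * _]mulrC.
  by rewrite [_ / _ * t]mulrAC ltr_pdivrMr// [`|X k w| * _]mulrC.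
apply: EFin_inj; rewrite -probE; last by apply: measurableI; exact: measurable_big.
rewrite E// E// (indep_pair indep)// !idd// EFinM.
have QE k : P (X 0 @^-1` B k) = (Q (a / `|c k| * t))%:E.
  rewrite /Q -probE; last exact: measurable_abs_gt.
  by congr (P _); apply/seteqP; split=> w; rewrite /B /= in_itv /= andbT.
by rewrite -!QE.
Qed.

Lemma term_excl N i w : i \in ints N ->
  \sum_(j <- ints N) term None j w = c i * X i w + \sum_(j <- ints N) term (Some i) j w.
Proof.
move: (ints_uniq N); move: (ints N) => s U iN.
rewrite (bigD1_seq i iN U) [X in _ = _ + X](bigD1_seq i iN U) /=.
rewrite [in X in _ = X]/term eqxx add0r; congr (_ + _); apply: eq_bigr => j ji.
by case: eqP => // -[ij]; rewrite ij eqxx in ji.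
Qed.

(** The exceptional set joins two events: two window terms exceeding [a * t], and the event [Z]
    outside which the terms beyond the window sum to at most [t/4]. *)
Lemma decomposition N0 : exists2 N, (N0 <= N)%N &
  littleo_infty (fun t => prob P [set w | t < S None w] -
     \sum_(i <- ints N) prob P (jump i t)) g.
Proof.
have [K K0 QK] := Qfar.
(* [Q (K * t)] is negligible; with this [rho] it pays for a remainder of size
   [rho * K * t = t / 4]. *)
pose rho := (4 * K)^-1; have r0 : 0 < rho by rewrite invr_gt0 mulr_gt0.
pose eps := rho `^ delta; have e0 : 0 < eps by rewrite powR_gt0.
have epsE : eps `^ delta^-1 = rho.
  by rewrite /eps -powRrM mulfV ?gt_eqF// powRr1// ltW.
have c0 j : 0 <= `|c j| `^ delta by exact: powR_ge0.
have [N1 HN1] := seq_bound_tail c0 sumA e0.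
exists (maxn N0 N1); first exact: leq_maxl.
set N := maxn N0 N1.
pose b j := if (N < `|j|)%N then c j else 0.
have sb : forall s : seq int, uniq s -> \sum_(j <- s) `|b j| `^ delta <= eps.
  move=> s us; apply: le_trans (HN1 s us); apply: ler_sum => j _; rewrite /b.
  case: ifPn => [Nj|_]; first by rewrite (leq_ltn_trans _ Nj)// leq_maxr.
  by rewrite normr0 powR0 ?gt_eqF//; case: ifP.
pose n := size (ints N).
(* If no window term exceeds [a * t], their sum is at most [t/4]. *)
pose a : R := (4 * n.+1%:R)^-1.
have a0 : 0 < a by rewrite invr_gt0 mulr_gt0.
pose pairs t := \big[setU/set0]_(p <- [seq (i, j) | i <- ints N, j <- ints N])
   (if p.1 != p.2 then big p.1 (a * t) `&` big p.2 (a * t) else set0).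
have mp t p : measurable (if p.1 != p.2 then big p.1 (a * t) `&` big p.2 (a * t) else set0).
  by case: ifP => // _; apply: measurableI; exact: measurable_big.
have mpairs t : measurable (pairs t) by apply: bigsetU_measurable => p _; exact: mp.
have pairsP t w i j : i \in ints N -> j \in ints N -> i != j ->
    a * t < `|c i * X i w| -> a * t < `|c j * X j w| -> pairs t w.
  move=> iN jN ij bi bj; rewrite /pairs -bigcup_seq; exists (i, j).
    exact: (@allpairs_f _ _ _ pair).
  by rewrite /= ij.
have pairs_o : littleo_infty (fun t => prob P (pairs t)) g.
  apply: (@littleo_le _ _ (fun t => \sum_(p <- [seq (i, j) | i <- ints N, j <- ints N])
     prob P (if p.1 != p.2 then big p.1 (a * t) `&` big p.2 (a * t) else set0)) _ 1) => //.
    apply: nearW => t; rewrite mul1r ger0_norm ?prob_ge0// ger0_norm; last first.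
      by apply: sumr_ge0 => p _; exact: prob_ge0.
    exact: prob_bigsetU_le.
  apply: littleo_sum => -[i j] _ /=.
  have [ij|ij] := eqVneq i j.
    move=> e e1; apply: nearW => t; rewrite /prob measure0 /= normr0.
    by rewrite mulr_ge0// ltW.
  exact: big_pair_littleo.
have tot : littleo_infty (fun t => prob P (pairs t) + Q (K * t)) g.
  exact: littleo_add.
apply: (littleo_le (C := n.+1%:R) _ _ tot) => //.
apply: filterS2 (near_oo_scale K0 Qdecay) (near_pinfty_ge 1) => t Hd t1.
have t0 : 0 < t by lra.
have x0 : 0 <= K * t by rewrite mulr_ge0// ltW.
have [Z [mZ PZ HZ]] := series_tail idd delta_gt0 delta_lt1 e0 x0 sb Hd.
have rt : eps `^ delta^-1 * (K * t) = t / 4.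
  by rewrite epsE /rho; field; rewrite gt_eqF.
rewrite rt in HZ.
have at4 : n%:R * (a * t) <= t / 4.
  rewrite /a invfM mulrA mulrCA -mulrA [X in _ <= X]mulrC ler_wpM2l//.
  by rewrite ler_piMl ?(ltW t0)// ler_pdivrMr// mul1r ler_nat.
have at4' : a * t <= t / 4.
  by rewrite mulrC ler_wpM2l ?(ltW t0)// lef_pV2 ?posrE ?mulr_gt0// ler_peMr// ler1n.
have SumB (f : int -> R) : (forall j, j \in ints N -> f j <= a * t) ->
    \sum_(j <- ints N) f j <= t / 4.
  move=> Hf; apply: le_trans at4.
  rewrite -[n]sum1_size natr_sum mulr_suml big_seq [X in _ <= X]big_seq.
  by apply: ler_sum => j jN; rewrite mul1r; exact: Hf.
have nn : n.+1%:R * prob P (pairs t `|` Z) <= n.+1%:R * `|prob P (pairs t) + Q (K * t)|.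
  rewrite ler_wpM2l// ger0_norm; last by rewrite addr_ge0 ?prob_ge0.
  by rewrite (le_trans (probU_le _ _ _))// lerD2l.
apply: le_trans nn.
apply: prob_sum_approx.
- exact: ints_uniq.
- exact: measurable_wseries_gt.
- exact: measurableU.
- by move=> i; exact: measurable_jump.
- move=> w /= tS nZ.
  have nZ1 : ~ Z w by move=> H; apply: nZ; right.
  have nP : ~ pairs t w by move=> H; apply: nZ; left.
  have [i iN yi] : exists2 i, i \in ints N & a * t < c i * X i w.
    apply: contrapT => H.
    have [r rB [_ SE]] := @wseries_split None N w (t / 4) (fun i H => match H with end) (HZ w nZ1).
    have : \sum_(j <- ints N) term None j w <= t / 4.
      apply: SumB => j jN; rewrite leNgt; apply/negP => lt; apply: H.
      by exists j.
    by move: tS rB; rewrite SE ler_norml => ? /andP[? ?] ?; lra.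
  exists i => //.
  have eN k : Some i = Some k -> (`|k| <= N)%N by move=> [<-]; rewrite -mem_ints.
  have [r rB [Si SN]] := @wseries_split (Some i) N w (t / 4) eN (HZ w nZ1).
  have SS : S None w = c i * X i w + S (Some i) w.
    by rewrite SN Si addrA -term_excl.
  rewrite /jump /= -SS; split=> //.
  rewrite leNgt; apply/negP => Sbig; apply: nP.
  (* Otherwise the other window terms and the remainder contribute at most [t/4] each, contradicting
     [|S_i| > t/2]. *)
  have [j jN [ij yj]] : exists2 j, j \in ints N & i != j /\ a * t < `|c j * X j w|.
    apply: contrapT => H.
    have : \sum_(j <- ints N) `|term (Some i) j w| <= t / 4.
      apply: SumB => j jN; rewrite /term; have [<-|ij] := eqVneq i j.
        by rewrite eqxx normr0 mulr_ge0// ltW.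
      rewrite ifN; last by apply: contra_neq ij => -[].
      by rewrite leNgt; apply/negP => lt; apply: H; exists j.
    move=> H1; have H2 := ler_norm_sum (ints N) (fun j => term (Some i) j w) xpredT.
    have H3 := ler_normD (\sum_(j <- ints N) term (Some i) j w) r.
    by move: Sbig; rewrite Si; lra.
  apply: (pairsP _ _ i j) => //.
  by rewrite (lt_le_trans yi)// ler_norm.
(* Outside [Z] the series converges, so its limit does split into the term [i] and the sum of the
   others. *)
- move=> i w iN [tS _] nZ.
  have nZ1 : ~ Z w by move=> H; apply: nZ; right.
  have eN k : Some i = Some k -> (`|k| <= N)%N by move=> [<-]; rewrite -mem_ints.
  have [r rB [Si SN]] := @wseries_split (Some i) N w (t / 4) eN (HZ w nZ1).
  rewrite /=; have -> // : S None w = c i * X i w + S (Some i) w.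
  by rewrite SN Si addrA -term_excl.
(* Each of the two jumps forces its own term above [t/2], hence above [a * t]. *)
- move=> i j w iN jN ij [ti Si] [tj Sj]; left; apply: (pairsP _ _ i j) => //.
    apply: lt_le_trans (ler_norm _).
    by move: Si; rewrite ler_norml => /andP[_]; lra.
  apply: lt_le_trans (ler_norm _).
  by move: Sj; rewrite ler_norml => /andP[_]; lra.
Qed.
End Series.

(** * Contribution of each index *)

Section PerIndex.
Context {R : realType} d (T : measurableType d) (P : probability T R).
Variable X : int -> {RV P >-> R}.
Variable c : int -> R.
Hypothesis indep : mutually_independent P (fun i => (X i : T -> R)).
Hypothesis idd : forall i (B : set R), measurable B -> P (X i @^-1` B) = P (X 0 @^-1` B).
Let S (excl : option int) : T -> R := wseries c (fun i => X i : T -> R) excl.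
Hypothesis Smoments : forall excl q,
  P.-integrable setT (fun w => ((1 + `|S excl w|) ^+ q)%:E).
Variables (lambda : R) (m : nat) (h : R -> R).
Hypotheses (m_gt0 : (0 < m)%N) (lambda_gt0 : 0 < lambda).
Hypothesis HHp : logtail lambda m (tailM P (X 0) 1) h.
Hypothesis left_tail : (\forall v \near +oo, tailM P (X 0) (-1) v = 0) \/ balanced (X 0) m.

Let jump i t := [set w | t < c i * X i w + S (Some i) w /\ `|S (Some i) w| <= t / 2].
Let tl := tailM P (X 0).

Lemma tailM_id i a : tailM P (X i) a = tl a.
Proof.
apply/funext => t; rewrite /tl /tailM /prob; congr fine.
have E j : [set w | t < a * X j w] = X j @^-1` ((fun y => a * y) @^-1` `]t, +oo[).
  by apply/seteqP; split=> v /=; rewrite in_itv /= andbT.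
rewrite !E idd//; rewrite -[X in measurable X]setTI.
have mc : measurable_fun setT (fun y : R => a * y) by exact: measurable_funM.
by apply: mc => //; exact: measurable_itv.
Qed.

Lemma loghaz_change l' t : loghaz l' t = l' / lambda * loghaz lambda t.
Proof. by rewrite /loghaz !mulrA divfK// gt_eqF. Qed.

(** A negative weight comes with its own [l'], but [loghaz l'] and [loghaz lambda] differ by a
    constant factor only. *)
Lemma jump_order_littleo i n : active (X 0) m (c i) -> (n <= m)%N ->
  littleo_infty (fun t => prob P (jump i t) -
    \sum_(j < n.+1) (-1) ^+ j / j`!%:R * rv_moment P (S (Some i)) j * derive1n j (tl (c i)) t)
   (fun t => loghaz lambda t ^+ n * tl (c i) t).
Proof.
move=> ai nm.
have [l' [h' l0 HH]] := active_logtail m_gt0 lambda_gt0 HHp ai.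
have mS := measurable_wseries X c (Some i).
pose SS : {RV P >-> R} := HB.pack (S (Some i)) (isMeasurableFun.Build _ _ _ _ _ mS).
have HH' : logtail l' m (tailM P (X i) (c i)) h' by rewrite tailM_id.
have ind (B C : set R) : measurable B -> measurable C ->
  P (X i @^-1` B `&` SS @^-1` C) = (P (X i @^-1` B) * P (SS @^-1` C))%E.
  by move=> mB mC; exact: (indep_wseries c indep).
have K := jump_expansion m_gt0 l0 HH' nm ind (Smoments (Some i)).
have e1 : 0 < (l' / lambda) ^+ n by rewrite exprn_gt0// divr_gt0.
apply: (@littleo_ler _ _ (fun t => loghaz l' t ^+ n * tl (c i) t) _ ((l' / lambda) ^+ n)) => //.
  apply: nearW => t; rewrite loghaz_change exprMn -mulrA normrM.
  by rewrite [X in X * _]ger0_norm// ltW.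
move=> e e0; apply: filterS2 (K _ e0) (filterI (loghaz_gt0 l0) (near_pinfty_ge 0)) => t.
rewrite tailM_id -/tl => H1 [L0 _].
rewrite [X in _ <= _ * X]ger0_norm//.
by rewrite mulr_ge0 ?exprn_ge0 ?(ltW L0)// /tl tailM_ge0.
Qed.

Lemma derive1n_active_bound i n : active (X 0) m (c i) -> (n <= m)%N ->
  exists2 C : R, 0 < C & \forall t \near +oo,
    `|derive1n n (tl (c i)) t| <= C * `|loghaz lambda t ^+ n * tl (c i) t|.
Proof.
move=> ai nm; have [l' [h' l0 HH]] := active_logtail m_gt0 lambda_gt0 HHp ai.
exists (2 * (l' / lambda) ^+ n); first by rewrite mulr_gt0// exprn_gt0// divr_gt0.
apply: filterS2 (derive1n_bound m_gt0 l0 HH nm) (loghaz_gt0 lambda_gt0) => t H L0.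
apply: (le_trans H); rewrite loghaz_change exprMn ger0_norm.
  by rewrite -!mulrA.
by rewrite mulr_ge0 ?exprn_ge0 ?(ltW L0)// /tl tailM_ge0.
Qed.

Variable b : R.
Hypothesis ab : active (X 0) m b.
Variable k : nat.
Hypothesis km : (k <= m)%N.

Let W t := loghaz lambda t ^+ k * tl b t.
Let L i t := laplace_char (rv_moment P (S (Some i)))
  (k%:Z + Num.floor (lambda * ln `|c i / b|)) (tl (c i)) t.

Lemma jump_littleo_max i : active (X 0) m (c i) -> `|c i| = `|b| ->
  littleo_infty (fun t => prob P (jump i t) - L i t) W.
Proof.
move=> ai ib; have b0 := active_neq0 ab.
have [C C0 HC] := active_ratio_eq ai ab ib.
apply: (littleo_ler (g1 := fun t => loghaz lambda t ^+ k * tl (c i) t) C0).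
  apply: filterS2 HC (loghaz_gt0 lambda_gt0) => t H L0.
  rewrite /W !normrM mulrCA ler_wpM2l// !ger0_norm ?tailM_ge0//.
apply: littleo_near (jump_order_littleo ai km); apply: nearW => t.
rewrite /L /laplace_char normf_div ib divff ?normr_eq0// ln1 mulr0 floor0 addr0.
by [].
Qed.

(** The integer part is negative, so an expansion one order beyond the Laplace character still has
    order at most [k]. Its extra term and its error are both [O(h^q H_i)], negligible since [k - q]
    is strictly below [lambda * ln (|b| / |c i|)]. *)
Lemma jump_littleo_lt i : active (X 0) m (c i) -> `|c i| < `|b| ->
  littleo_infty (fun t => prob P (jump i t) - L i t) W.
Proof.
move=> ai ib; have b0 := active_neq0 ab; have c0 := active_neq0 ai.
have nb0 : 0 < `|b| by rewrite normr_gt0.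
have nc0 : 0 < `|c i| by rewrite normr_gt0.
set x := lambda * ln `|c i / b|.
have xE : lambda * ln (`|b| / `|c i|) = - x.
  by rewrite /x normf_div -[`|c i| / `|b|]invf_div lnV ?posrE ?divr_gt0// mulrN opprK.
have x0 : x < 0.
  rewrite -oppr_gt0 -xE mulr_gt0// ln_gt0// ltr_pdivlMr// mul1r//.
set z := k%:Z + Num.floor x.
have fx0 : Num.floor x < 0 by rewrite floor_lt_int.
(* The number of terms of the Laplace character, and also the first order that it omits. The strict
   inequality [kq] is [x < floor x + 1]. *)
pose q := if 0 <= z then (absz z).+1 else 0%N.
have qk : (q <= k)%N by rewrite /q; case: ifP => // z0; lia.
have LE t : L i t = \sum_(j < q) (-1) ^+ j / j`!%:R * rv_moment P (S (Some i)) j * derive1n j (tl (c i)) t.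
  by rewrite /L /laplace_char -/x -/z /q; case: ifP => // _; rewrite big_ord0.
have kq : (k - q)%:R < lambda * ln (`|b| / `|c i|).
  rewrite xE ltrNr.
  have : x < (Num.floor x)%:~R + 1 by rewrite -[1]/(1%:~R) -rmorphD; exact: floorD1_gt.
  have : ((k - q)%N%:Z <= - Num.floor x - 1)%R by rewrite /q; case: ifP; lia.
  by rewrite -(ler_int R) rmorphB rmorphN /= => A B; lra.
have qm := leq_trans qk km.
have o1 := active_order_littleo lambda_gt0 HHp ai ab ib qk kq.
have [C C0 HC] := derive1n_active_bound ai qm.
have o2 : littleo_infty (fun t => prob P (jump i t) -
    \sum_(j < q.+1) (-1) ^+ j / j`!%:R * rv_moment P (S (Some i)) j * derive1n j (tl (c i)) t) W.
  move=> e e0; apply: filterS2 (jump_order_littleo ai qm e0) (o1 _ ltr01) => t H1 H2.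
  by apply: (le_trans H1); rewrite ler_wpM2l ?(ltW e0)// -[X in _ <= X]mul1r.
pose A := (-1) ^+ q / q`!%:R * rv_moment P (S (Some i)) q.
have o3 : littleo_infty (fun t => A * derive1n q (tl (c i)) t) W.
  apply: (littleo_le (C := `|A| * C + 1) _ _ o1).
    by rewrite ltr_wpDl// mulr_ge0// ltW.
  apply: filterS HC => t H1; rewrite normrM mulrDl -mulrA ler_wpDr//.
  by rewrite ler_wpM2l.
apply: littleo_near (littleo_add o2 o3); apply: nearW => t.
by rewrite LE big_ord_recr /= -/A opprD addrA subrK.
Qed.

(** Below this threshold the order is negative and the operator empty by convention: for active
    weights the indicator discards only zero terms. *)
Lemma laplace_small i : active (X 0) m (c i) -> `|c i| < `|b| * expR (- (k%:R / lambda)) ->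
  L i = fun=> 0.
Proof.
move=> ai ib; have b0 := active_neq0 ab; have c0 := active_neq0 ai.
have nb0 : 0 < `|b| by rewrite normr_gt0.
have nc0 : 0 < `|c i| by rewrite normr_gt0.
apply/funext => t; rewrite /L /laplace_char ifN// -ltNge.
have : lambda * ln `|c i / b| < - k%:R.
  have : ln `|c i / b| < - (k%:R / lambda).
    rewrite normf_div -[X in _ < X]expRK ltr_ln ?posrE ?divr_gt0 ?expR_gt0//.
    by rewrite ltr_pdivrMr// mulrC.
  by rewrite -(ltr_pM2l lambda_gt0) mulrN [lambda * (_ / _)]mulrC divfK// gt_eqF.
move=> H; have := le_lt_trans (floor_le _) H.
by rewrite -[k%:R]/((k%:Z)%:~R) -rmorphN ltr_int -ltrBrDl sub0r.
Qed.

Lemma jump_littleo_inactive i : ~ active (X 0) m (c i) ->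
  littleo_infty (fun t => prob P (jump i t)) W.
Proof.
move=> na; have h0 : 0 < 1 / 2 :> R by rewrite divr_gt0.
have H := near_oo_scale h0 (inactive_tail left_tail na).
move=> e e0; apply: filterS H => t; rewrite -[tailM P (X 0) (c i)]/(tl (c i)) -(tailM_id i) => Ht.
have -> : prob P (jump i t) = 0.
  apply/eqP; rewrite eq_le prob_ge0 andbT -Ht.
  apply: le_prob; [exact: measurable_jump|exact: measurable_tail|].
  move=> w [H1]; rewrite ler_norml => /andP[_ H2] /=; lra.
by rewrite normr0 mulr_ge0// ltW.
Qed.
End PerIndex.

Lemma fsum_ints {R : realType} (I : set int) (N : nat) (f : int -> R) :
  (forall i, I i -> (`|i| <= N)%N) ->
  \sum_(i \in I) f i = \sum_(i <- ints N) (if i \in I then f i else 0).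
Proof.
move=> IN; rewrite -(@fsbig_fwiden _ _ _ _ (ints N) I (fun i => if i \in I then f i else 0)).
- by apply: eq_fsbigr => i ->.
- by move=> i /IN; rewrite /= mem_ints.
- exact: ints_uniq.
- by move=> i [/= _ Ii]; rewrite /= memNset.
Qed.

Theorem theorem2p3p3
  (R : realType) (d : measure_display) (T : measurableType d)
  (P : probability T R)
  (X : int -> {RV P >-> R})            (* the X_i, i in Z *)
  (F : R -> R)                         (* their common distribution function *)
  (c : int -> R)                       (* the weights c_i *)
  (h : R -> R)                         (* hazard rate of F *)
  (lambda : R) (m : nat) (i1 : int)    (* c_(1) = c i1 *)
  :
  (* independence, common distribution F *)
  mutually_independent P (fun i => (X i : T -> R)) ->
  (forall i t, dfun P (X i) t = F t) ->
  (* weights tend to 0 at infinity *)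
  (forall e : R, 0 < e -> exists N : nat, forall i : int, (N < `|i|)%N -> `|c i| < e) ->
  (* h is the hazard rate of F *)
  hazard_rate F h ->
  (* standard conditions *)
  (exists2 delta : R, 0 < delta < 1 &
     (\esum_(i in [set: int]) ((`|c i| `^ delta)%:E) < +oo)%E) ->
  ((exists t0 : R, forall t, t <= t0 -> F t = 0) \/
   ((* strongly tail balanced *)
    (exists2 l : R, 0 < l & ((1 - F t) / F (- t)) @[t --> +oo] --> l) /\
    exists hm : R -> R,
      hazard_rate (dfun P (fun w => - X 0 w)) hm /\
      (exists2 lambda' : R, 0 < lambda' & hazard_log_asymp lambda' hm) /\
      (exists alpha : R, smoothly_varying alpha m hm))) ->
  (* m positive, assumptions (i) and (ii) *)
  (0 < m)%N ->
  0 < lambda -> hazard_log_asymp lambda h ->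
  (exists alpha : R, smoothly_varying alpha m h) ->
  (* c_(1) = c i1 is a \prec-maximal weight *)
  (forall j : int, ~ wprec P (X 0) (c i1) (c j)) ->
  (* conclusion *)
  forall k : nat, (0 < k <= m)%N ->
    littleo_infty
      (fun t =>
         (1 - dfun P (wseries c (fun i => X i : T -> R) None) t)
         - \sum_(i \in [set i : int | wsucceq P (X 0) (c i)
                                        (c i1 * expR (- (k%:R / lambda)))])
             laplace_char
               (rv_moment P (wseries c (fun j => X j : T -> R) (Some i)))
               (k%:Z + Num.floor (lambda * ln `|c i / c i1|))
               (tailM P (X 0) (c i)) t)
      (fun t => h t ^+ k * tailM P (X 0) (c i1) t).
Proof.
move=> indep Fd c0 hazF [delta /andP[d0 d1] csum] std m0 l0 hlog [alpha sv] cmax k /andP[k0 km].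
have idd i (B : set R) : measurable B -> P (X i @^-1` B) = P (X 0 @^-1` B).
  by apply: prob_preimage_unique => t; rewrite !Fd.
have FE : F = dfun P (X 0) by apply/funext => t; rewrite Fd.
have HHp : logtail lambda m (tailM P (X 0) 1) h.
  rewrite (_ : tailM P (X 0) 1 = fun t => 1 - F t); first exact: (logtail_of_hazard m0 l0 hazF hlog sv).
  by apply/funext => t; rewrite tailM_dfun Fd.
have left_tail : (\forall v \near +oo, tailM P (X 0) (-1) v = 0) \/ balanced (X 0) m.
  case: std => [[t0 Ft0]|[[l ll Fl] [hm [hazm [[l' l'0 hml] [alpha' svm]]]]]].
    by left; apply: (@left_tail_null _ _ _ _ _ t0) => t /Ft0; rewrite FE.
  right; split; first by rewrite FE in Fl; exact: (tail_balanced m0 l0 HHp ll Fl).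
  exists l', hm => //.
  rewrite (_ : tailM P (X 0) (-1) = fun t => 1 - dfun P (fun w => - X 0 w) t).
    exact: (logtail_of_hazard m0 l'0 hazm hml svm).
  by apply/funext => t; rewrite tailM_dfunN.
have [ab bmax] := maximal_active l0 HHp left_tail cmax.
have b0 := active_neq0 ab.
have nb0 : 0 < `|c i1| by rewrite normr_gt0.
set b := c i1 in ab bmax b0 nb0 *.
set x := expR (- (k%:R / lambda)).
have x0 : 0 < x by exact: expR_gt0.
have x1 : x <= 1 by rewrite -[1](@expR0 R) ler_expR oppr_le0 divr_ge0// ltW.
pose W t := loghaz lambda t ^+ k * tailM P (X 0) b t.
(* The error is measured with [loghaz] instead of [h]; eventually [loghaz <= 2 * h], so the passage
   costs [2 ^+ k]. *)
suff main : littleo_infty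
      (fun t =>
         (1 - dfun P (wseries c (fun i => X i : T -> R) None) t)
         - \sum_(i \in [set i : int | wsucceq P (X 0) (c i) (b * x)])
             laplace_char
               (rv_moment P (wseries c (fun j => X j : T -> R) (Some i)))
               (k%:Z + Num.floor (lambda * ln `|c i / b|))
               (tailM P (X 0) (c i)) t) W.
  have c2 : 0 < 2 ^+ k :> R by rewrite exprn_gt0.
  apply: (littleo_ler c2 _ main).
  have l2 : lambda / 2 < lambda by rewrite ltr_pdivrMr// ltr_pMr// ltr1n.
  apply: filterS2 (hazard_ge l0 l2 hlog) (loghaz_gt0 l0) => t H1 L0.
  have H2 : loghaz lambda t <= 2 * h t by move: H1; rewrite /loghaz -mulrA; lra.
  have h0 : 0 <= h t by lra.
  rewrite !ger0_norm ?mulr_ge0 ?exprn_ge0 ?tailM_ge0 ?(ltW L0)//.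
  rewrite /W mulrA ler_wpM2r ?tailM_ge0// -exprMn lerXn2r ?nnegrE ?(ltW L0)//.
  by rewrite mulr_ge0.
have [A A0 sumA] := esum_seq_bound (fun i => powR_ge0 `|c i| delta) csum.
have p0 : 0 <= delta / (1 - delta) by rewrite divr_ge0 ?(ltW d0)// subr_ge0 ltW.
have Qdecay := abs_tail_decay l0 HHp left_tail p0.
have Qpoly := abs_tail_superpoly l0 HHp left_tail.
have Smoments := wseries_moments idd d0 d1 A0 sumA Qdecay Qpoly.
have Qfar := abs_tail_far l0 HHp left_tail k ab.
have Qpair := fun x y => @abs_tail_pair _ _ _ _ _ _ _ _ l0 HHp left_tail k b x y ab.
have bx0 : 0 < `|b| * x by rewrite mulr_gt0.
(* All indices with [|b| * x <= |c i|] are at most [N0] in absolute value, so the window contains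
   the whole index set of the expansion. *)
have [N0 HN0] := c0 _ bx0.
have [N NN0 dec] := decomposition indep idd d0 d1 sumA Qdecay Qfar Qpair N0.
have abx : active (X 0) m (b * x).
  case: ab => [pb|[bal nb]]; [left; exact: mulr_gt0|right; split => //].
  by rewrite nmulr_rlt0.
pose I := [set i : int | wsucceq P (X 0) (c i) (b * x)].
have IP i : I i <-> active (X 0) m (c i) /\ `|b| * x <= `|c i|.
  rewrite (_ : `|b| * x = `|b * x|); last by rewrite normrM (gtr0_norm x0).
  exact: (wsucceqP m0 l0 HHp).
pose L i t := laplace_char (rv_moment P (wseries c (fun j => X j : T -> R) (Some i)))
               (k%:Z + Num.floor (lambda * ln `|c i / b|)) (tailM P (X 0) (c i)) t.
pose J i t := prob P [set w | t < c i * X i w + wseries c (fun j => X j : T -> R) (Some i) w /\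
   `|wseries c (fun j => X j : T -> R) (Some i) w| <= t / 2].
(* Inactive weights have a negligible jump; active ones are expanded whether or not they belong to
   [I], since outside [I] their character is 0. *)
have per i : littleo_infty (fun t => J i t - (if i \in I then L i t else 0)) W.
  have [ai|na] := pselect (active (X 0) m (c i)); last first.
    apply: littleo_near (jump_littleo_inactive idd lambda left_tail b k na); apply: nearW => t.
    by rewrite memNset ?subr0// => /IP[].
  have JL : littleo_infty (fun t => J i t - L i t) W.
    move: (bmax _ ai); rewrite le_eqVlt => /orP[/eqP ib|ib].
      exact: (jump_littleo_max indep idd Smoments m0 l0 HHp ab km ai ib).
    exact: (jump_littleo_lt indep idd Smoments m0 l0 HHp ab km ai ib).
  have [iI|iI] := boolP (i \in I) => //.
  have L0 : L i = fun=> 0.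
    apply: (laplace_small l0 ab ai).
    rewrite ltNge; apply: contra iI => H.
    by apply/mem_set/IP.
  by move: JL; rewrite L0.
have := littleo_add dec (littleo_sum (s := ints N) (fun i _ => per i)).
apply: littleo_near; apply: nearW => t.
rewrite (@fsum_ints _ I N); last first.
  move=> i /IP[_ H]; rewrite leqNgt; apply/negP => Ni.
  by move: H; rewrite leNgt HN0// (leq_ltn_trans NN0).
rewrite sumrB addrA subrK; congr (_ - _).
rewrite /dfun -probC.
  by congr (prob P _); apply/seteqP; split=> w /=; rewrite ltNge => /negP.
rewrite -[X in measurable X]setCK; apply: measurableC.
rewrite (_ : ~` _ = [set w | t < wseries c (fun i => X i : T -> R) None w]).
  exact: measurable_wseries_gt.
by apply/seteqP; split=> w /=; rewrite ltNge => /negP.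
Qed.
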